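(* Let $k$ be a field, let $(R,\mathfrak m)$ be a regular local ring of Krull dimension $n$ containing $k$ with residue field $k$, let $w\in\mathfrak m$ be non-zero, $S=R/w$, let $\partial_1,\dots,\partial_n$ be $k$-linear derivations of $R$, and let $\Omega_w=S/(\partial_1w,\dots,\partial_nw)$. Let $X$ be a matrix factorization of $w$ of possibly infinite rank, given by $\varphi:X^1\to X^0$ and $\psi:X^0\to X^1$, and let $M=\operatorname{coker}(\varphi)$. Then the following are equivalent: (1) $M$ is a free $S$-module. (2) $M$ is a flat $S$-module. (3) $\operatorname{Tor}^S_i(N,M)=0$ for every finitely generated $S$-module $N$ and all $i>0$. (4) $\operatorname{Tor}^S_i(N,M)=0$ for every finitely generated $\Omega_w$-module $N$ and all $i>0$. If $w$ has an isolated singularity, in the sense that $\dim_k\Omega_w<\infty$, then conditions (1), (2), (3) and (4) are equivalent to (5) $\operatorname{Tor}^S_i(k,M)=0$ for all $i>0$.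
   Context: A matrix factorization of $w$ of possibly infinite rank is a pair of free $R$-modules $X^0,X^1$ of possibly infinite rank with $R$-linear maps $\varphi:X^1\to X^0$, $\psi:X^0\to X^1$ such that $\varphi\psi=w\,\mathrm{id}_{X^0}$ and $\psi\varphi=w\,\mathrm{id}_{X^1}$. Its cokernel $M=\operatorname{coker}(\varphi)$ is annihilated by $w$, hence is an $S$-module. *)

(* Defs.v *)
From HB Require Import structures.
From mathcomp Require Import all_boot all_order all_algebra.
From mathcomp Require Import finmap.
From mathcomp Require Import boolp classical_sets functions cardinality fsbigop.

Set Implicit Arguments.
Unset Strict Implicit.
Unset Printing Implicit Defensive.

Import GRing.Theory.
Import Quotient.
Local Open Scope classical_set_scope.
Local Open Scope ring_scope.
Local Open Scope quotient_scope.

(* Membership in mathcomp's collective predicates is boolean; arbitrary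
   (undecidable) submodules and ideals are covered through [asbool]. *)

Section Submodules.
Variables (R : pzRingType) (V : lmodType R).

Definition span (A : set V) : {pred V} := fun x =>
  `[< exists2 s : seq (R * V), (forall p, p \in s -> A p.2) &
        x = \sum_(p <- s) p.1 *: p.2 >].

Lemma span_submod (A : set V) : submod_closed (span A).
Proof.
split; first by apply/asboolP; exists [::]; rewrite ?big_nil.
move=> a u v /asboolP[s sA ->] /asboolP[t tA ->]; apply/asboolP.
exists ([seq (a * p.1, p.2) | p <- s] ++ t).
  move=> p; rewrite mem_cat => /orP[/mapP[q /sA Aq ->] // | /tA //].
rewrite big_cat big_map /= scaler_sumr; congr (_ + _).
by apply: eq_bigr => p _; rewrite scalerA.
Qed.
HB.instance Definition _ (A : set V) :=
  GRing.isSubmodClosed.Build R V (span A) (span_submod A).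

Definition subm (W : submodClosed V) := {x : V | x \in W}.
HB.instance Definition _ (W : submodClosed V) := SubType.on (subm W).
HB.instance Definition _ (W : submodClosed V) := Choice.on (subm W).
HB.instance Definition _ (W : submodClosed V) :=
  [SubChoice_isSubLmodule of subm W by <:].

Definition fingen : Prop :=
  exists n (e : 'I_n -> V), forall v : V, v \in span (range e).

End Submodules.

Section KerIm.
Variables (R : pzRingType) (U V : lmodType R) (f : {linear U -> V}).

Definition kerp : {pred U} := fun x => f x == 0.
Lemma kerp_submod : submod_closed kerp.
Proof.
split; rewrite /kerp ?unfold_in ?raddf0 // => a u v.
by rewrite !unfold_in linearP => /eqP-> /eqP->; rewrite scaler0 addr0.
Qed.
HB.instance Definition _ := GRing.isSubmodClosed.Build R U kerp kerp_submod.

Definition imp : {pred V} := fun y => `[< exists x, y = f x >].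
Lemma imp_submod : submod_closed imp.
Proof.
split; first by apply/asboolP; exists 0; rewrite raddf0.
move=> a u v /asboolP[x ->] /asboolP[y ->]; apply/asboolP.
by exists (a *: x + y); rewrite linearP.
Qed.
HB.instance Definition _ := GRing.isSubmodClosed.Build R V imp imp_submod.

End KerIm.

Section QuotientModule.
Variables (R : pzRingType) (V : lmodType R) (W : submodClosed V).

Fact submod_zmod_closed : zmod_closed W.
Proof. exact: GRing.submod_closedB (submodClosedP W). Qed.
Definition submod_zmod : {pred V} := fun x => x \in W.
HB.instance Definition _ :=
  GRing.isZmodClosed.Build V submod_zmod submod_zmod_closed.

Definition quotmod : Type := {quot submod_zmod}.
HB.instance Definition _ := GRing.Zmodule.on quotmod.

Definition qmod (x : V) : quotmod := \pi_{quot submod_zmod} x.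
Lemma qmod_zmod : zmod_morphism qmod.
Proof. by move=> x y; rewrite /qmod raddfB. Qed.
HB.instance Definition _ := GRing.isZmodMorphism.Build V quotmod qmod qmod_zmod.

Definition qrepr (x : quotmod) : V := repr (x : {quot submod_zmod}).
Lemma qreprK : cancel qrepr qmod. Proof. by move=> x; exact: reprK. Qed.

Lemma qmod_eqP x y : reflect (qmod x = qmod y) (x - y \in W).
Proof. by rewrite (@idealrBE _ submod_zmod); exact: eqP. Qed.

Definition qmod_scale a (x : quotmod) : quotmod := qmod (a *: qrepr x).
Lemma qmod_scaleE a x : qmod_scale a (qmod x) = qmod (a *: x).
Proof.
by apply/qmod_eqP; rewrite -scalerBr rpredZ //; apply/qmod_eqP; rewrite qreprK.
Qed.

Fact quotmod_scalerA a b x :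
  qmod_scale a (qmod_scale b x) = qmod_scale (a * b) x.
Proof. by rewrite -[x]qreprK !qmod_scaleE scalerA. Qed.
Fact quotmod_scale1r : left_id 1 qmod_scale.
Proof. by move=> x; rewrite -[x]qreprK qmod_scaleE scale1r. Qed.
Fact quotmod_scalerDr : right_distributive qmod_scale +%R.
Proof.
move=> a x y; rewrite -[x]qreprK -[y]qreprK -raddfD !qmod_scaleE.
by rewrite scalerDr raddfD.
Qed.
Fact quotmod_scalerDl x : {morph qmod_scale^~ x : a b / a + b}.
Proof.
by move=> a b; rewrite -[x]qreprK !qmod_scaleE scalerDl raddfD.
Qed.
HB.instance Definition _ := GRing.Zmodule_isLmodule.Build R quotmod
  quotmod_scalerA quotmod_scale1r quotmod_scalerDr quotmod_scalerDl.

Fact qmod_scalable : scalable qmod.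
Proof. by move=> a x; rewrite -qmod_scaleE. Qed.
HB.instance Definition _ :=
  GRing.isScalable.Build R V quotmod *:%R qmod qmod_scalable.


Section QuotientLift.
Variables (U : lmodType R) (f : {linear V -> U}).
Hypothesis f0 : forall x, x \in W -> f x = 0.

Definition qlift (x : quotmod) : U := f (qrepr x).
Lemma qliftE x : qlift (qmod x) = f x.
Proof.
by apply/eqP; rewrite -subr_eq0 /qlift -linearB f0 //; apply/qmod_eqP; rewrite qreprK.
Qed.
Lemma qlift_linear : linear qlift.
Proof.
move=> a x y; rewrite -[x]qreprK -[y]qreprK.
by rewrite -linearP !qliftE linearP.
Qed.
End QuotientLift.

End QuotientModule.
Arguments qmod {R V} W x.

Section QuotientRing.
Variables (R : comPzRingType) (I : submodClosed R^o).

(* [{ideal_quot I}] is not used because it is restricted to proper ideals,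
   whereas S/(d_1 w, ..., d_n w) may be the zero ring. *)
Definition quotring : Type := quotmod I.
HB.instance Definition _ := GRing.Zmodule.on quotring.

Definition qring (x : R) : quotring := qmod I x.
Lemma qring_zmod : zmod_morphism qring.
Proof. by move=> x y; rewrite /qring -raddfB. Qed.
HB.instance Definition _ := GRing.isZmodMorphism.Build R quotring qring qring_zmod.

Definition qrrepr (x : quotring) : R := qrepr (x : quotmod I).
Lemma qrreprK : cancel qrrepr qring. Proof. exact: qreprK. Qed.

Lemma qring_eqP (x y : R) : reflect (qring x = qring y) ((x - y : R^o) \in I).
Proof. exact: qmod_eqP. Qed.

Lemma idealMl (a x : R) : (x : R^o) \in I -> (a * x : R^o) \in I.
Proof. exact: (@rpredZ _ _ I a x). Qed.

Definition qmul (x y : quotring) : quotring := qring (qrrepr x * qrrepr y).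
Lemma qmulE x y : qmul (qring x) (qring y) = qring (x * y).
Proof.
apply/qring_eqP; set x' := qrrepr _; set y' := qrrepr _.
have Ix : (x' - x : R^o) \in I by apply/qring_eqP; rewrite qrreprK.
have Iy : (y' - y : R^o) \in I by apply/qring_eqP; rewrite qrreprK.
have -> : x' * y' - x * y = y' * (x' - x) + x * (y' - y) :> R.
  by rewrite !mulrBr (mulrC y' x') (mulrC y' x) addrA subrK.
by apply: (@rpredD _ I); apply: idealMl.
Qed.

Fact qmulA : associative qmul.
Proof.
by move=> x y z; rewrite -[x]qrreprK -[y]qrreprK -[z]qrreprK !qmulE mulrA.
Qed.
Fact qmulC : commutative qmul.
Proof. by move=> x y; rewrite /qmul mulrC. Qed.
Fact qmul1 : left_id (qring 1) qmul.
Proof. by move=> x; rewrite -[x]qrreprK qmulE mul1r. Qed.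
Fact qmulDl : left_distributive qmul +%R.
Proof.
move=> x y z; rewrite -[x]qrreprK -[y]qrreprK -[z]qrreprK.
by rewrite -raddfD !qmulE mulrDl raddfD.
Qed.
HB.instance Definition _ := GRing.Zmodule_isComPzRing.Build quotring
  qmulA qmulC qmul1 qmulDl.

Fact qring_monoid : monoid_morphism qring.
Proof. by split=> // x y; rewrite -qmulE. Qed.
HB.instance Definition _ :=
  GRing.isMonoidMorphism.Build R quotring qring qring_monoid.

End QuotientRing.
Arguments qring {R} I x.

(* The R/I-module carried by an R-module annihilated by I. *)
Section AnnihilatedModule.
Variables (R : comPzRingType) (I : submodClosed R^o) (V : lmodType R).
Definition annihilates := forall a : R, (a : R^o) \in I -> forall v : V, a *: v = 0.
Hypothesis annI : annihilates.

Definition annmod (_ : annihilates) : Type := V.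
Local Notation V' := (annmod annI).
HB.instance Definition _ := GRing.Zmodule.on V'.

Definition ann_scale (s : quotring I) (v : V') : V' := qrrepr s *: (v : V).
Lemma ann_scaleE a v : ann_scale (qring I a) v = a *: (v : V).
Proof.
apply/eqP; rewrite -subr_eq0 /ann_scale -scalerBl annI //.
by apply/qring_eqP; rewrite qrreprK.
Qed.
Fact ann_scalerA a b v : ann_scale a (ann_scale b v) = ann_scale (a * b) v.
Proof.
by rewrite -[a]qrreprK -[b]qrreprK -rmorphM !ann_scaleE scalerA.
Qed.
Fact ann_scale1r : left_id 1 ann_scale.
Proof. by move=> v; rewrite ann_scaleE scale1r. Qed.
Fact ann_scalerDr : right_distributive ann_scale +%R.
Proof. by move=> a u v; rewrite /ann_scale scalerDr. Qed.
Fact ann_scalerDl v : {morph ann_scale^~ v : a b / a + b}.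
Proof.
move=> a b; rewrite -[a]qrreprK -[b]qrreprK -raddfD !ann_scaleE.
by rewrite scalerDl.
Qed.
HB.instance Definition _ := GRing.Zmodule_isLmodule.Build (quotring I) V'
  ann_scalerA ann_scale1r ann_scalerDr ann_scalerDl.
End AnnihilatedModule.

Section RestrictionOfScalars.
Variables (R S : pzRingType) (f : {rmorphism R -> S}) (V : lmodType S).
Definition restr (_ : {rmorphism R -> S}) : Type := V.
HB.instance Definition _ := GRing.Zmodule.on (restr f).
Definition restr_scale (a : R) (v : restr f) : restr f := f a *: (v : V).
Fact restr_scalerA a b v :
  restr_scale a (restr_scale b v) = restr_scale (a * b) v.
Proof. by rewrite /restr_scale scalerA rmorphM. Qed.
Fact restr_scale1r : left_id 1 restr_scale.
Proof. by move=> v; rewrite /restr_scale rmorph1 scale1r. Qed.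
Fact restr_scalerDr : right_distributive restr_scale +%R.
Proof. by move=> a u v; rewrite /restr_scale scalerDr. Qed.
Fact restr_scalerDl v : {morph restr_scale^~ v : a b / a + b}.
Proof. by move=> a b; rewrite /restr_scale rmorphD scalerDl. Qed.
HB.instance Definition _ := GRing.Zmodule_isLmodule.Build R (restr f)
  restr_scalerA restr_scale1r restr_scalerDr restr_scalerDl.
End RestrictionOfScalars.

(* The free module on the set T: finitely supported functions T -> R. *)
Section FreeModule.
Variables (R : pzRingType) (T : choiceType).

Definition finsuppp : {pred T -> R^o} := fun f => `[< finite_set (f @^-1` [set~ 0]) >].
Fact finsuppp_submod : submod_closed finsuppp.
Proof.
split; first by apply/asboolP; rewrite (_ : _ @^-1` _ = set0) // -subset0 => x [].
move=> a u v /asboolP fu /asboolP fv; apply/asboolP.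
apply: (@sub_finite_set _ _ ((u @^-1` [set~ 0]) `|` (v @^-1` [set~ 0]))); last first.
  by rewrite finite_setU.
move=> t /=; apply: contra_notP => /not_orP[/contrapT u0 /contrapT v0].
by rewrite !fctE u0 v0 scaler0 addr0.
Qed.
HB.instance Definition _ :=
  GRing.isSubmodClosed.Build R (T -> R^o) finsuppp finsuppp_submod.

Definition freemod : Type := subm finsuppp.
HB.instance Definition _ := GRing.Lmodule.on freemod.

Definition fcoef (x : freemod) : T -> R := val (x : subm finsuppp).

Fact fdelta_subproof (t : T) : ((fun s => (s == t)%:R) : T -> R^o) \in finsuppp.
Proof.
apply/asboolP; apply: (@sub_finite_set _ _ [set t]) => // s /=.
by case: eqVneq => //= _ /(_ erefl).
Qed.
Definition fdelta (t : T) : freemod :=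
  exist (fun f : T -> R^o => f \in finsuppp) _ (fdelta_subproof t).

Lemma fcoef_finite (x : freemod) : finite_set [set t | fcoef x t != 0].
Proof.
have /asboolP := valP (x : subm finsuppp); apply: sub_finite_set => t /=.
by move/eqP.
Qed.

Section FreeLift.
Variables (V : lmodType R) (u : T -> V).
Definition freelift (x : freemod) : V := \sum_(t \in [set: T]) (fcoef x t *: u t).

Lemma freeliftE (A : {fset T}) (x : freemod) :
  (forall t, t \notin A -> fcoef x t = 0) ->
  freelift x = \sum_(t <- A) fcoef x t *: u t.
Proof. by move=> xA; apply: fsbigTE => t /xA ->; rewrite scale0r. Qed.

Fact freelift_linear : linear freelift.
Proof.
move=> a x y.
pose A := (fset_set [set t | fcoef x t != 0] `|`
           fset_set [set t | fcoef y t != 0])%fset.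
have Ax t : t \notin A -> fcoef x t = 0.
  rewrite in_fsetU => /norP[+ _]; apply: contraNeq => xt.
  by rewrite in_fset_set ?inE //; exact: fcoef_finite.
have Ay t : t \notin A -> fcoef y t = 0.
  rewrite in_fsetU => /norP[_]; apply: contraNeq => yt.
  by rewrite in_fset_set ?inE //; exact: fcoef_finite.
have xyE t : fcoef (a *: x + y) t = a * fcoef x t + fcoef y t by [].
rewrite (freeliftE Ax) (freeliftE Ay) (@freeliftE A); last first.
  by move=> t At; rewrite xyE Ax // Ay // mulr0 addr0.
rewrite scaler_sumr -big_split /=; apply: eq_bigr => t _.
by rewrite xyE scalerDl scalerA.
Qed.
HB.instance Definition _ :=
  GRing.isLinear.Build R freemod V *:%R freelift freelift_linear.

Lemma freelift_delta t : freelift (fdelta t) = u t.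
Proof.
rewrite (@freeliftE [fset t]%fset) ?big_seq_fset1 /fcoef /= ?eqxx ?scale1r //.
by move=> s; rewrite inE => /negPf ->.
Qed.
End FreeLift.
End FreeModule.
Arguments freemod : clear implicits.
Arguments fdelta {R T} t.

Definition free_module (R : pzRingType) (V : lmodType R) : Prop :=
  exists (T : choiceType) (f : {linear freemod R T -> V}), bijective f.

Section Tensor.
Variables (S : comPzRingType) (N M : lmodType S).

Local Notation F := (freemod S (N * M)%type).
Definition tens_rel : set F := [set x |
  [\/ exists n n' m, x = fdelta (n + n', m) - fdelta (n, m) - fdelta (n', m),
      exists n m m', x = fdelta (n, m + m') - fdelta (n, m) - fdelta (n, m'),
      exists a n m, x = fdelta (a *: n, m) - a *: fdelta (n, m) |
      exists a n m, x = fdelta (n, a *: m) - a *: fdelta (n, m)]].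
Definition tens : Type := quotmod (span tens_rel).
HB.instance Definition _ := GRing.Lmodule.on tens.
Definition tensor (n : N) (m : M) : tens := qmod (span tens_rel) (fdelta (n, m)).

Lemma tens_rel0 (x : F) :
  x \in tens_rel -> qmod (span tens_rel) x = 0.
Proof.
rewrite inE => xr; rewrite -(raddf0 (qmod (span tens_rel))).
apply/qmod_eqP; rewrite subr0; apply/asboolP; exists [:: (1, x)].
  by move=> p; rewrite inE => /eqP ->.
by rewrite big_seq1 scale1r.
Qed.

Lemma tensorDl n n' m : tensor (n + n') m = tensor n m + tensor n' m.
Proof.
apply/eqP; rewrite -subr_eq0 opprD addrA /tensor -!raddfB; apply/eqP.
by apply: tens_rel0 => //; rewrite inE; apply: Or41; exists n, n', m.
Qed.
Lemma tensorDr n m m' : tensor n (m + m') = tensor n m + tensor n m'.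
Proof.
apply/eqP; rewrite -subr_eq0 opprD addrA /tensor -!raddfB; apply/eqP.
by apply: tens_rel0 => //; rewrite inE; apply: Or42; exists n, m, m'.
Qed.
Lemma tensorZl a n m : tensor (a *: n) m = a *: tensor n m.
Proof.
apply/eqP; rewrite -subr_eq0 /tensor -linearZ -raddfB; apply/eqP.
by apply: tens_rel0 => //; rewrite inE; apply: Or43; exists a, n, m.
Qed.
Lemma tensorZr a n m : tensor n (a *: m) = a *: tensor n m.
Proof.
apply/eqP; rewrite -subr_eq0 /tensor -linearZ -raddfB; apply/eqP.
by apply: tens_rel0 => //; rewrite inE; apply: Or44; exists a, n, m.
Qed.
End Tensor.

Section TensorMap.
Variables (S : comPzRingType) (N N' M : lmodType S) (f : {linear N -> N'}).

Definition tensmap_pre : freemod S (N * M)%type -> tens N' M :=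
  freelift (fun p => tensor (f p.1) p.2).
HB.instance Definition _ := GRing.Linear.on tensmap_pre.

Fact tensmap_pre0 x : x \in span (@tens_rel S N M) -> tensmap_pre x = 0.
Proof.
case/asboolP => s sr ->; rewrite linear_sum big_seq big1 // => p /sr rp.
rewrite linearZ /=; suff -> : tensmap_pre p.2 = 0 by rewrite scaler0.
case: rp => [[n [n' [m ->]]]|[n [m [m' ->]]]|[a [n [m ->]]]|[a [n [m ->]]]].
- by rewrite !raddfB /= /tensmap_pre !freelift_delta /= raddfD tensorDl
     -addrA -opprD subrr.
- by rewrite !raddfB /= /tensmap_pre !freelift_delta /= tensorDr
     -addrA -opprD subrr.
- by rewrite linearB linearZ /= /tensmap_pre !freelift_delta /= linearZ tensorZl subrr.
- by rewrite linearB linearZ /= /tensmap_pre !freelift_delta /= tensorZr subrr.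
Qed.

(* f (x) id_M : N (x) M -> N' (x) M *)
Definition tensmap : tens N M -> tens N' M := qlift tensmap_pre.
HB.instance Definition _ := GRing.isLinear.Build S (tens N M) (tens N' M)
  *:%R tensmap (qlift_linear tensmap_pre0).

Lemma tensmapE n m : tensmap (tensor n m) = tensor (f n) m.
Proof.
by rewrite /tensmap [tensor n m]/tensor (qliftE tensmap_pre0) /=
  /tensmap_pre freelift_delta.
Qed.
End TensorMap.
Arguments tensmap {S N N'} M f.

Definition flat_module (S : comPzRingType) (M : lmodType S) : Prop :=
  forall (N N' : lmodType S) (f : {linear N -> N'}),
    injective f -> injective (tensmap M f).

Section Homology.
Variables (R : pzRingType) (U V W : lmodType R).
Variables (f : {linear U -> V}) (g : {linear V -> W}).
Definition bdry : {pred subm (kerp g)} := fun x => val x \in imp f.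
Fact bdry_submod : submod_closed bdry.
Proof.
split; first by change (0 \in imp f); exact: rpred0.
move=> a u v fu fv; change (a *: val u + val v \in imp f).
by apply: rpredD; first apply: rpredZ.
Qed.
HB.instance Definition _ :=
  GRing.isSubmodClosed.Build R (subm (kerp g)) bdry bdry_submod.
Definition homology : Type := quotmod bdry.
HB.instance Definition _ := GRing.Lmodule.on homology.
End Homology.

(* Tor_i(N, M) is the homology of F (x) M for the standard free resolution
   ... -> F_1 -> F_0 -> N, where F_i is free on the underlying set of the i-th
   syzygy Z_i, with Z_0 = N and Z_(i+1) = ker (F_i -> Z_i). *)
Section Resolution.
Variables (S : comPzRingType) (N : lmodType S).

Definition aug (Z : lmodType S) : freemod S Z -> Z := freelift (@idfun Z).
HB.instance Definition _ (Z : lmodType S) := GRing.Linear.on (@aug Z).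

Fixpoint syz (i : nat) : lmodType S :=
  if i is j.+1 then subm (kerp (@aug (syz j))) else N.

Definition resol (i : nat) : lmodType S := freemod S (syz i).

Definition resol_d (i : nat) : resol i.+1 -> resol i :=
  fun x => val (@aug (syz i.+1) x : subm (kerp (@aug (syz i)))).
Fact resol_d_linear i : linear (@resol_d i).
Proof. by move=> a x y; rewrite /resol_d !linearP. Qed.
HB.instance Definition _ i :=
  GRing.isLinear.Build S (resol i.+1) (resol i) *:%R (@resol_d i) (@resol_d_linear i).

End Resolution.

Definition Tor (S : comPzRingType) (i : nat) (N M : lmodType S) : lmodType S :=
  if i is j.+1 then
    homology (tensmap M (@resol_d S N j.+1)) (tensmap M (@resol_d S N j))
  else quotmod (imp (tensmap M (@resol_d S N 0))).

Definition zero_module (R : pzRingType) (V : lmodType R) : Prop :=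
  forall x : V, x = 0.

Section RegularLocal.
Variable R : comNzRingType.
Notation ideal := (submodClosed R^o).

Definition maximal_ideal (m : ideal) : Prop :=
  1 \notin m /\ forall J : ideal,
    1 \notin J -> {subset m <= J} -> J =i m.

Definition local_ring (m : ideal) : Prop :=
  maximal_ideal m /\ forall m' : ideal, maximal_ideal m' -> m' =i m.

Definition noetherian : Prop :=
  forall I : ideal, exists n (g : 'I_n -> R^o), I =i span (range g).

Definition prime_chain n (P : 'I_n.+1 -> prime_idealr R) : Prop :=
  forall i j : 'I_n.+1, (i < j)%N ->
    {subset P i <= P j} /\ ~ {subset P j <= P i}.

Definition krull_dim (n : nat) : Prop :=
  (exists P : 'I_n.+1 -> prime_idealr R, prime_chain P) /\
  forall l (P : 'I_l.+1 -> prime_idealr R), prime_chain P -> (l <= n)%N.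

(* R is noetherian and local with maximal ideal m, has dimension n, and m can be
   generated by n elements. *)
Definition regular_local (m : ideal) (n : nat) : Prop :=
  [/\ noetherian, local_ring m, krull_dim n &
      exists g : 'I_n -> R^o, m =i span (range g)].

End RegularLocal.

Definition derivation (k : pzRingType) (R : comAlgType k) (D : {linear R -> R}) : Prop :=
  forall a b : R, D (a * b) = D a * b + a * D b.

(* The residue field R/m is k: the composite k -> R -> R/m is an isomorphism. *)
Definition residue_field_is (k : fieldType) (R : comAlgType k)
    (m : submodClosed R^o) : Prop :=
  bijective (fun c : k => qring m (c%:A : R)).

Definition principal (R : comPzRingType) (w : R) : submodClosed R^o :=
  span [set w : R^o].

Record matfac (R : comPzRingType) (w : R) := Matfac {
  mf0 : lmodType R;
  mf1 : lmodType R;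
  mf_phi : {linear mf1 -> mf0};
  mf_psi : {linear mf0 -> mf1};
  mf_free0 : free_module mf0;
  mf_free1 : free_module mf1;
  mf_phiK : forall x, mf_phi (mf_psi x) = w *: x;
  mf_psiK : forall x, mf_psi (mf_phi x) = w *: x
}.

Section Hypersurface.
Variables (R : comPzRingType) (w : R).
Local Notation S := (quotring (principal w)).

Fact annihilates_principal (V : lmodType R) :
  (forall v : V, w *: v = 0) -> annihilates (principal w) V.
Proof.
move=> wV a /asboolP[s sw ->] v; rewrite scaler_suml big_seq big1 // => p /sw ->.
by rewrite -scalerA wV scaler0.
Qed.

Fact coker_ann (X : matfac w) :
  annihilates (principal w) (quotmod (imp (mf_phi X))).
Proof.
apply: annihilates_principal => v; rewrite -[v]qreprK -linearZ.
rewrite -(raddf0 (qmod (imp (mf_phi X)))); apply/qmod_eqP; rewrite subr0.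
by apply/asboolP; exists (mf_psi X (qrepr v)); rewrite mf_phiK.
Qed.
Definition coker (X : matfac w) : lmodType S := annmod (@coker_ann X).

Fact residue_ann (m : submodClosed R^o) :
  (w : R^o) \in m -> annihilates (principal w) (quotmod m).
Proof.
move=> wm; apply: annihilates_principal => v; rewrite -[v]qreprK -linearZ.
rewrite -(raddf0 (qmod m)); apply/qmod_eqP.
rewrite subr0; have := idealMl (qrepr v : R) wm; by rewrite mulrC.
Qed.
(* The S-module R/m, i.e. the residue field. *)
Definition residue_module (m : submodClosed R^o) (wm : (w : R^o) \in m) :
  lmodType S := annmod (@residue_ann m wm).
End Hypersurface.

Section Jacobian.
Variables (k : fieldType) (R : comAlgType k) (w : R).
Variables (n : nat) (D : 'I_n -> {linear R -> R}).
(* The ideal of S = R/w generated by the classes of d_1 w, ..., d_n w. *)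
Definition jacobian_ideal : submodClosed (quotring (principal w))^o :=
  span [set x : (quotring (principal w))^o | exists i, x = qring (principal w) (D i w)].
Definition Omega : comPzRingType := quotring jacobian_ideal.
Definition Omega_proj : {rmorphism quotring (principal w) -> Omega} :=
  qring jacobian_ideal.
(* dim_k Omega < oo, with k acting on Omega through k -> R -> S -> Omega. *)
Definition isolated_singularity : Prop :=
  fingen (restr Omega^o (Omega_proj \o qring (principal w) \o in_alg R)).
End Jacobian.

(* Main.v *)
(* Choose bases of X^0 and X^1 and reduce modulo w: the factorization becomes an
   odd endomorphism d with d^2 = 0 of a free S-module F on a set T. It is exact
   because w is a nonzerodivisor, R being a domain, and it resolves M
   periodically, so that vanishing of Tor(N, M) means exactness of d on the direct
   sum of copies of N indexed by T.

   Differentiating d^2 = w shows that each d_i w is null-homotopic on this complex.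
   Hence an ideal I maximal among those for which the complex with coefficients in
   S/I is not exact contains every d_i w, and (4) excludes this; for an isolated
   singularity, I would have the maximal ideal as an associated prime, and (5)
   excludes this. So d is exact with coefficients in every finitely generated N.

   Taking for N a quotient of a finite free module by suitable linear forms gives,
   for each finite subset U of T, a linear s with d (s g) = g for all cycles g
   supported in U. Subsets B of T spanning a subcomplex with this same property are
   closed under unions of chains, and each can be enlarged by a countable set in
   such a way that, by Kaplansky's argument for projective modules over a local
   ring, the cycles supported in B' are those supported in B plus a free complement.
   Zorn's lemma then provides a basis of the odd cycles, a module isomorphic to M. *)

From HB Require Import structures.
Require Import Defs.
From mathcomp Require Import all_boot all_order all_algebra.
From mathcomp Require Import finmap.
From mathcomp Require Import boolp classical_sets functions cardinality fsbigop.
From mathcomp Require Import ring.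

Set Implicit Arguments.
Unset Strict Implicit.
Unset Printing Implicit Defensive.

Import GRing.Theory.
Local Open Scope ring_scope.
Local Notation span := Defs.span.

(** * Regular local rings are domains *)

Section Ideals.
Variable A : comPzRingType.
Implicit Types (I J K P Q N C : A -> Prop) (a b r s x y : A).

(** Without finite generation a flat module over a local ring need not be free: the fraction field
    of a discrete valuation ring is flat, and Nakayama's lemma says nothing about it. What rescues
    [M] is periodicity. The cokernel is also the module of odd cycles, so it sits inside a free
    module, where every element has finite support, and exactness with finitely generated
    coefficients turns into contractions that read only finitely many coordinates. These
    contractions depend on the finite set, and nothing makes two of them compatible, so no global
    splitting can be read off; this is why a basis is assembled along a transfinite chain of
    subcomplexes. That regular local rings are domains rests on a count: [m] has n generators and
    some chain of primes has n strict steps, so each step uses up one generator and none is left to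
    make the bottom prime non-zero. *)

Definition incl I J := forall x, I x -> J x.

Definition idealP I :=
  [/\ I 0, forall x y, I x -> I y -> I (x + y) & forall a x, I x -> I (a * x)].

Definition primeP P :=
  [/\ idealP P, ~ P 1 & forall a b, P (a * b) -> P a \/ P b].

Definition colon I a b := I (b * a).

Definition addp I x a := exists b r, I b /\ a = b + r * x.

(* Ideals saturated with respect to the complement of N correspond to the
   ideals of the localization at N. *)
Definition saturated N I := idealP I /\ forall s a, ~ N s -> I (s * a) -> I a.

Definition sat N I a := exists2 s, ~ N s & I (s * a).

Definition max_condition := forall F : (A -> Prop) -> Prop,
  (forall I, F I -> idealP I) -> (exists I, F I) ->
  exists2 I, F I & forall J, F J -> incl I J -> incl J I.

Lemma idealN I x : idealP I -> I x -> I (- x).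
Proof. by case=> _ _ IM Ix; rewrite -mulN1r; apply: IM. Qed.

Lemma idealB I x y : idealP I -> I x -> I y -> I (x - y).
Proof. by move=> II Ix Iy; case: (II) => _ ID _; apply: ID => //; apply: idealN. Qed.

Lemma ideal_colon I a : idealP I -> idealP (colon I a).
Proof.
case=> I0 ID IM; rewrite /colon; split; first by rewrite mul0r.
  by move=> x y Ix Iy; rewrite mulrDl; apply: ID.
by move=> b x Ix; rewrite -mulrA; apply: IM.
Qed.

Lemma ideal_addp I x : idealP I -> idealP (addp I x).
Proof.
move=> II; case: (II) => I0 ID IM; split.
- by exists 0, 0; rewrite mul0r addr0.
- move=> _ _ [b [r [Ib ->]]] [c [s [Ic ->]]].
  by exists (b + c), (r + s); split; [apply: ID | ring].
- move=> a _ [b [r [Ib ->]]]; exists (a * b), (a * r).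
  by split; [apply: IM | ring].
Qed.

Lemma addp_incl I x : incl I (addp I x).
Proof. by move=> a Ia; exists a, 0; rewrite mul0r addr0. Qed.

Lemma addp_gen I x : idealP I -> addp I x x.
Proof. by case=> I0 _ _; exists 0, 1; rewrite mul1r add0r. Qed.

Lemma ideal_sat N I : primeP N -> idealP I -> saturated N (sat N I).
Proof.
case=> _ N1 NM [I0 ID IM].
have NMn s t : ~ N s -> ~ N t -> ~ N (s * t) by move=> ns nt /NM[].
split; last by move=> s a Ns [t Nt It]; exists (t * s); rewrite -?mulrA //; apply: NMn.
split; first by exists 1; rewrite ?mulr0.
- move=> x y [s Ns Ix] [t Nt Iy]; exists (s * t); first exact: NMn.
  have -> : s * t * (x + y) = t * (s * x) + s * (t * y) by ring.
  by apply: ID; apply: IM.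
- by move=> a x [s Ns Ix]; exists s => //; rewrite mulrCA; apply: IM.
Qed.

Lemma sat_incl N I : primeP N -> incl I (sat N I).
Proof. by move=> [_ N1 _] x Ix; exists 1; rewrite ?mul1r. Qed.

Lemma sat_sub N I J : saturated N J -> incl I J -> incl (sat N I) J.
Proof. by move=> [_ JN] IJ x [s Ns /IJ]; apply: JN. Qed.

Hypothesis noethA : max_condition.

(** A maximal [colon I a] with [a] outside [I] is prime: if it contains b c but not b, then
    [colon I (b * a)] is another candidate, hence no larger, and it contains c. *)
Lemma colon_prime I : idealP I -> ~ I 1 ->
  exists2 a, ~ I a & primeP (colon I a).
Proof.
move=> II I1.
have [||K [a Ia ->] maxK] :=
    @noethA (fun K => exists2 a, ~ I a & K = colon I a).
- by move=> K [a _ ->]; apply: ideal_colon.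
- by exists (colon I 1), 1.
exists a => //; split; first exact: ideal_colon.
  by rewrite /colon mul1r.
move=> b c Ibc; have [|Ib] := EM (colon I a b); [by left | right].
have /maxK : exists2 a', ~ I a' & colon I (b * a) = colon I a' by exists (b * a).
case: (II) => _ _ IM; move=> H; apply: H.
  move=> x; rewrite /colon mulrCA; exact: IM.
by rewrite /colon mulrA (mulrC c).
Qed.

(** For a maximal proper ideal [K] the associated prime [colon K a] contains [K], hence equals
    it. *)
Lemma exists_prime I : idealP I -> ~ I 1 ->
  exists P, [/\ primeP P, incl I P & forall J, idealP J -> ~ J 1 -> incl P J -> incl J P].
Proof.
move=> II I1.
have [||K [KI K1 IK] maxK] :=
    @noethA (fun K => [/\ idealP K, ~ K 1 & incl I K]).
- by move=> K [].
- by exists I; split.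
have maxK' J : idealP J -> ~ J 1 -> incl K J -> incl J K.
  by move=> JI J1 KJ; apply: maxK => //; split=> // x /IK /KJ.
exists K; split=> //.
have [a Ka aP] := colon_prime KI K1.
have sub : incl (colon K a) K.
  by case: aP => aI a1 _; apply: maxK' => // x Kx; case: KI => _ _; rewrite /colon mulrC; apply.
split=> // b c Kbc; case: (aP) => _ _ /(_ b c)[].
- by rewrite /colon mulrC; case: KI => _ _; apply.
- by move/sub; left.
- by move/sub; right.
Qed.

(** Nakayama's lemma in the localization at [N], for C = C' + x C. The maximal condition replaces a
    finite set of generators: over a maximal saturated [K] that fails to contain [C], any single [g]
    of [C] outside [K] generates the rest. *)
Lemma sat_nakayama N C C' x : primeP N -> saturated N C -> saturated N C' ->
  incl C' C -> N x ->
  (forall a, C a -> exists s c' c, [/\ ~ N s, C' c', C c & s * a = c' + x * c]) ->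
  incl C C'.
Proof.
move=> Np [CI Csat] C's C'C Nx H; apply: contrapT => nCC'.
have [||K [Ks C'K KC nCK] maxK] := @noethA
    (fun K => [/\ saturated N K, incl C' K, incl K C & ~ incl C K]).
- by move=> K [[]].
- by exists C'; split.
apply: nCK => g Cg; apply: contrapT => Kg; case: (Ks) => KI Ksat.
have gKg := addp_gen g KI.
have K2s := ideal_sat Np (ideal_addp g KI).
have KK2 : incl K (sat N (addp K g)).
  by move=> y Ky; apply: sat_incl => //; apply: addp_incl.
have CK2 : incl C (sat N (addp K g)).
  apply: contrapT => nC; apply: Kg; apply: (maxK (sat N (addp K g))) => //.
    split=> // [y /C'K /KK2 //|]; apply: sat_sub => // _ [b [r [/KC Cb ->]]].
    by case: CI => _ CD CM; apply: CD => //; apply: CM.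
  exact: sat_incl.
have [s [c' [c [Ns C'c' Cc E]]]] := H g Cg.
have [t Nt [b [r [Kb E']]]] := CK2 c Cc.
(* Substituting one equation into the other puts (t s - x r) g into [K]; the factor lies outside [N]
   because [x] is in [N] while [s] and [t] are not. *)
apply: Kg; apply: (Ksat (t * s - x * r)).
  case: Np => NI _ NM ntsx; have : N (t * s).
    rewrite -(subrK (x * r) (t * s)); case: (NI) => _ ND NMl; apply: ND => //.
    by rewrite mulrC; apply: NMl.
  by case/NM.
have -> : (t * s - x * r) * g = t * c' + x * b.
  have -> : (t * s - x * r) * g = t * (s * g) - x * r * g by ring.
  rewrite E mulrDr mulrCA E'; ring.
by case: KI => _ KD KM; apply: KD; apply: KM => //; apply: C'K.
Qed.

Definition stable_over N I := forall K : nat -> A -> Prop,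
  (forall i, saturated N (K i)) -> (forall i, incl (K i.+1) (K i)) ->
  (forall i, incl I (K i)) ->
  exists c, forall i, (c <= i)%N -> incl (K c) (K i).

(** If [N] is minimal over [I0], the localization of A/I0 at [N] is artinian. In a maximal
    counterexample [I] the associated prime [colon I a] is squeezed into [N], hence equals it, so
    locally I + (a) is one simple step above [I]. *)
Lemma descending_stable N I0 : primeP N ->
  (forall P, primeP P -> incl I0 P -> incl P N -> incl N P) ->
  forall I, saturated N I -> incl I0 I -> stable_over N I.
Proof.
move=> Np minN I1 I1s I0I1; apply: contrapT => nst1.
have [||I [Is I0I nst] maxI] := @noethA
    (fun I => [/\ saturated N I, incl I0 I & ~ stable_over N I]).
- by move=> K [[]].
- by exists I1; split.
apply: nst => K Ks Kd IK; case: (Is) => II Isat.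
have Kd' i j : (i <= j)%N -> incl (K j) (K i).
  elim: j => [|j IH]; first by rewrite leqn0 => /eqP-> x.
  by rewrite leq_eqVlt => /orP[/eqP-> x //| /IH h x /Kd /h].
have [i1|ni1] := EM (I 1).
  by exists 0%N => i _ x _; apply: IK; rewrite -(mulr1 x); case: II => _ _; apply.
have [a Ia aP] := colon_prime II ni1.
have NaI : incl N (colon I a).
  apply: minN => // [x /I0I Ix | x].
    by rewrite /colon mulrC; case: II => _ _; apply.
  by rewrite /colon => Ixa; apply: contrapT => /Isat /(_ Ixa).
have KI i : idealP (K i) by case: (Ks i).
have stI2 : stable_over N (sat N (addp I a)).
  apply: contrapT => nst; apply: Ia; apply: (maxI (sat N (addp I a))).
  - split=> //; first exact: ideal_sat (ideal_addp _ _).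
    by move=> x /I0I Ix; apply: sat_incl => //; apply: addp_incl.
  - by move=> x Ix; apply: sat_incl => //; apply: addp_incl.
  - by apply: sat_incl => //; apply: addp_gen.
have [||i|c cP] := stI2 (fun i => sat N (addp (K i) a)).
- by move=> i; apply: ideal_sat => //; apply: ideal_addp.
- by move=> i x [s Ns [b [r [/Kd Kb E]]]]; exists s => //; exists b, r.
- by move=> x [s Ns [b [r [Ib E]]]]; exists s => //; exists b, r; split=> //; apply: IK.
(* The chain of the K i + (a) is stable from [c] on. If every term contains [a], nothing was added;
   otherwise, from some index on, the terms meet I + (a) only in [I]. *)
have [Ka|/asboolP] := EM (forall i, K i a).
  have sub i : incl (sat N (addp (K i) a)) (K i).
    apply: sat_sub => // _ [b [r [Kb ->]]]; case: (KI i) => _ KD KM.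
    by apply: KD => //; apply: KM.
  exists c => i /cP ci x Kx; apply: sub; apply: ci; apply: sat_incl => //.
  exact: addp_incl.
rewrite asbool_neg => /existsp_asboolPn[i0 Ki0].
exists (maxn c i0) => i; rewrite geq_max => /andP[ci i0i] z Kz.
have /cP : (c <= i)%N by [].
case/(_ z); first apply: sat_incl => //; first apply: addp_incl.
  by apply: Kd' Kz; rewrite leq_maxl.
move=> s Ns [b [r [Kb E]]].
have Km : K (maxn c i0) (r * a).
  have -> : r * a = s * z - b by rewrite E addrAC subrr add0r.
  apply: idealB => //; first by case: (KI (maxn c i0)) => _ _; apply.
  by apply: Kd' Kb; rewrite geq_max ci.
have Nr : N r.
  apply: contrapT => Nr; apply: Ki0; apply: (Kd' i0 (maxn c i0)).
    by rewrite leq_maxr.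
  by case: (Ks (maxn c i0)) => _ Ksat; apply: Ksat Km.
case: (Ks i) => _ Ksat; apply: (Ksat s) => //; rewrite E.
by case: (KI i) => _ KD _; apply: KD => //; apply: IK; apply: NaI.
Qed.

(* Krull's principal ideal theorem. The chain [C i] consists of the contractions
   of the ideals generated by [y ^+ i] in the localization of A/P at Q. *)
Lemma krull_principal P Q N x :
  primeP P -> primeP Q -> primeP N -> incl P Q -> ~ incl Q P ->
  incl Q N -> ~ incl N Q -> N x -> ~ P x ->
  exists Q1, [/\ primeP Q1, incl P Q1, Q1 x, incl Q1 N & ~ incl N Q1].
Proof.
move=> Pp Qp Np PQ nQP QN nNQ Nx nPx; apply: contrapT => noQ1.
case: (Pp) => PI P1 PM; case: (Qp) => QI Q1 QM; case: (Np) => NI N1 NM.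
have minN P' : primeP P' -> incl (addp P x) P' -> incl P' N -> incl N P'.
  move=> P'p sub P'N; apply: contrapT => nN; apply: noQ1; exists P'; split=> //.
    by move=> z Pz; apply: sub; apply: addp_incl.
  by apply: (sub x); apply: addp_gen.
have nQx : ~ Q x.
  move=> Qx; apply: nNQ; apply: minN => // _ [b [r [/PQ Qb ->]]].
  by case: QI => _ QD QMl; apply: QD => //; apply: QMl.
have [y Qy nPy] : exists2 y, Q y & ~ P y.
  by apply: contrapT => h; apply: nQP => z Qz; apply: contrapT => Pz; apply: h; exists z.
pose C i := sat Q (addp P (y ^+ i)).
have Cs i : saturated Q (C i) by apply: ideal_sat => //; apply: ideal_addp.
have CsN i : saturated N (C i).
  by case: (Cs i) => ? CQ; split=> // s a Ns; apply: CQ => /QN.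
have CI i : idealP (C i) by case: (Cs i).
have PC i : incl P (C i) by move=> z Pz; apply: sat_incl => //; apply: addp_incl.
have Cd i : incl (C i.+1) (C i).
  move=> z [s Ns [b [r [Pb E]]]]; exists s => //; exists b, (r * y); split=> //.
  by rewrite E exprS mulrA.
have [||i|c cP] := descending_stable Np minN
    (ideal_sat Np (ideal_addp x PI)) (sat_incl Np) (K := fun i => sat N (addp (C i) x)).
- by move=> i; apply: ideal_sat => //; apply: ideal_addp.
- by move=> i z [s Ns [b [r [/Cd Cb E]]]]; exists s => //; exists b, r.
- move=> z [s Ns [b [r [Pb E]]]]; exists s => //; exists b, r.
  by split=> //; apply: PC.
(* Stability writes s a = b + r x with [b] in [C c.+1]. As [x] is outside [Q], saturation puts [r]
   into [C c], as Nakayama's lemma requires. *)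
have CC : incl (C c) (C c.+1).
  apply: (@sat_nakayama N _ _ x) => // a Ca.
  have [|s Ns [b [r [Cb E]]]] := cP c.+1 (leqnSn c) a.
    by apply: sat_incl => //; apply: addp_incl.
  exists s, b, r; split=> //; last by rewrite E (mulrC r).
  case: (Cs c) => _ CQ; apply: (CQ x) => //.
  have -> : x * r = s * a - b by rewrite E addrAC subrr add0r mulrC.
  by apply: idealB => //; [case: (CI c) => _ _; apply | apply: Cd].
have [s nQs [b [r [Pb E]]]] : C c.+1 (y ^+ c).
  by apply: CC; apply: sat_incl => //; apply: addp_gen.
(* Since [y] is outside [P], the second factor falls into [P], and then [s] into [Q], against its
   choice. *)
have : P (y ^+ c * (s - r * y)).
  have -> : y ^+ c * (s - r * y) = b; last by [].
  by rewrite mulrBr mulrC E exprS; ring.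
case/PM => [|/PQ Qsry].
  elim: {E cP CC} c => [|c IH]; first by rewrite expr0.
  by rewrite exprS => /PM[|/IH].
apply: nQs; rewrite -(subrK (r * y) s); case: QI => _ QD QMl.
by apply: QD => //; apply: QMl.
Qed.

Definition chain n (P : nat -> A -> Prop) :=
  (forall i, (i <= n)%N -> primeP (P i)) /\
  (forall i, (i < n)%N -> incl (P i) (P i.+1) /\ ~ incl (P i.+1) (P i)).

(** The prime just below the top is exchanged, by the principal ideal theorem, for one containing
    [x]; induction on the chain below it brings [x] down to level 1. *)
Lemma chain_through n (P : nat -> A -> Prop) x : chain n.+1 P -> ~ P 0%N x -> P n.+1 x ->
  exists P' : nat -> A -> Prop, [/\ chain n.+1 P', P' 0%N = P 0%N, P' n.+1 = P n.+1 & P' 1%N x].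
Proof.
elim: n P => [|n IH] P cP nP0 Pn; first by exists P.
have [P'' [cP'' P''0 P''x P''n]] : exists P'' : nat -> A -> Prop, [/\ chain n.+1 P'', P'' 0%N = P 0%N,
    P'' n.+1 x & incl (P'' n.+1) (P n.+2) /\ ~ incl (P n.+2) (P'' n.+1)].
  case: (cP) => pP iP; case: (iP n.+1 (leqnn _)) => i1 i2.
  have [Px|nPx] := EM (P n.+1 x).
    exists P; split=> //; split=> i lt_in; first exact: pP (leqW lt_in).
    by apply: iP; apply: leqW.
  case: (iP n (ltnW (leqnn _))) => i3 i4.
  have [||||Q1 [Q1p PQ1 Q1x Q1P nPQ1]] := krull_principal _ _ _ i3 i4 i1 i2 Pn (P := P n).
  - exact: pP (leqW (leqW (leqnn _))).
  - exact: pP (leqW (leqnn _)).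
  - exact: pP.
  - by move/i3.
  exists (fun i => if i == n.+1 then Q1 else P i); rewrite eqxx; split=> //.
  split=> i lt_in.
    by case: eqVneq => // _; apply: pP (leqW lt_in).
  rewrite (ltn_eqF lt_in); have [[E]|_] := eqVneq i.+1 n.+1.
    rewrite E; split=> // Q1Pn; apply: (nPx); apply: i3; exact: Q1Pn.
  by apply: iP; apply: leqW.
have [|P' [cP' P'0 P'n P'1]] := IH _ cP'' _ P''x; first by rewrite P''0.
exists (fun i => if i == n.+2 then P n.+2 else P' i); rewrite eqxx /=.
split=> //; last by rewrite P'0 P''0.
split=> i lt_in.
  have [_|ne] := eqVneq i n.+2; first by case: cP => pP _; apply: pP.
  by case: cP' => pP _; apply: pP; rewrite -ltnS ltn_neqAle ne.
rewrite (ltn_eqF lt_in) eqSS; have [->|ne] := eqVneq i n.+1; first by rewrite P'n.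
by case: cP' => _; apply; rewrite ltn_neqAle ne -ltnS.
Qed.

Definition generated_over I (xs : seq A) a :=
  forall J, idealP J -> incl I J -> (forall x, x \in xs -> J x) -> J a.

(* A generator x of N outside P 0 may be assumed to lie in P 1; by induction P 1 is
   then I + (x), so that P 0 = I + x P 0. *)
Lemma regular_bottom N : primeP N -> (forall s, ~ N s -> exists t, t * s = 1) ->
  forall n I (P : nat -> A -> Prop) (xs : seq A), size xs = n -> idealP I ->
  chain n P -> incl I (P 0%N) -> incl N (P n) ->
  incl N (generated_over I xs) -> (forall x, x \in xs -> N x) -> incl (P 0%N) I.
Proof.
move=> Np Nu n; case: (Np) => NI N1 NM.
have proper_incl J : idealP J -> ~ J 1 -> incl J N.
  move=> [_ _ JM] J1 x Jx; apply: contrapT => /Nu[t E]; apply: J1.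
  by rewrite -E; apply: JM.
have saturatedN J : idealP J -> saturated N J.
  move=> JI; split=> // s a /Nu[t E] Jsa; rewrite -[a]mul1r -E -mulrA.
  by case: JI => _ _; apply.
elim: n => [|n IH] I P xs sxs II cP IP NP gN xsN.
  have g : incl (P 0%N) N by case: cP => /(_ 0%N (leqnn _))[Pi P1 _] _; apply: proper_incl.
  by move=> x /g /gN; apply=> //; case: xs sxs {gN xsN}.
case: (cP) => /(_ 0%N (leq0n _))[P0I P01 P0M] /(_ 0%N (ltn0Sn _)) [_ nP10].
have P'1N i : (i <= n.+1)%N -> incl (P i) N.
  by move=> le_in; case: cP => /(_ i le_in)[Pi Pi1 _] _; apply: proper_incl.
have [x xsx nPx] : exists2 x, x \in xs & ~ P 0%N x.
  apply: contrapT => h; apply: nP10 => z Pz; apply: (gN z) => //.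
    exact: (P'1N 1%N).
  by move=> x xsx; apply: contrapT => nPx; apply: h; exists x.
have Nx := xsN x xsx.
have [P' [cP' P'0 P'n P'x]] := chain_through cP nPx (NP _ Nx).
have sub : incl (P' 1%N) (addp I x).
  apply: (IH (addp I x) (fun i => P' i.+1) (rem x xs)).
  - by rewrite size_rem // sxs.
  - exact: ideal_addp.
  - by case: cP' => p1 p2; split=> i ?; [apply: p1 | apply: p2].
  - case: cP' => /(_ 1%N (ltn0Sn _))[[_ P'D P'M] _ _] /(_ 0%N (ltn0Sn _))[].
    rewrite P'0 => P01' _ _ [b [r [/IP /P01' Pb ->]]].
    by apply: P'D => //; apply: P'M.
  - by rewrite P'n.
  - move=> z /gN g J JI IJ Jxs; apply: g => // [a Ia|a].
      by apply: IJ; apply: addp_incl.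
    rewrite (perm_mem (perm_to_rem xsx)) inE => /orP[/eqP->|/Jxs //].
    by apply: IJ; apply: addp_gen.
  - by move=> a /mem_rem /xsN.
apply: (@sat_nakayama N _ _ x) => //; try exact: saturatedN.
move=> a Pa; have /sub[b [r [Ib E]]] : P' 1%N a.
  by case: cP' => _ /(_ 0%N (ltn0Sn _))[+ _]; rewrite P'0; apply.
exists 1, b, r; split=> //; last by rewrite mul1r E (mulrC r).
have : P 0%N (r * x).
  have -> : r * x = a - b by rewrite E addrAC subrr add0r.
  by apply: idealB => //; apply: IP.
by case/P0M.
Qed.

End Ideals.

(** * Ideals as predicates and as bundled submodules *)

Section MakeIdeal.
Variable R : comPzRingType.

Definition mkideal_pred (I : R -> Prop) : {pred R^o} := fun x => `[< I x >].

Fact mkideal_closed (I : R -> Prop) : idealP I -> submod_closed (mkideal_pred I).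
Proof.
case=> I0 ID IM; split; first exact/asboolP.
move=> a x y /asboolP Ix /asboolP Iy; apply/asboolP; apply: ID => //.
exact: (IM a x).
Qed.

Definition mkideal (I : R -> Prop) (hI : idealP I) : submodClosed R^o :=
  HB.pack (mkideal_pred I) (GRing.isSubmodClosed.Build R R^o _ (mkideal_closed hI)).

Lemma mem_mkideal (I : R -> Prop) (hI : idealP I) (x : R) : (x : R^o) \in mkideal hI <-> I x.
Proof. by split=> [/asboolP|Ix] //; apply/asboolP. Qed.

Lemma span_min (g : set R^o) (J : R -> Prop) : idealP J -> (forall x, g x -> J x) ->
  forall x : R^o, x \in span g -> J x.
Proof.
case=> J0 JD JM gJ x /asboolP[s sg ->].
elim: s sg => [|p s IH] sg; first by rewrite big_nil.
rewrite big_cons; apply: JD.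
  by apply: (JM p.1); apply: gJ; apply: sg; rewrite mem_head.
by apply: IH => q sq; apply: sg; rewrite inE sq orbT.
Qed.

Lemma mem_span (g : set R^o) x : g x -> x \in span g.
Proof.
move=> gx; apply/asboolP; exists [:: (1, x)]; last by rewrite big_seq1 scale1r.
by move=> p; rewrite inE => /eqP->.
Qed.

End MakeIdeal.

Section RegularDomain.
Variable R : comNzRingType.

Lemma submodClosed_ideal (I : submodClosed R^o) : idealP (fun x : R => (x : R^o) \in I).
Proof.
split; first exact: (@rpred0 _ I).
  by move=> x y; apply: (@rpredD _ I).
by move=> a x; apply: idealMl.
Qed.

Lemma noetherian_max : noetherian R -> max_condition R.
Proof.
move=> noeR F FI [I0 FI0]; apply: contrapT => nomax.
have next (I : {I | F I}) : exists J : {I | F I},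
    incl (sval I) (sval J) /\ ~ incl (sval J) (sval I).
  apply: contrapT => nJ; apply: nomax; exists (sval I); first exact: (svalP I).
  move=> J FJ IJ; apply: contrapT => nJI; apply: nJ.
  by exists (exist _ J FJ).
have [f fP] := choice next.
pose K i := sval (iter i f (exist _ I0 FI0)).
have KI i : idealP (K i) by apply: FI; rewrite /K; case: (iter _ _ _).
have K1 i : incl (K i) (K i.+1) by case: (fP (iter i f (exist _ I0 FI0))).
have K2 i : ~ incl (K i.+1) (K i) by case: (fP (iter i f (exist _ I0 FI0))).
have Km i j : (i <= j)%N -> incl (K i) (K j).
  elim: j => [|j IH]; first by rewrite leqn0 => /eqP-> x.
  by rewrite leq_eqVlt => /orP[/eqP-> x //| /IH h x /h /K1].
pose U x := exists i, K i x.
have UI : idealP U.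
  split; first by exists 0%N; case: (KI 0%N).
    move=> x y [i Kx] [j Ky]; exists (maxn i j).
    by case: (KI (maxn i j)) => _ KD _; apply: KD;
      [apply: Km Kx; rewrite leq_maxl | apply: Km Ky; rewrite leq_maxr].
  by move=> a x [i Kx]; exists i; case: (KI i) => _ _; apply.
have [n [g gP]] := noeR (mkideal UI).
have gU i : U (g i).
  by apply/(mem_mkideal UI); rewrite gP; apply: mem_span; exists i.
have [h hP] := choice gU.
pose c := \max_i h i.
apply: (K2 c) => x Kx.
have : (x : R^o) \in mkideal UI by apply/mem_mkideal; exists c.+1.
rewrite gP => /(span_min (KI c)); apply=> _ [i _ <-].
by apply: Km (hP i); apply: leq_bigmax.
Qed.

Lemma maximal_ideal_max (m : submodClosed R^o) (P : R -> Prop) :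
  primeP P -> (forall J : R -> Prop, idealP J -> ~ J 1 -> incl P J -> incl J P) ->
  (forall x : R, (x : R^o) \in m <-> P x) -> maximal_ideal m.
Proof.
move=> [PI P1 _] Pmax mP; split; first by apply/negP => /mP.
move=> J J1 mJ x; apply/idP/idP; last exact: mJ.
move=> Jx; apply/mP; apply: (Pmax (fun x => (x : R^o) \in J)) => //.
- exact: submodClosed_ideal.
- exact/negP.
- by move=> y /mP /mJ.
Qed.

Lemma local_unit (m : submodClosed R^o) : max_condition R -> local_ring m ->
  forall s : R, (s : R^o) \notin m -> exists t, t * s = 1.
Proof.
move=> noeR [[m1 _] munique] s nms; apply: contrapT => nu.
pose I := fun x : R => exists t, x = t * s.
have II : idealP I.
  split; first by exists 0; rewrite mul0r.
    by move=> _ _ [t ->] [u ->]; exists (t + u); rewrite mulrDl.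
  by move=> a _ [t ->]; exists (a * t); rewrite mulrA.
have [|P [Pp IP Pmax]] := exists_prime noeR II.
  by case=> t E; apply: nu; exists t.
have PI : idealP P by case: Pp.
have /munique E : maximal_ideal (mkideal PI).
  exact: maximal_ideal_max Pmax (mem_mkideal PI).
move/negP: nms; apply; rewrite -E; apply/mem_mkideal; apply: IP; exists 1.
by rewrite mul1r.
Qed.

Lemma local_prime (m : submodClosed R^o) : max_condition R -> local_ring m ->
  primeP (fun x : R => (x : R^o) \in m).
Proof.
move=> noeR mloc; have mu := local_unit noeR mloc; case: mloc => [[m1 _] _].
split; first exact: submodClosed_ideal.
  exact/negP.
move=> a b mab; have [|nma] := boolP ((a : R^o) \in m); [by left | right].
have [t E] := mu a nma; rewrite -[b]mul1r -E -mulrA.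
exact: (@idealMl _ _ t).
Qed.

Lemma prime_idealr_prime (P : prime_idealr R) : primeP (fun x : R => x \in P).
Proof.
split.
- split; first exact: (@rpred0 _ P).
    by move=> x y; apply: (@rpredD _ P).
  by move=> a x; apply: (@idealMr _ P).
- by apply/negP; rewrite idealr1.
- by move=> a b; rewrite prime_idealrM => /orP.
Qed.

Definition mkprime_pred (I : R -> Prop) : {pred R} := fun x => `[< I x >].

Fact mkprime_zmod (I : R -> Prop) : primeP I -> zmod_closed (mkprime_pred I).
Proof.
case=> II _ _; split; first by apply/asboolP; case: II.
by move=> x y /asboolP Ix /asboolP Iy; apply/asboolP; apply: idealB.
Qed.

Fact mkprime_proper (I : R -> Prop) : primeP I -> ring_quotient.proper_ideal (mkprime_pred I).
Proof.
case=> II I1 _; split; first by apply/asboolP.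
by move=> a x /asboolP Ix; apply/asboolP; case: II => _ _; apply.
Qed.

Fact mkprime_prime (I : R -> Prop) : primeP I -> prime_idealr_closed (mkprime_pred I).
Proof.
by case=> _ _ IM x y /asboolP /IM[] ?; apply/orP; [left | right]; apply/asboolP.
Qed.

Definition mkprime (I : R -> Prop) (hI : primeP I) : prime_idealr R :=
  HB.pack (mkprime_pred I) (GRing.isZmodClosed.Build R _ (mkprime_zmod hI))
    (isProperIdeal.Build R _ (mkprime_proper hI))
    (isPrimeIdealrClosed.Build R _ (mkprime_prime hI)).

Lemma mem_mkprime (I : R -> Prop) (hI : primeP I) x : x \in mkprime hI <-> I x.
Proof. by split=> [/asboolP|Ix] //; apply/asboolP. Qed.

Lemma chain_prime_chain n (P : nat -> R -> Prop) (cP : chain n P) :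
  exists Q : 'I_n.+1 -> prime_idealr R, prime_chain Q.
Proof.
case: (cP) => pP iP.
have pPo (i : 'I_n.+1) : primeP (P i) by apply: pP; rewrite -ltnS.
exists (fun i => mkprime (pPo i)) => i j lt_ij.
have Pm k l : (k <= l <= n)%N -> incl (P k) (P l).
  elim: l => [|l IH]; first by rewrite leqn0 => /andP[/eqP-> _] x.
  rewrite leq_eqVlt => /andP[/orP[/eqP->|kl] ln] x Px //.
  by case: (iP l ln) => + _; apply; apply: (IH _ x Px); rewrite -ltnS kl ltnW.
have jn : (j <= n)%N by rewrite -ltnS.
split=> [x /mem_mkprime Px|sub]; first by apply/mem_mkprime; apply: (Pm i j _ x Px); rewrite (ltnW lt_ij).
case: (iP i (leq_trans lt_ij jn)) => _; apply=> x Px.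
by apply/(mem_mkprime (pPo i)); apply: sub; apply/mem_mkprime; apply: (Pm i.+1 j _ x Px); rewrite lt_ij.
Qed.

(** [regular_bottom] over the zero ideal shows that the bottom prime of a chain of full length n is
    zero. *)
Lemma regular_local_domain (m : submodClosed R^o) n : regular_local m n ->
  forall a b : R, a * b = 0 -> a = 0 \/ b = 0.
Proof.
case=> /noetherian_max noeR mloc [[P cP] dimR] [g mg].
have mu := local_unit noeR mloc; have mp := local_prime noeR mloc.
pose P' i : R -> Prop := fun x => x \in P (inord i).
have cP' : chain n P'.
  split=> i lt_in; first exact: prime_idealr_prime.
  by apply: cP; rewrite !inordK // ltnW.
(* Otherwise [m] could be put on top of the chain, giving length n + 1. *)
have mP : incl (fun x : R => (x : R^o) \in m) (P' n).
  apply: contrapT => nmP.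
  pose M : R -> Prop := fun x => (x : R^o) \in m.
  have /chain_prime_chain[Q /dimR] : chain n.+1 (fun i => if i == n.+1 then M else P' i).
    case: (cP') => p1 p2; split=> i.
      by case: eqVneq => // /eqP ne; rewrite leq_eqVlt => /orP[/eqP //|]; apply: p1.
    move=> lt_in; rewrite (ltn_eqF lt_in) eqSS; case: eqVneq => [->|ne].
      split=> // x Px; apply: contrapT => /negP /mu[t E].
      case: (p1 n (leqnn n)) => [[_ _ PM] P1 _]; apply: P1; rewrite -E.
      exact: PM.
    by apply: p2; rewrite ltn_neqAle ne -ltnS.
  by rewrite ltnn.
have I0 : idealP (fun x : R => x = 0).
  by split=> [|x y -> ->|a x ->]; rewrite ?addr0 ?mulr0.
have P0 : incl (P' 0%N) (fun x => x = 0).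
  apply: (@regular_bottom _ noeR _ mp _ n _ _ (codom g)) => //.
  - by move=> s /negP /mu.
  - by rewrite size_codom card_ord.
  - by move=> x ->; case: cP' => /(_ 0%N (leq0n _))[[]].
  - move=> x; rewrite mg => xg J JI _ Jg; apply: span_min xg => // _ [i _ <-].
    by apply: Jg; apply: codom_f.
  - by move=> _ /codomP[i ->]; rewrite mg; apply: mem_span; exists i.
case: cP' => /(_ 0%N (leq0n _))[[P00 _ _] _ PM] _ a b ab0.
by have /PM[/P0 ?|/P0 ?] : P' 0%N (a * b) by [rewrite ab0]; [left | right].
Qed.

End RegularDomain.

(** * Complexes with coefficients in a module *)

(* The direct sum of copies of V indexed by T, as a module of finitely supported
   functions. It is only used through this interface: the instance below is kept
   opaque because unification is otherwise tempted to unfold its operations. *)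
Record direct_sum (A : comPzRingType) (T : choiceType) (V : lmodType A) := DirectSum {
  ds_mod : lmodType A;
  ds_coef : T -> {linear ds_mod -> V};
  ds_supp : ds_mod -> {fset T};
  ds_mk : (T -> V) -> ds_mod;
  ds_eq : forall x y, (forall t, ds_coef t x = ds_coef t y) -> x = y;
  ds_mem_supp : forall x t, (t \in ds_supp x) = (ds_coef t x != 0);
  ds_coef_mk : forall (B : {fset T}) f t,
    (forall s, s \notin B -> f s = 0) -> ds_coef t (ds_mk f) = f t
}.

Section DirectSumExists.
Local Open Scope classical_set_scope.
Variables (A : comPzRingType) (T : choiceType) (V : lmodType A).

Definition finsup : {pred T -> V} := fun f => `[< finite_set (f @^-1` [set~ 0]) >].

Fact finsup_submod : submod_closed finsup.
Proof.
split; first by apply/asboolP; rewrite (_ : _ @^-1` _ = set0) // -subset0 => x [].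
move=> a u v /asboolP fu /asboolP fv; apply/asboolP.
apply: (@sub_finite_set _ _ ((u @^-1` [set~ 0]) `|` (v @^-1` [set~ 0]))); last first.
  by rewrite finite_setU.
move=> t /=; apply: contra_notP => /not_orP[/contrapT u0 /contrapT v0].
by rewrite !fctE u0 v0 scaler0 addr0.
Qed.
HB.instance Definition _ :=
  GRing.isSubmodClosed.Build A (T -> V) finsup finsup_submod.

Definition finsup_coef (t : T) (x : subm finsup) : V := val x t.
Fact finsup_coef_linear t : linear (finsup_coef t). Proof. by []. Qed.
HB.instance Definition _ t :=
  GRing.isLinear.Build A (subm finsup) V *:%R (finsup_coef t) (finsup_coef_linear t).

Lemma direct_sum_exists : direct_sum T V.
Proof.
(* Functions of infinite support are sent to 0; [ds_coef_mk] speaks only of functions vanishing off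
   a finite set. *)
pose mk (f : T -> V) : subm finsup :=
  if pselect (f \in finsup) is left h then exist (fun f => f \in finsup) f h else 0.
apply: (@DirectSum _ _ _ (subm finsup) (fun t => finsup_coef t)
  (fun x => fset_set [set t | finsup_coef t x != 0]) mk).
- by move=> x y xy; apply: val_inj; apply/funext => t; apply: xy.
- move=> x t; rewrite in_fset_set.
    by apply/idP/idP => [/set_mem|?] //; apply/mem_set.
  have /asboolP := valP x.
  by apply: sub_finite_set => s /= /eqP.
- move=> B f t fB; rewrite /mk; case: pselect => // -[]; apply/asboolP.
  apply: (@sub_finite_set _ _ [set` B]); last exact: finite_fset.
  by move=> s /=; apply: contra_notT => /fB.
Qed.
End DirectSumExists.

Section DirectSum.
Variables (A : comPzRingType) (T : choiceType).

Section Basics.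
Variable V : lmodType A.

Definition dsum : lmodType A := ds_mod (direct_sum_exists T V).
Definition coef (t : T) : {linear dsum -> V} := ds_coef (direct_sum_exists T V) t.
Definition supp (x : dsum) : {fset T} := ds_supp x.
Definition mkdsum (f : T -> V) : dsum := ds_mk _ f.

Lemma coef0 t : coef t 0 = 0. Proof. exact: raddf0. Qed.
Lemma coefD t x y : coef t (x + y) = coef t x + coef t y. Proof. exact: raddfD. Qed.
Lemma coefB t x y : coef t (x - y) = coef t x - coef t y. Proof. exact: raddfB. Qed.
Lemma coefZ t a x : coef t (a *: x) = a *: coef t x. Proof. exact: linearZ. Qed.

Lemma dsum_eq (x y : dsum) : (forall t, coef t x = coef t y) -> x = y.
Proof. exact: ds_eq. Qed.

Lemma mem_supp x t : (t \in supp x) = (coef t x != 0).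
Proof. exact: ds_mem_supp. Qed.

Lemma coef_supp x t : t \notin supp x -> coef t x = 0.
Proof. by rewrite mem_supp negbK => /eqP. Qed.

Lemma coef_mk (B : {fset T}) (f : T -> V) t :
  (forall s, s \notin B -> f s = 0) -> coef t (mkdsum f) = f t.
Proof. exact: ds_coef_mk. Qed.

Definition single t v : dsum := mkdsum (fun s => if s == t then v else 0).

Lemma coef_single t v s : coef s (single t v) = if s == t then v else 0.
Proof.
rewrite (coef_mk _ (B := [fset t]%fset)) // => r; rewrite inE.
by case: eqP.
Qed.

Fact single_linear t : linear (single t).
Proof.
move=> a u v; apply: dsum_eq => s; rewrite coefD coefZ !coef_single.
by case: eqP => // _; rewrite scaler0 addr0.
Qed.
HB.instance Definition _ t :=
  GRing.isLinear.Build A V dsum *:%R (single t) (single_linear t).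

End Basics.
Arguments coef {V} t.
Arguments mkdsum {V} f.

Section Lift.
Variables (V U : lmodType A) (g : T -> {linear V -> U}).

Definition dlift (x : dsum V) : U := \sum_(t \in [set: T]) g t (coef t x).

Lemma dliftE (B : {fset T}) x : (forall t, t \notin B -> coef t x = 0) ->
  dlift x = \sum_(t <- B) g t (coef t x).
Proof. by move=> xB; apply: fsbigTE => t /xB ->; rewrite linear0. Qed.

Lemma dlift_supp x : dlift x = \sum_(t <- supp x) g t (coef t x).
Proof. by apply: dliftE => t; apply: coef_supp. Qed.

Fact dlift_linear : linear dlift.
Proof.
move=> a x y.
pose B := (supp x `|` supp y)%fset.
have Bx t : t \notin B -> coef t x = 0.
  by rewrite in_fsetU => /norP[+ _]; apply: coef_supp.
have By t : t \notin B -> coef t y = 0.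
  by rewrite in_fsetU => /norP[_]; apply: coef_supp.
rewrite (dliftE Bx) (dliftE By) (@dliftE B); last first.
  by move=> t Bt; rewrite linearP /= Bx // By // scaler0 addr0.
rewrite scaler_sumr -big_split /=; apply: eq_bigr => t _.
by rewrite !linearP.
Qed.
HB.instance Definition _ := GRing.isLinear.Build A (dsum V) U *:%R dlift dlift_linear.

Lemma dlift_single t v : dlift (single t v) = g t v.
Proof.
rewrite (@dliftE [fset t]%fset) ?big_seq_fset1 ?coef_single ?eqxx //.
by move=> s; rewrite inE coef_single => /negPf->.
Qed.
End Lift.

Lemma dsum_expand (V : lmodType A) (x : dsum V) :
  x = \sum_(t <- supp x) single t (coef t x).
Proof.
apply: dsum_eq => s; rewrite linear_sum /=.
have [sx|sx] := boolP (s \in supp x); last first.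
  rewrite coef_supp // big_seq big1 // => t tx; rewrite coef_single.
  by case: eqP => // st; rewrite st tx in sx.
rewrite (big_rem s) //= coef_single eqxx big_seq big1 ?addr0 // => t.
rewrite coef_single; case: eqVneq => // <-.
by rewrite mem_rem_uniq ?fset_uniq // inE eqxx.
Qed.

Lemma dsum_ext (V U : lmodType A) (f g : {linear dsum V -> U}) :
  (forall t v, f (single t v) = g (single t v)) -> f =1 g.
Proof.
move=> fg x; rewrite (dsum_expand x) !linear_sum /=.
by apply: eq_bigr => t _.
Qed.

Section Map.
Variables (V U : lmodType A) (f : {linear V -> U}).
Definition dmap (x : dsum V) : dsum U := mkdsum (fun t => f (coef t x)).

Lemma coef_dmap t x : coef t (dmap x) = f (coef t x).
Proof.
by rewrite (coef_mk _ (B := supp x)) // => s /coef_supp ->; rewrite linear0.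
Qed.

Fact dmap_linear : linear dmap.
Proof. by move=> a x y; apply: dsum_eq => t; rewrite !(coefD, coefZ, coef_dmap) linearP. Qed.
HB.instance Definition _ :=
  GRing.isLinear.Build A (dsum V) (dsum U) *:%R dmap dmap_linear.

Lemma dmap0 : dmap 0 = 0. Proof. exact: raddf0. Qed.
Lemma dmapB x y : dmap (x - y) = dmap x - dmap y. Proof. exact: raddfB. Qed.
Lemma dmap_single t v : dmap (single t v) = single t (f v).
Proof.
apply: dsum_eq => s; rewrite coef_dmap !coef_single.
by case: eqP => // _; rewrite linear0.
Qed.

(** [W] stands for a submodule, so that lifting modulo [W] needs no quotient module. Off the support
    of [y] the lift is 0, where [W 0] suffices. *)
Lemma dmap_surj (W : U -> Prop) (y : dsum U) : W 0 ->
  (forall t, exists v, W (coef t y - f v)) ->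
  exists x, forall t, W (coef t (y - dmap x)).
Proof.
move=> W0 /choice[v vP].
exists (mkdsum (fun t => if t \in supp y then v t else 0)) => t.
rewrite linearB /= coef_dmap (coef_mk _ (B := supp y)); last by move=> s /negPf->.
case: ifP => [_|/negbT/coef_supp ->]; first exact: vP.
by rewrite linear0 subr0.
Qed.
End Map.

Lemma dmap_lift (V U : lmodType A) (f : {linear V -> U}) (y : dsum U) :
  (forall t, exists v, coef t y = f v) -> exists x, y = dmap f x.
Proof.
move=> fs; have [||x xP] := @dmap_surj V U f (fun u => u = 0) y; first by [].
  by move=> t; have [v ->] := fs t; exists v; rewrite subrr.
exists x; apply: dsum_eq => t; apply/eqP; rewrite -subr_eq0.
by have /eqP := xP t; rewrite linearB.
Qed.

Definition F : lmodType A := dsum A^o.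
Definition e (t : T) : F := @single A^o t (1 : A).

Section Act.
Variable V : lmodType A.

(** The tensor x (x) v, when F (x) V is identified with the direct sum of copies of [V]. *)
Definition dact (x : F) (v : V) : dsum V := mkdsum (fun t => coef t x *: v).

Lemma coef_dact t x v : coef t (dact x v) = (coef t x : A) *: v.
Proof.
by rewrite (coef_mk _ (B := supp x)) // => s /coef_supp ->; rewrite scale0r.
Qed.

Fact dact_linear x : linear (dact x).
Proof.
move=> a u v; apply: dsum_eq => t; rewrite !(coefD, coefZ, coef_dact).
by rewrite scalerDr !scalerA mulrC.
Qed.
HB.instance Definition _ x :=
  GRing.isLinear.Build A V (dsum V) *:%R (dact x) (dact_linear x).

Lemma dactDr x u v : dact x (u + v) = dact x u + dact x v.
Proof. exact: raddfD. Qed.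

Lemma dactZr x a v : dact x (a *: v) = a *: dact x v.
Proof. exact: linearZ. Qed.

Lemma dactDl x y v : dact (x + y) v = dact x v + dact y v.
Proof. by apply: dsum_eq => t; rewrite coefD !coef_dact coefD scalerDl. Qed.

Lemma dactZl a x v : dact (a *: x) v = a *: dact x v.
Proof. by apply: dsum_eq => t; rewrite coefZ !coef_dact coefZ scalerA. Qed.

Lemma dact_e t v : dact (e t) v = single t v.
Proof.
apply: dsum_eq => s; rewrite coef_dact !coef_single.
by case: eqP; rewrite ?scale1r ?scale0r.
Qed.

Definition dactl (v : V) (x : F) := dact x v.
Fact dactl_linear v : linear (dactl v).
Proof. by move=> a x y; rewrite /dactl dactDl dactZl. Qed.
HB.instance Definition _ v :=
  GRing.isLinear.Build A F (dsum V) *:%R (dactl v) (dactl_linear v).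

Lemma dactBl x y v : dact (x - y) v = dact x v - dact y v.
Proof. exact: (raddfB (dactl v)). Qed.

Lemma dact0l v : dact 0 v = 0.
Proof. exact: (raddf0 (dactl v)). Qed.
End Act.

Lemma F_expand (x : F) : x = \sum_(t <- supp x) (coef t x : A) *: e t.
Proof.
rewrite {1}(dsum_expand x); apply: eq_bigr => t _.
by rewrite -linearZ /= /GRing.scale /= mulr1.
Qed.

Lemma F_ext (U : lmodType A) (f g : {linear F -> U}) :
  (forall t, f (e t) = g (e t)) -> f =1 g.
Proof.
move=> fg x; rewrite (F_expand x) !linear_sum /=.
by apply: eq_bigr => t _; rewrite !linearZ fg.
Qed.

(* The endomorphism of the direct sum of copies of V given by the matrix with
   columns D t. *)
Section Differential.
Variables (D : T -> F) (V : lmodType A).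

Definition dD : dsum V -> dsum V := dlift (fun t => dact (D t)).
HB.instance Definition _ := GRing.Linear.on dD.

Lemma dD0 : dD 0 = 0. Proof. exact: raddf0. Qed.
Lemma dDD x y : dD (x + y) = dD x + dD y. Proof. exact: raddfD. Qed.
Lemma dDB x y : dD (x - y) = dD x - dD y. Proof. exact: raddfB. Qed.
Lemma dDZ a x : dD (a *: x) = a *: dD x. Proof. exact: linearZ. Qed.

Lemma dD_single t v : dD (single t v) = dact (D t) v.
Proof. exact: dlift_single. Qed.

Lemma coef_dD t x : coef t (dD x) = \sum_(s <- supp x) (coef t (D s) : A) *: coef s x.
Proof.
rewrite /dD dlift_supp linear_sum /=; apply: eq_bigr => s _.
by rewrite coef_dact.
Qed.
End Differential.

Lemma dD_e D t : dD D (e t) = D t.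
Proof. by rewrite dD_single; apply: dsum_eq => s; rewrite coef_dact /GRing.scale /= mulr1. Qed.

Lemma dmap_dact (V U : lmodType A) (f : {linear V -> U}) x v :
  dmap f (dact x v) = dact x (f v).
Proof. by apply: dsum_eq => t; rewrite coef_dmap !coef_dact linearZ. Qed.

Lemma dmap_dD (V U : lmodType A) (f : {linear V -> U}) D x :
  dmap f (dD D x) = dD D (dmap f x).
Proof.
have H : dmap f \o @dD D V =1 @dD D U \o dmap f; last exact: H.
apply: dsum_ext => t v /=.
by rewrite dD_single dmap_single dD_single dmap_dact.
Qed.

Lemma dD_dact (V : lmodType A) D x (v : V) : dD D (dact x v) = dact (dD D x) v.
Proof.
have H : @dD D V \o dactl v =1 dactl v \o @dD D A^o; last exact: H.
apply: F_ext => t /=.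
by rewrite /dactl dact_e dD_single dD_e.
Qed.

End DirectSum.
Arguments coef {A T V} t.
Arguments mkdsum {A T V} f.

(** * Tensor products and Tor *)

Section FreeModuleExtra.
Variables (A : comPzRingType) (T : choiceType).

Lemma freemod_expand (B : {fset T}) (x : freemod A T) :
  (forall t, t \notin B -> fcoef x t = 0) ->
  x = \sum_(t <- B) fcoef x t *: fdelta t.
Proof.
move=> xB; apply: val_inj; apply/funext => s.
rewrite raddf_sum /= fct_sumE /=.
have E t : val (fcoef x t *: fdelta t : freemod A T) s = fcoef x t * (s == t)%:R by [].
rewrite (eq_bigr _ (fun t _ => E t)).
have [sB|sB] := boolP (s \in B); last first.
  rewrite -[LHS]/(fcoef x s) xB // big_seq big1 // => t tB.
  by case: eqVneq => [st|_]; [rewrite st tB in sB | rewrite mulr0].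
rewrite (big_rem s) //= eqxx mulr1 big_seq big1 ?addr0 // => t.
rewrite mem_rem_uniq ?fset_uniq // inE => /andP[ts _].
by rewrite eq_sym (negPf ts) mulr0.
Qed.

Definition fsupp (x : freemod A T) : {fset T} := fset_set [set t | fcoef x t != 0]%classic.

Lemma fsuppP (x : freemod A T) t : t \notin fsupp x -> fcoef x t = 0.
Proof.
apply: contraNeq => xt; rewrite in_fset_set; first exact/mem_set.
exact: fcoef_finite.
Qed.

Lemma freemod_ind (P : freemod A T -> Prop) x : P 0 ->
  (forall y z, P y -> P z -> P (y + z)) -> (forall a t, P (a *: fdelta t)) -> P x.
Proof.
move=> P0 PD Pd; rewrite (freemod_expand (@fsuppP x)).
by apply: (big_ind P).
Qed.

Definition coordf (t : T) (x : freemod A T) : A^o := fcoef x t.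
Fact coordf_linear t : linear (coordf t). Proof. by []. Qed.
HB.instance Definition _ t :=
  GRing.isLinear.Build A (freemod A T) A^o *:%R (coordf t) (coordf_linear t).

Section Scaling.
Variables (V : lmodType A) (v : V).
Definition scalev (a : A^o) : V := (a : A) *: v.
Fact scalev_linear : linear scalev.
Proof. by move=> a x y; rewrite /scalev scalerDl scalerA. Qed.
HB.instance Definition _ := GRing.isLinear.Build A A^o V *:%R scalev scalev_linear.
End Scaling.

Fact to_freemod_subproof (x : F A T) : (fun t => coef t x) \in @finsuppp A T.
Proof.
apply/asboolP; apply: (sub_finite_set _ (finite_fset (supp x))) => t /= xt.
by rewrite mem_supp; apply/eqP.
Qed.
Definition to_freemod (x : F A T) : freemod A T :=
  exist (fun f : T -> A^o => f \in @finsuppp A T) _ (to_freemod_subproof x).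

Lemma freemod_eq (x y : freemod A T) : (forall t, fcoef x t = fcoef y t) -> x = y.
Proof. by move=> xy; apply: val_inj; apply/funext. Qed.

Fact to_freemod_linear : linear to_freemod.
Proof.
move=> a x y; apply: freemod_eq => t; rewrite -[LHS]/(coef t (a *: x + y)).
by rewrite coefD coefZ.
Qed.
HB.instance Definition _ :=
  GRing.isLinear.Build A (F A T) (freemod A T) *:%R to_freemod to_freemod_linear.

Lemma to_freemod_inj : injective to_freemod.
Proof.
by move=> x y /(congr1 (@fcoef A T)) /funeqP xy; apply: dsum_eq => t; apply: xy.
Qed.

Definition of_freemod (x : freemod A T) : F A T := mkdsum (fcoef x : T -> A^o).
Lemma of_freemodK : cancel of_freemod to_freemod.
Proof.
move=> x; apply: freemod_eq => t; rewrite -[LHS]/(coef t (of_freemod x)).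
by rewrite (coef_mk _ (B := fsupp x)) //; apply: fsuppP.
Qed.

End FreeModuleExtra.

Lemma homology_zeroP (A : pzRingType) (U V W : lmodType A)
    (f : {linear U -> V}) (g : {linear V -> W}) :
  zero_module (homology f g) <-> forall v, g v = 0 -> exists u, v = f u.
Proof.
split=> [h v gv | h x].
  have kv : v \in kerp g by apply/eqP.
  have := h (qmod (bdry f (g := g)) (exist (fun x => x \in kerp g) v kv : subm (kerp g))).
  rewrite -(raddf0 (qmod _)) => /qmod_eqP; rewrite subr0.
  by move=> /asboolP.
rewrite -[x]qreprK; case: (qrepr x) => v kv.
rewrite -(raddf0 (qmod _)); apply/qmod_eqP; rewrite subr0.
by apply/asboolP; apply: h; apply/eqP.
Qed.

Section KernelInclusion.
Variables (A : pzRingType) (U V : lmodType A) (f : {linear U -> V}).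

Definition kerval (z : subm (kerp f)) : U := val z.
Fact kerval_linear : linear kerval. Proof. by []. Qed.
HB.instance Definition _ :=
  GRing.isLinear.Build A (subm (kerp f)) U *:%R kerval kerval_linear.

Lemma kerval_inj : injective kerval. Proof. exact: val_inj. Qed.

Lemma kervalK z : f (kerval z) = 0.
Proof. by apply/eqP; apply: (valP z). Qed.

Lemma kervalP x : f x = 0 -> exists z, x = kerval z.
Proof.
by move=> /eqP x0; exists (exist (fun x => x \in kerp f) x x0).
Qed.
End KernelInclusion.

Lemma aug_surj (A : comPzRingType) (V : lmodType A) (z : V) : exists x, z = aug x.
Proof. by exists (fdelta z); rewrite /aug freelift_delta. Qed.

Section Tensors.
Variables (A : comPzRingType) (M : lmodType A).

Section Bilinear.
Variable N : lmodType A.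

Definition tensr (m : M) (n : N) : tens N M := tensor n m.
Fact tensr_linear m : linear (tensr m).
Proof. by move=> a x y; rewrite /tensr tensorDl tensorZl. Qed.
HB.instance Definition _ m :=
  GRing.isLinear.Build A N (tens N M) *:%R (tensr m) (tensr_linear m).

Definition tensl (n : N) (m : M) : tens N M := tensor n m.
Fact tensl_linear n : linear (tensl n).
Proof. by move=> a x y; rewrite /tensl tensorDr tensorZr. Qed.
HB.instance Definition _ n :=
  GRing.isLinear.Build A M (tens N M) *:%R (tensl n) (tensl_linear n).

Lemma tens_ind (P : tens N M -> Prop) u : P 0 ->
  (forall y z, P y -> P z -> P (y + z)) -> (forall n m, P (tensor n m)) -> P u.
Proof.
move=> P0 PD Pt; rewrite -[u]qreprK.
elim/freemod_ind: (qrepr u) => [|y z Py Pz|a [n m]]; first by rewrite raddf0.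
  by rewrite raddfD; apply: PD.
by rewrite linearZ /= -[qmod _ _]/(tensor n m) -tensorZl.
Qed.
End Bilinear.

Section TensMapLinear.
Variables (N N' : lmodType A) (f : {linear N -> N'}).
Lemma tensmap0 : tensmap M f 0 = 0. Proof. exact: raddf0. Qed.
Lemma tensmapD u v : tensmap M f (u + v) = tensmap M f u + tensmap M f v.
Proof. exact: raddfD. Qed.
End TensMapLinear.

Lemma tensor0r (N : lmodType A) (n : N) : tensor n (0 : M) = 0.
Proof. exact: (raddf0 (tensl n)). Qed.

Lemma tensor0l (N : lmodType A) (m : M) : tensor (0 : N) m = 0.
Proof. exact: (raddf0 (@tensr N m)). Qed.

Lemma tensmap_comp (N1 N2 N3 : lmodType A) (f : {linear N1 -> N2})
    (g : {linear N2 -> N3}) (h : {linear N1 -> N3}) u :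
  (forall x, g (f x) = h x) -> tensmap M g (tensmap M f u) = tensmap M h u.
Proof.
move=> gf; elim/tens_ind: u => [|y z Ey Ez|n m]; first by rewrite !tensmap0.
  by rewrite !tensmapD Ey Ez.
by rewrite !tensmapE gf.
Qed.

Lemma tensmap_eq0 (N N' : lmodType A) (f : {linear N -> N'}) u :
  (forall x, f x = 0) -> tensmap M f u = 0.
Proof.
move=> f0; elim/tens_ind: u => [|y z Ey Ez|n m]; first exact: tensmap0.
  by rewrite tensmapD Ey Ez addr0.
by rewrite tensmapE f0 tensor0l.
Qed.

Lemma tensmap_surj (N N' : lmodType A) (f : {linear N -> N'}) u :
  (forall y, exists x, y = f x) -> exists v, u = tensmap M f v.
Proof.
move=> fs; elim/tens_ind: u => [|y z [v ->] [w ->]|n m].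
- by exists 0; rewrite tensmap0.
- by exists (v + w); rewrite tensmapD.
- by have [x ->] := fs n; exists (tensor x m); rewrite tensmapE.
Qed.

Section Presentation.
Variables (T : choiceType) (q : {linear F A T -> M}).
Hypothesis q_surj : forall m, exists x, m = q x.

(** The map from N (x) F to N (x) M induced by [q]. *)
Definition tq (N : lmodType A) : dsum T N -> tens N M :=
  dlift (fun t => tensr (q (e A t)) : {linear N -> tens N M}).
HB.instance Definition _ N := GRing.Linear.on (@tq N).

Section TqLinear.
Variable N : lmodType A.
Lemma tq0 : tq (0 : dsum T N) = 0. Proof. exact: raddf0. Qed.
Lemma tqD (x y : dsum T N) : tq (x + y) = tq x + tq y. Proof. exact: raddfD. Qed.
Lemma tqB (x y : dsum T N) : tq (x - y) = tq x - tq y. Proof. exact: raddfB. Qed.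
Lemma tqZ a (x : dsum T N) : tq (a *: x) = a *: tq x. Proof. exact: linearZ. Qed.
End TqLinear.

Lemma tq_single (N : lmodType A) t (n : N) : tq (single t n) = tensor n (q (e A t)).
Proof. exact: dlift_single. Qed.

Lemma tq_dact (N : lmodType A) x (n : N) : tq (dact x n) = tensor n (q x).
Proof.
have H : @tq N \o dactl n =1 tensl n \o q; last exact: H.
by apply: F_ext => t /=; rewrite /dactl dact_e tq_single.
Qed.

Lemma tq_surj (N : lmodType A) (u : tens N M) : exists n, u = tq n.
Proof.
elim/tens_ind: u => [|y z [n ->] [n' ->]|n m].
- by exists 0; rewrite tq0.
- by exists (n + n'); rewrite tqD.
- by have [x ->] := q_surj m; exists (dact x n); rewrite tq_dact.
Qed.

Lemma tensmap_tq (N N' : lmodType A) (f : {linear N -> N'}) n :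
  tensmap M f (tq n) = tq (dmap f n).
Proof.
have H : tensmap M f \o @tq N =1 @tq N' \o dmap f; last exact: H.
by apply: dsum_ext => t v /=; rewrite dmap_single !tq_single tensmapE.
Qed.

Section Kernel.
Variable N : lmodType A.

Definition tqker_gen : set (dsum T N) := [set n | exists x a, q x = 0 /\ n = dact x a]%classic.
Local Notation W := (span tqker_gen).

Lemma tqker_mem x a : q x = 0 -> dact x a \in W.
Proof.
move=> qx; apply/asboolP; exists [:: (1, dact x a)]; last by rewrite big_seq1 scale1r.
by move=> p; rewrite inE => /eqP->; exists x, a.
Qed.

(* The kernel is computed with the map to the cokernel of the relations given by
   (n, m) |-> n x for any preimage x of m. *)
Lemma tq_ker n : tq n = 0 -> n \in W.
Proof.
have [s sP] := choice q_surj.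
pose k0 : freemod A (N * M)%type -> quotmod W :=
  freelift (fun p => qmod W (dact (s p.2) p.1)).
have qmod0 z : z \in W -> qmod W z = 0.
  by move=> zW; rewrite -(raddf0 (qmod W)); apply/qmod_eqP; rewrite subr0.
(* The section [s] is not linear, but another preimage changes the value only by a generator of [W];
   this restores bilinearity in the quotient. *)
have qmodE x y a : q x = q y -> qmod W (dact x a) = qmod W (dact y a).
  move=> xy; apply/qmod_eqP; rewrite -dactBl.
  by apply: tqker_mem; rewrite linearB xy subrr.
have k0d p : k0 (fdelta p) = qmod W (dact (s p.2) p.1) by apply: freelift_delta.
have k0l : linear k0 by move=> a x y; rewrite /k0 linearP.
have qD x y : qmod W (x + y) = qmod W x + qmod W y by exact: raddfD.
have qZ a x : qmod W (a *: x) = a *: qmod W x by exact: linearZ.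
pose k0L : {linear freemod A (N * M)%type -> quotmod W} :=
  HB.pack k0 (GRing.isLinear.Build A _ _ _ k0 k0l).
have k00 x : x \in span (@tens_rel A N M) -> k0L x = 0.
  case/asboolP => l lr ->; rewrite linear_sum big_seq big1 // => p /lr rp.
  rewrite linearZ /=; suff -> : k0 p.2 = 0 by rewrite scaler0.
  have k0B x' y' : k0 (x' - y') = k0 x' - k0 y' by rewrite -[k0]/(k0L : _ -> _) linearB.
  have k0Z a y' : k0 (a *: y') = a *: k0 y' by rewrite -[k0]/(k0L : _ -> _) linearZ.
  case: rp => [[a [b [m ->]]]|[b [m [m' ->]]]|[a [b [m ->]]]|[a [b [m ->]]]].
  - by rewrite !k0B !k0d dactDr qD -addrA -opprD subrr.
  - rewrite !k0B !k0d -addrA -opprD -qD -dactDl; apply/eqP; rewrite subr_eq0; apply/eqP.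
    by apply: qmodE; rewrite [RHS]raddfD /= -!sP.
  - by rewrite k0B k0Z !k0d dactZr qZ subrr.
  - rewrite k0B k0Z !k0d -qZ -dactZl; apply/eqP; rewrite subr_eq0; apply/eqP.
    by apply: qmodE; rewrite [RHS]linearZ /= -!sP.
pose k1 : {linear tens N M -> quotmod W} :=
  HB.pack (qlift k0L : tens N M -> quotmod W)
    (GRing.isLinear.Build A _ _ _ (qlift k0L) (qlift_linear k00)).
have E : k1 \o @tq N =1 qmod W.
  apply: dsum_ext => t v; have <- := dact_e t v.
  transitivity (k0 (fdelta (v, q (e A t)))).
    by rewrite [LHS]/= tq_dact; exact: (qliftE k00).
  by rewrite k0d; apply: qmodE; rewrite -sP.
move=> tn; have qn : qmod W n = 0.
  by rewrite -(E n) -[RHS](raddf0 k1); exact: (congr1 k1 tn).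
by rewrite -[n]subr0; apply/qmod_eqP; rewrite qn raddf0.
Qed.

End Kernel.

(** Right exactness on representatives: a relation [dact x a] over N' lifts to one over [N] by
    lifting [a] along [f], so a representative of [u] can be corrected until [dmap f] kills it. *)
Lemma tens_right_exact (N N' : lmodType A) (f : {linear N -> N'}) (u : tens N M) :
  (forall y, exists x, y = f x) -> tensmap M f u = 0 ->
  exists n, u = tq n /\ dmap f n = 0.
Proof.
move=> fs; have [n ->] := tq_surj u; rewrite tensmap_tq => /tq_ker/asboolP[l lP E].
suff [n' [n'0 E']] : exists n', tq n' = 0 /\ dmap f n' = dmap f n.
  by exists (n - n'); rewrite tqB n'0 subr0 raddfB /= E' subrr.
rewrite {}E; elim: l lP => [|p l IH] lP.
  by exists 0; rewrite tq0 raddf0 big_nil.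
have [|n' [n'0 E']] := IH; first by move=> r rl; apply: lP; rewrite inE rl orbT.
have [x [a [qx E]]] := lP p (mem_head _ _); have [a' Ea] := fs a.
exists (p.1 *: dact x a' + n'); rewrite big_cons -E' E Ea tqD tqZ.
rewrite tq_dact qx n'0 tensor0r scaler0 addr0; split=> //.
by rewrite raddfD /= linearZ /= dmap_dact.
Qed.

End Presentation.

(** The free cover on the elements of [M] itself, for arguments in which no presentation is
    given. *)
Definition from_all : F A M -> M := dlift (fun m => scalev m).
HB.instance Definition _ := GRing.Linear.on from_all.
Lemma from_all_surj m : exists x, m = from_all x.
Proof. by exists (e A m); rewrite /from_all dlift_single /= /scalev scale1r. Qed.

(** For a basis [q] is injective, so 0 is the only relation and [tensmap M g] acts as [g] in each
    coordinate. *)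
Lemma free_flat : free_module M -> flat_module M.
Proof.
case=> T [f fb] N N' g ginj u v.
have finj := bij_inj fb; case: (fb) => f' _ f'K.
have qs m : exists x, m = (f \o @to_freemod A T) x.
  by exists (of_freemod (f' m)); rewrite /= of_freemodK f'K.
have [n ->] := tq_surj qs u; have [n' ->] := tq_surj qs v.
rewrite !tensmap_tq => /eqP; rewrite -subr_eq0 -tqB -raddfB => /eqP /(tq_ker qs)/asboolP[l lP E].
congr (tq _); apply/eqP; rewrite -subr_eq0; apply/eqP.
have {}E : dmap g (n - n') = 0.
  rewrite {}E big_seq big1 // => p /lP[x [a [/= fx ->]]].
  have -> : x = 0 by apply: to_freemod_inj; apply: finj; rewrite fx !linear0.
  by rewrite dact0l scaler0.
apply: dsum_eq => t; rewrite linear0; apply: ginj.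
by rewrite -coef_dmap E !linear0.
Qed.

(* Two consecutive steps of a free resolution, factored through the syzygies. *)
Section Syzygies.
Variables (P2 Z2 P1 Z1 P0 : lmodType A).
Variables (a2 : {linear P2 -> Z2}) (k1 : {linear Z2 -> P1}).
Variables (a1 : {linear P1 -> Z1}) (k0 : {linear Z1 -> P0}).
Variables (d2 : {linear P2 -> P1}) (d1 : {linear P1 -> P0}).
Hypotheses (d2E : forall x, k1 (a2 x) = d2 x) (d1E : forall x, k0 (a1 x) = d1 x).
Hypothesis a1_surj : forall y, exists x, y = a1 x.

(** Dimension shift: an element of Z1 (x) M that dies in P0 (x) M lifts to a cycle of P1 (x) M; this
    is a boundary, and boundaries die in Z1 (x) M. *)
Lemma homology_zero_inj : (forall z, a1 (k1 z) = 0) ->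
  zero_module (homology (tensmap M d2) (tensmap M d1)) ->
  forall u : tens Z1 M, tensmap M k0 u = 0 -> u = 0.
Proof.
move=> ak /homology_zeroP h' u.
have h v : tensmap M d1 v = 0 -> exists w, v = tensmap M d2 w by apply: h'.
have [v ->] := tensmap_surj u a1_surj.
rewrite (tensmap_comp _ d1E) => /h[w ->].
rewrite -(tensmap_comp _ d2E) (tensmap_comp _ (h := a1 \o k1)) //.
exact: tensmap_eq0.
Qed.

(** Flatness keeps [k0] injective, so a cycle already dies in Z1 (x) M. Right exactness then
    represents it by coefficients in the kernel of [a1], which lift through [k1] and [a2] one by
    one. *)
Lemma flat_homology_zero : flat_module M -> injective k0 ->
  (forall y, exists x, y = a2 x) -> (forall x, a1 x = 0 -> exists z, x = k1 z) ->
  zero_module (homology (tensmap M d2) (tensmap M d1)).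
Proof.
move=> flM k0inj a2_surj exact1; apply/homology_zeroP => v v0.
have : tensmap M a1 v = 0.
  by apply: (flM _ _ _ k0inj); rewrite tensmap0 (tensmap_comp _ d1E).
case/(tens_right_exact from_all_surj a1_surj) => n [-> n0].
have [n1 E1] : exists n1, n = dmap k1 n1.
  by apply: dmap_lift => t; apply: exact1; rewrite -coef_dmap n0 linear0.
have [n2 E2] : exists n2, n1 = dmap a2 n2.
  by apply: dmap_lift => t; apply: a2_surj.
exists (tq from_all n2); rewrite E1 E2 -!tensmap_tq.
exact: tensmap_comp.
Qed.
End Syzygies.

End Tensors.

Section Torsion.
Variables (A : comPzRingType) (M N : lmodType A).
Local Notation Z := (syz N).

Definition syz_cover j : {linear resol N j -> Z j} := @aug A (Z j).
Definition syz_incl j : {linear Z j.+1 -> resol N j} := kerval (f := @aug A (Z j)).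

Lemma syz_incl_cover j x : syz_incl j (syz_cover j.+1 x) = resol_d x.
Proof. by []. Qed.
Lemma syz_cover_surj j y : exists x, y = syz_cover j x.
Proof. exact: aug_surj. Qed.
Lemma syz_cover_incl j z : syz_cover j (syz_incl j z) = 0.
Proof. exact: (@kervalK A _ _ (syz_cover j)). Qed.
Lemma syz_incl_inj j : injective (syz_incl j).
Proof. exact: (@kerval_inj A _ _ (syz_cover j)). Qed.
Lemma syz_exact j x : syz_cover j x = 0 -> exists z, x = syz_incl j z.
Proof. exact: (@kervalP A _ _ (syz_cover j)). Qed.

Lemma tor_zero_inj j : zero_module (Tor j.+1 N M) ->
  forall u : tens (Z j.+1) M, tensmap M (syz_incl j) u = 0 -> u = 0.
Proof.
exact: (@homology_zero_inj A M _ _ _ _ _ (syz_cover j.+2) (syz_incl j.+1)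
  (syz_cover j.+1) (syz_incl j) (@resol_d A N j.+1) (@resol_d A N j)
  (@syz_incl_cover _) (@syz_incl_cover _) (@syz_cover_surj _) (@syz_cover_incl _)).
Qed.

Lemma flat_tor_zero j : flat_module M -> zero_module (Tor j.+1 N M).
Proof.
move=> flM.
exact: (@flat_homology_zero A M _ _ _ _ _ (syz_cover j.+2) (syz_incl j.+1)
  (syz_cover j.+1) (syz_incl j) (@resol_d A N j.+1) (@resol_d A N j)
  (@syz_incl_cover _) (@syz_incl_cover _) (@syz_cover_surj _) flM
  (@syz_incl_inj _) (@syz_cover_surj _) (@syz_exact _)).
Qed.
End Torsion.

(** * Exactness with varying coefficients *)

Section Projection.
Variables (A : comPzRingType) (T : choiceType).

Section Def.
Variables (B : pred T) (V : lmodType A).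

Definition dprj (x : dsum T V) : dsum T V := mkdsum (fun t => if B t then coef t x else 0).

Lemma coef_dprj t x : coef t (dprj x) = if B t then coef t x else 0.
Proof.
by rewrite (coef_mk _ (B := supp x)) // => s /coef_supp ->; rewrite if_same.
Qed.

Fact dprj_linear : linear dprj.
Proof.
move=> a x y; apply: dsum_eq => t; rewrite !(coefD, coefZ, coef_dprj).
by case: ifP => // _; rewrite scaler0 addr0.
Qed.
HB.instance Definition _ :=
  GRing.isLinear.Build A (dsum T V) (dsum T V) *:%R dprj dprj_linear.

Lemma dprj_id x : (forall t, ~~ B t -> coef t x = 0) -> dprj x = x.
Proof. by move=> xB; apply: dsum_eq => t; rewrite coef_dprj; case: ifPn => [|/xB]. Qed.

Lemma dprj_eq0 x : (forall t, B t -> coef t x = 0) -> dprj x = 0.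
Proof.
by move=> xB; apply: dsum_eq => t; rewrite coef_dprj linear0; case: ifPn => [/xB|].
Qed.

Lemma dprj_single t v : dprj (single t v) = if B t then single t v else 0.
Proof.
apply: dsum_eq => s; rewrite coef_dprj coef_single.
case: (eqVneq s t) => [->|st]; first by case: ifP => _; rewrite ?coef_single ?eqxx ?linear0.
by rewrite if_same; case: ifP => _; rewrite ?coef_single ?(negPf st) ?linear0.
Qed.

End Def.

Lemma dprj_idem B V (x : dsum T V) : dprj B (dprj B x) = dprj B x.
Proof. by apply: dsum_eq => t; rewrite !coef_dprj; case: (B t). Qed.

Lemma dprjC_add (B : pred T) (V : lmodType A) (x : dsum T V) :
  x = dprj B x + dprj (predC B) x.
Proof.
apply: dsum_eq => t; rewrite raddfD /= !coef_dprj /=.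
by case: (B t); rewrite /= ?addr0 ?add0r.
Qed.

Lemma dmap_dprj B (V U : lmodType A) (f : {linear V -> U}) x :
  dmap f (dprj B x) = dprj B (dmap f x).
Proof.
apply: dsum_eq => t; rewrite coef_dmap !coef_dprj coef_dmap.
by case: ifP => // _; rewrite linear0.
Qed.

Variables (D : T -> F A T) (p : pred T).
Hypothesis Dp : forall t s, coef s (D t) != 0 -> p s = ~~ p t.

(** The matrix [D] is odd for the parity [p], so the differential exchanges the two halves. *)
Lemma dD_dprj (V : lmodType A) (x : dsum T V) :
  dD D (dprj p x) = dprj (predC p) (dD D x).
Proof.
have H : @dD A T D V \o @dprj p V =1 @dprj (predC p) V \o @dD A T D V.
  apply: dsum_ext => t v /=; rewrite dprj_single dD_single.
  case: ifP => pt; rewrite ?dD_single ?raddf0.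
    rewrite dprj_id // => s; rewrite negbK coef_dact => ps.
    case: (eqVneq (coef s (D t)) 0) => [->|/Dp]; first by rewrite scale0r.
    by rewrite ps pt.
  rewrite dprj_eq0 // => s /= ps; rewrite coef_dact.
  case: (eqVneq (coef s (D t)) 0) => [->|/Dp]; first by rewrite scale0r.
  by rewrite pt (negPf ps).
exact: H.
Qed.

End Projection.

Section Exactness.
Variables (A : comPzRingType) (T : choiceType) (D : T -> F A T).
Implicit Types V : lmodType A.
Local Notation d := (dD D).

Definition submodP V (W : V -> Prop) :=
  [/\ W 0, forall x y, W x -> W y -> W (x + y) & forall (a : A) x, W x -> W (a *: x)].

(* Exactness of the complex with coefficients in V / W. *)
Definition exact_mod V (W : V -> Prop) := forall n : dsum T V,
  (forall t, W (coef t (d n))) -> exists n', forall t, W (coef t (n - d n')).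

Definition exact_coef V := exact_mod (fun v : V => v = 0).

Lemma exact_coefP V : exact_coef V <->
  (forall n : dsum T V, d n = 0 -> exists n', n = d n').
Proof.
split=> H n n0.
  have [t|n' n'P] := H n; first by rewrite n0 raddf0.
  by exists n'; apply/eqP; rewrite -subr_eq0; apply/eqP/dsum_eq => t; rewrite n'P raddf0.
have [|n' ->] := H n; first by apply: dsum_eq => t; rewrite n0 raddf0.
by exists n' => t; rewrite subrr raddf0.
Qed.

Lemma exact_mod_ext V (W W' : V -> Prop) : (forall v, W v <-> W' v) ->
  exact_mod W -> exact_mod W'.
Proof.
move=> WW' H n nW; have [t|n' n'P] := H n; first exact/WW'.
by exists n' => t; apply/WW'.
Qed.

Lemma exact_mod_all V (W : V -> Prop) : (forall v, W v) -> exact_mod W.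
Proof. by move=> WT n _; exists 0. Qed.

Lemma exact_mod_quot V (N : lmodType A) (f : {linear V -> N}) : (forall y, exists x, y = f x) ->
  exact_coef N -> exact_mod (fun v => f v = 0).
Proof.
move=> fs /exact_coefP H n nf; have [|m mP] := H (dmap f n).
  by rewrite -dmap_dD; apply: dsum_eq => t; rewrite coef_dmap nf raddf0.
have [n' E] : exists n', m = dmap f n' by apply: dmap_lift => t; apply: fs.
by exists n' => t; rewrite -coef_dmap raddfB /= dmap_dD -E mP subrr raddf0.
Qed.

Lemma submod_dD V (W : V -> Prop) (E : T -> F A T) n : submodP W ->
  (forall t, W (coef t n)) -> forall t, W (coef t (dD E n)).
Proof.
case=> W0 WD WZ Wn t; rewrite coef_dD.
by apply: (big_ind W) => // s _; apply: WZ.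
Qed.

Lemma submodN V (W : V -> Prop) x : submodP W -> W x -> W (- x).
Proof. by case=> _ _ WZ Wx; rewrite -scaleN1r; apply: WZ. Qed.

Lemma submodB V (W : V -> Prop) x y : submodP W -> W x -> W y -> W (x - y).
Proof. by move=> Ws Wx Wy; case: (Ws) => _ WD _; apply: WD => //; apply: submodN. Qed.

Definition addm V (W : V -> Prop) (z : V) (v : V) :=
  exists b (r : A), W b /\ v = b + r *: z.

Lemma submod_addm V (W : V -> Prop) z : submodP W -> submodP (addm W z).
Proof.
case=> W0 WD WZ; split.
- by exists 0, 0; rewrite scale0r addr0.
- move=> _ _ [b [r [Wb ->]]] [c [s [Wc ->]]]; exists (b + c), (r + s).
  by split; [apply: WD | rewrite scalerDl addrACA].
- move=> a _ [b [r [Wb ->]]]; exists (a *: b), (a * r).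
  by split; [apply: WZ | rewrite scalerDr scalerA].
Qed.

Hypothesis dd0 : forall t, d (D t) = 0.

Lemma dD_sq V (n : dsum T V) : d (d n) = 0.
Proof.
have H : @dD A T D V \o @dD A T D V =1 \0; last exact: H.
by apply: dsum_ext => t v /=; rewrite dD_single dD_dact dd0 dact0l.
Qed.

(** The sequence 0 -> A/(W : z) -> V/W -> V/(W + Az) -> 0 on representatives: after a correction
    over the right-hand term, [n] is modulo [W] a multiple z c, where c is a cycle modulo (W :
    z). *)
Lemma exact_mod_extension V (W : V -> Prop) (z : V) : submodP W ->
  exact_mod (addm W z) -> @exact_mod A^o (fun a => W ((a : A) *: z)) -> exact_mod W.
Proof.
move=> Ws Hz Ha n nW; case: (Ws) => W0 WD WZ.
have [t|n' n'P] := Hz n; first by exists (coef t (d n)), 0; rewrite scale0r addr0.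
have [//|t|c cP] := dmap_surj (f := scalev z) (W := W) (y := n - d n').
  by have [b [r [Wb E]]] := n'P t; exists r; rewrite E /scalev addrK.
have [t|c' c'P] := Ha c.
  have -> : (coef t (d c) : A) *: z = coef t (d n) - coef t (d (n - d n' - dmap (scalev z) c)).
    rewrite -raddfB -raddfB /= opprB addrC.
    have -> : dmap (scalev z) c - (n - d n') + n = dmap (scalev z) c + d n'.
      by rewrite opprB -addrA subrK.
    by rewrite raddfD /= dD_sq addr0 -dmap_dD coef_dmap.
  by apply: submodB => //; apply: submod_dD.
exists (n' + dmap (scalev z) c') => t.
have -> : n - d (n' + dmap (scalev z) c') =
    (n - d n' - dmap (scalev z) c) + dmap (scalev z) (c - d c').
  rewrite [d (_ + _)]raddfD [dmap _ (_ - _)]raddfB /= dmap_dD addrA subrK.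
  by rewrite opprD addrA.
by rewrite raddfD /=; apply: WD; [exact: cP | rewrite coef_dmap; exact: c'P].
Qed.

(** Being null-homotopic, [a] acts as zero on the homology with coefficients in A/I; being regular,
    it then embeds this homology in the one with coefficients in A/(I + (a)). *)
Lemma exact_mod_regular (I : A -> Prop) (a : A) (H : T -> F A T) : idealP I ->
  (forall t, d (H t) + dD H (D t) = a *: e A t) ->
  (forall x, I (x * a) -> I x) -> @exact_mod A^o (addp I a) -> @exact_mod A^o I.
Proof.
move=> II HH reg Ha n nI.
case: (II) => I0 ID IM; have Is : @submodP A^o I by [].
have homotopy (x : F A T) : d (dD H x) = a *: x - dD H (d x).
  apply/eqP; rewrite -subr_eq0 opprB addrA subr_eq0; apply/eqP.
  pose dF := @dD A T D A^o; pose hF := @dD A T H A^o.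
  have E : (dF \o hF) \+ (hF \o dF) =1 *:%R a.
    by apply: F_ext => t /=; rewrite /dF /hF !dD_e HH.
  exact: E.
(* Modulo [I] the boundary of [dD H n] is a n, so [dD H n] is a cycle modulo I + (a). Writing it as
   d n' + a c and applying [d] gives a n = a (d c) modulo [I], and [a] cancels. *)
have [t|n' n'P] := Ha (dD H n).
  exists (- coef t (dD H (d n))), (coef t n : A).
  split; first by apply: idealN => //; exact: (@submod_dD A^o I H (d n) Is nI t).
  by rewrite homotopy coefB coefZ addrC mulrC.
have [|t|c cP] := dmap_surj (f := scalev (a : A^o)) (W := I) (y := dD H n - d n').
- exact: I0.
- by have [b [r [Wb E]]] := n'P t; exists r; rewrite E /scalev addrK.
exists c => t; apply: reg; rewrite mulrC.
have E : a *: (n - d c) =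
    dD H (d n) + d (dD H n - d n' - dmap (scalev (a : A^o)) c).
  rewrite !dDB dD_sq subr0 homotopy -dmap_dD addrA addrCA subrr addr0 scalerBr.
  by congr (_ - _); apply: dsum_eq => s; rewrite coefZ coef_dmap /scalev /GRing.scale /= mulrC.
have -> : a * coef t (n - d c) = coef t (a *: (n - d c)) by rewrite coefZ.
rewrite E coefD.
apply: ID; first exact: (@submod_dD A^o I H (d n) Is nI t).
exact: (@submod_dD A^o I D _ Is cP t).
Qed.

(** If a maximal failure [I] omits [a i], then I + (a i) is larger and hence exact. Either [a i] is
    regular modulo [I], or (I : a i) is larger too and A/I is an extension of two exact cases. *)
Lemma exact_mod_noetherian (X : Type) (a : X -> A) : max_condition A ->
  (forall i, exists H : T -> F A T, forall t, d (H t) + dD H (D t) = a i *: e A t) ->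
  (forall I, idealP I -> (forall i, I (a i)) -> @exact_mod A^o I) ->
  forall I, idealP I -> @exact_mod A^o I.
Proof.
move=> noethA HH HJ I0 I0I; apply: contrapT => nI0.
have [||I [II nI] maxI] := noethA (fun I => idealP I /\ ~ @exact_mod A^o I).
- by move=> I [].
- by exists I0.
have maxI' J x : idealP J -> incl I J -> J x -> ~ I x -> @exact_mod A^o J.
  by move=> JI IJ Jx Ix; apply: contrapT => nJ; apply: Ix; apply: (maxI J).
have [Ia|/existsNP[i Iai]] := EM (forall i, I (a i)); first exact: nI (HJ I II Ia).
have Ha : @exact_mod A^o (addp I (a i)).
  by apply: (maxI' _ (a i)) => //; [apply: ideal_addp | apply: addp_incl | apply: addp_gen].
have [reg|/existsNP[x /not_implyP[Ixa nIx]]] := EM (forall x, I (x * a i) -> I x).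
  by have [H HP] := HH i; apply: nI; apply: exact_mod_regular reg Ha.
apply: nI; apply: (@exact_mod_extension A^o I (a i)) => //.
apply: (maxI' (colon I (a i)) x) => //; first exact: ideal_colon.
by move=> y Iy; rewrite /colon mulrC; case: II => _ _; apply.
Qed.

(* If N is the only prime containing all a i, then an ideal containing all a i and
   maximal without the property would have N as an associated prime. *)
Lemma exact_mod_isolated (X : Type) (a : X -> A) (N : A -> Prop) : max_condition A ->
  (forall P, primeP P -> (forall i, P (a i)) -> forall x, N x <-> P x) ->
  @exact_mod A^o N ->
  forall I, idealP I -> (forall i, I (a i)) -> @exact_mod A^o I.
Proof.
move=> noethA HP HN I0 I0I I0a; apply: contrapT => nI0.
have [||I [II Ia nI] maxI] :=
  noethA (fun I => [/\ idealP I, forall i, I (a i) & ~ @exact_mod A^o I]).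
- by move=> I [].
- by exists I0.
have nI1 : ~ I 1.
  move=> I1; apply: nI; apply: exact_mod_all => v.
  by rewrite -[v]mulr1; case: II => _ _; apply.
have [b nIb bP] := colon_prime noethA II nI1.
apply: nI; apply: (@exact_mod_extension A^o I b) => //.
  apply: contrapT => nb; apply: nIb; apply: (maxI (addp I b)).
  - split=> //; first exact: ideal_addp.
    by move=> i; apply: addp_incl.
  - exact: addp_incl.
  - exact: addp_gen.
apply: (exact_mod_ext _ HN); apply: (HP (colon I b)) => // i.
by rewrite /colon mulrC; case: II => _ _; apply.
Qed.

(** Induction along a filtration with cyclic subquotients. Quantifying over all W' above [W] says
    that [s] generates V/W without forming the quotient. *)
Lemma exact_mod_fingen V (s : seq V) (W : V -> Prop) :
  (forall I, idealP I -> @exact_mod A^o I) -> submodP W ->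
  (forall (v : V) W', submodP W' -> (forall x, W x -> W' x) ->
     (forall x, x \in s -> W' x) -> W' v) ->
  exact_mod W.
Proof.
move=> HI; elim: s W => [|z s IH] W Ws gen.
  by apply: exact_mod_all => v; apply: gen.
case: (Ws) => W0 WD WZ; apply: (@exact_mod_extension _ W z) => //.
  apply: IH => [|v W' W's sub W's']; first exact: submod_addm.
  apply: gen => // x; first by move=> Wx; apply: sub; exists x, 0; rewrite scale0r addr0.
  rewrite inE => /orP[/eqP->|/W's' //]; apply: sub; exists 0, 1.
  by rewrite scale1r add0r.
apply: HI; split; first by rewrite scale0r.
  by move=> x y Wx Wy; rewrite scalerDl; apply: WD.
by move=> b x Wx; rewrite -scalerA; apply: WZ.
Qed.

Definition pairing (U : {fset T}) (g x : F A T) : A^o :=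
  \sum_(u <- U) (coef u g : A) * coef u x.

Fact pairing_linear U g : linear (pairing U g).
Proof.
move=> b x y; rewrite /pairing scaler_sumr -big_split; apply: eq_bigr => u _ /=.
by rewrite coefD coefZ mulrDr mulrCA.
Qed.
HB.instance Definition _ U g :=
  GRing.isLinear.Build A (F A T) A^o *:%R (pairing U g) (pairing_linear U g).

Lemma pairingDl U b g h x : pairing U (b *: g + h) x = b *: pairing U g x + pairing U h x.
Proof.
rewrite /pairing scaler_sumr -big_split; apply: eq_bigr => u _ /=.
by rewrite coefD coefZ mulrDl -mulrA.
Qed.

Lemma pairing_e (U : {fset T}) g u : u \in U -> pairing U g (e A u) = coef u g.
Proof.
move=> uU; rewrite /pairing (big_rem u) //= coef_single eqxx mulr1 big_seq big1 ?addr0 //.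
move=> t; rewrite mem_rem_uniq ?fset_uniq // inE => /andP[tu _].
by rewrite coef_single (negPf tu) mulr0.
Qed.

(* Exactness with coefficients in F modulo the forms vanishing on the cycles
   supported in U yields a contraction defined on these cycles. *)
Lemma cycle_contraction : (forall I, idealP I -> @exact_mod A^o I) ->
  forall U : {fset T}, exists s : {linear F A T -> F A T},
    forall g, (forall t, t \notin U -> coef t g = 0) -> d g = 0 -> d (s g) = g.
Proof.
move=> HI U.
pose cycle (g : F A T) := (forall t, t \notin U -> coef t g = 0) /\ d g = 0.
pose W (x : F A T) := forall g, cycle g -> pairing U g x = 0.
have Ws : submodP W.
  split=> [g _|x y Wx Wy g cg|b x Wx g cg]; first by rewrite linear0.
    by rewrite linearD /= Wx // Wy // addr0.
  by rewrite linearZ /= Wx // scaler0.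
have WU : exact_mod W.
  (* Pairings see only the coordinates in [U], so F/W is generated by the finitely many [e A u]. *)
  apply: (@exact_mod_fingen _ [seq e A u | u <- U]) => // v W' [W'0 W'D W'Z] sub W'U.
  pose v' := \sum_(u <- U) (coef u v : A) *: e A u.
  have -> : v = (v - v') + v' by rewrite subrK.
  apply: (W'D); last first.
    rewrite /v' big_seq; apply: (big_ind W' W'0 W'D) => u uU.
    by apply: (W'Z (coef u v)); apply: W'U; apply: map_f.
  apply: sub => g _; apply/eqP; rewrite (linearB (pairing U g)) subr_eq0 linear_sum /=.
  apply/eqP; rewrite {1}/pairing; apply: eq_big_seq => u uU.
  by rewrite linearZ /= pairing_e // mulrC.
(* A universal element: pairing its coefficients with [g] returns [g]. Hence it is a cycle modulo
   [W], and one primitive n' contracts all cycles supported in [U], linearly in [g]. *)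
pose n : dsum T (F A T) := mkdsum (fun t => if t \in U then e A t else 0).
have coefn t : coef t n = if t \in U then e A t else 0.
  by rewrite (coef_mk _ (B := U)) // => s /negPf->.
have nE g : (forall t, t \notin U -> coef t g = 0) -> dmap (pairing U g) n = g.
  move=> gU; apply: dsum_eq => t; rewrite coef_dmap coefn /=.
  by case: ifPn => [/pairing_e->|/gU->] //; rewrite (linear0 (pairing U g)).
have [t g [gU dg]|n' n'P] := WU n.
  by rewrite -coef_dmap dmap_dD nE // dg coef0.
pose s g := dmap (pairing U g) n'.
have sl : linear s.
  move=> b x y; apply: dsum_eq => t.
  by rewrite /s coefD coefZ !coef_dmap /= pairingDl.
pose sL : {linear F A T -> F A T} := HB.pack s (GRing.isLinear.Build A _ _ _ s sl).
exists sL => g gU dg; rewrite /sL /=.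
rewrite /s -dmap_dD; apply/eqP; rewrite eq_sym -subr_eq0 -{1}(nE g gU) -dmapB.
by apply/eqP/dsum_eq => t; rewrite coef_dmap coef0; apply: n'P.
Qed.

(** A cycle involves finitely many basis elements of [freemod A Z], each contributing a cycle over
    [A]. *)
Lemma exact_coef_free (Z : choiceType) : exact_coef A^o -> exact_coef (freemod A Z).
Proof.
move=> /exact_coefP HA; apply/exact_coefP => n dn.
pose Zs : {fset Z} := (\bigcup_(t <- supp n) fsupp (coef t n))%fset.
have ZsP t z : z \notin Zs -> fcoef (coef t n) z = 0.
  move=> zZ; apply: fsuppP; apply: contra zZ => zt; apply/bigfcupP; exists t => //.
  rewrite andbT mem_supp; apply: contraTneq zt => ->.
  by rewrite in_fset_set ?inE //=; [apply/negP => /set_mem /= /eqP|exact: fcoef_finite].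
have /choice[y yP] : forall z, exists y, dmap (coordf z) n = d y.
  by move=> z; apply: HA; rewrite -dmap_dD dn dmap0.
exists (\sum_(z <- Zs) dmap (scalev (fdelta z)) (y z)).
rewrite [d _]linear_sum /=; apply: dsum_eq => t; rewrite linear_sum /=.
rewrite {1}(freemod_expand (ZsP t)); apply: eq_bigr => z _.
by rewrite -dmap_dD coef_dmap -yP coef_dmap.
Qed.

(** * From vanishing of Tor to exactness, one parity at a time *)

Section TorsionExact.
Variables (p : pred T) (M : lmodType A) (q : {linear F A T -> M}).
Hypothesis Dp : forall t s, coef s (D t) != 0 -> p s = ~~ p t.
Hypothesis q_surj : forall m, exists x, m = q x.
Hypothesis q_ker : forall x, q x = 0 <-> exists y, dprj (predC p) x = d y.

Lemma qD t : q (D t) = 0.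
Proof.
apply/q_ker; have [pt|pt] := boolP (p t).
  exists (e A t); rewrite dD_e dprj_id // => s; rewrite negbK => ps.
  by apply/eqP; apply: contraTT pt => /Dp; rewrite ps => <-.
exists 0; rewrite dD0 dprj_eq0 // => s /= ps.
by apply/eqP; apply: contraNT pt => /Dp; rewrite (negPf ps) => /esym/negbFE.
Qed.

Lemma tq_dD N (n : dsum T N) : tq q (d n) = 0.
Proof.
have H : @tq A M T q N \o @dD A T D N =1 \0; last exact: H.
by apply: dsum_ext => t v /=; rewrite dD_single tq_dact qD tensor0r.
Qed.

Lemma tq_eq0 N (n : dsum T N) : tq q n = 0 -> exists n', dprj (predC p) n = d n'.
Proof.
move/(tq_ker q_surj)/asboolP => [l lP ->]; elim: l lP => [|r l IH] lP.
  by exists 0; rewrite big_nil raddf0 dD0.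
have [|n' E] := IH; first by move=> x xl; apply: lP; rewrite inE xl orbT.
have [x [a [/q_ker[y yE] rE]]] := lP r (mem_head _ _).
exists (r.1 *: dact y a + n'); rewrite big_cons rE [dprj _ _]linearD /= E dDD dDZ dD_dact -yE.
congr (_ + _); rewrite [LHS]linearZ /=; congr (_ *: _).
apply: dsum_eq => t; rewrite coef_dprj !coef_dact coef_dprj.
by case: ifP => // _; rewrite scale0r.
Qed.

Variables (P N Z : lmodType A) (c : {linear P -> N}) (i : {linear Z -> P}).
Hypotheses (c_surj : forall y, exists x, y = c x) (i_inj : injective i).
Hypotheses (ci : forall z, c (i z) = 0) (ci_exact : forall x, c x = 0 -> exists z, x = i z).
Hypothesis exactP : exact_coef P.

Lemma dmap_inj : injective (@dmap A T _ _ i).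
Proof.
move=> x y xy; apply: dsum_eq => t; apply: i_inj.
by rewrite -!coef_dmap xy.
Qed.

Lemma lift_cycle (B : pred T) (n : dsum T N) : d n = 0 -> dprj B n = n ->
  exists y z, [/\ n = dmap c y, dprj B y = y, d y = dmap i z & d z = 0].
Proof.
move=> dn Bn.
have [y E] : exists y, n = dmap c y by apply: dmap_lift => t; apply: c_surj.
have [z Ez] : exists z, d (dprj B y) = dmap i z.
  apply: dmap_lift => t; apply: ci_exact.
  by rewrite -coef_dmap dmap_dD dmap_dprj -E Bn dn coef0.
exists (dprj B y), z; split=> //.
- by rewrite dmap_dprj -E Bn.
- exact: dprj_idem.
- by apply: dmap_inj; rewrite dmap_dD -Ez dD_sq dmap0.
Qed.

Lemma boundary_descend (n : dsum T N) y z z' :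
  n = dmap c y -> d y = dmap i z -> z = d z' -> exists n', n = d n'.
Proof.
move=> -> dy zE; have /exact_coefP/(_ (y - dmap i z'))[|y' E] := exactP.
  by rewrite dDB dy -dmap_dD -zE subrr.
exists (dmap c y'); rewrite -dmap_dD -E dmapB.
suff -> : dmap c (dmap i z') = 0 by rewrite subr0.
by apply: dsum_eq => t; rewrite !coef_dmap ci coef0.
Qed.

Definition exact_at (B : pred T) (V : lmodType A) :=
  forall n : dsum T V, d n = 0 -> dprj B n = n -> exists n', n = d n'.

(** The connecting map sends the class of [n] to [tq q z] in Z (x) M. This dies in P (x) M because
    [dmap i z] is a boundary, so by injectivity it vanishes and [z] bounds. *)
Lemma exact_at_odd : (forall u : tens Z M, tensmap M i u = 0 -> u = 0) -> exact_at p N.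
Proof.
move=> iM n dn pn; have [y [z [nE py dy dz]]] := lift_cycle dn pn.
have zp : dprj (predC p) z = z.
  by apply: dmap_inj; rewrite dmap_dprj -dy -(dD_dprj Dp) py.
have /iM/tq_eq0[z' zE] : tensmap M i (tq q z) = 0 by rewrite tensmap_tq -dy tq_dD.
by apply: (boundary_descend nE dy (z' := z')); rewrite -zE zp.
Qed.

(** The connecting map reverses parity, trading the even half over [N] for the odd half over [Z]. *)
Lemma exact_at_even : exact_at p Z -> exact_at (predC p) N.
Proof.
move=> HZ n dn pn; have [y [z [nE py dy dz]]] := lift_cycle dn pn.
have zp : dprj p z = z.
  apply: dmap_inj; rewrite dmap_dprj -dy -py (dD_dprj (p := predC p)) /=.
    by apply: dsum_eq => t; rewrite !coef_dprj /=; case: (p t).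
  by move=> t s /Dp /= ->; rewrite negbK.
by have [z' zE] := HZ z dz zp; apply: boundary_descend nE dy zE.
Qed.

End TorsionExact.
End Exactness.

Section TorExact.
Variables (A : comPzRingType) (T : choiceType) (D : T -> F A T).
Variables (p : pred T) (M : lmodType A) (q : {linear F A T -> M}).
Hypothesis dd0 : forall t, dD D (D t) = 0.
Hypothesis Dp : forall t s, coef s (D t) != 0 -> p s = ~~ p t.
Hypothesis q_surj : forall m, exists x, m = q x.
Hypothesis q_ker : forall x, q x = 0 <-> exists y, dprj (predC p) x = dD D y.
Hypothesis exactA : exact_coef D A^o.

(** Tor_1 settles the odd half over [N]; Tor_2 settles the odd half over the first syzygy, and
    thereby the even half over [N]. *)
Lemma tor_zero_exact (N : lmodType A) :
  (forall i, (0 < i)%N -> zero_module (Tor i N M)) -> exact_coef D N.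
Proof.
move=> tor0.
have exR j : exact_coef D (resol N j) by apply: exact_coef_free.
have odd_exact j : exact_at D p (syz N j).
  apply: (exact_at_odd dd0 Dp q_surj q_ker (@syz_cover_surj _ N j) (@syz_incl_inj _ N j)
    (@syz_cover_incl _ N j) (@syz_exact _ N j) (exR _)).
  by apply: tor_zero_inj; apply: tor0.
have even_exact : exact_at D (predC p) N.
  apply: (exact_at_even dd0 Dp (@syz_cover_surj _ N 0) (@syz_incl_inj _ N 0)
    (@syz_cover_incl _ N 0) (@syz_exact _ N 0) (exR _)).
  exact: odd_exact.
apply/exact_coefP => n dn.
have [||n1 E1] := odd_exact 0%N (dprj p n).
- by rewrite (dD_dprj Dp) dn raddf0.
- exact: dprj_idem.
have [||n2 E2] := even_exact (dprj (predC p) n).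
- rewrite (dD_dprj (p := predC p)); first by rewrite dn raddf0.
  by move=> t s /Dp /= ->; rewrite negbK.
- exact: dprj_idem.
by exists (n1 + n2); rewrite dDD -E1 -E2 -dprjC_add.
Qed.
End TorExact.

(** * Freeness of the module of cycles *)

Section GoodSubcomplexes.
Variables (A : comPzRingType) (T : choiceType) (D : T -> F A T).
Local Notation F := (F A T).
Local Notation d := (dD D).
Local Notation e := (e A).
Implicit Types (B : T -> Prop) (U V : {fset T}) (x y z g : F).

Definition suppin B x := forall t, ~ B t -> coef t x = 0.
Local Notation suppU U := (suppin (fun t => t \in U)).

Lemma suppin0 B : suppin B 0. Proof. by move=> t _; rewrite coef0. Qed.

Lemma suppinD B x y : suppin B x -> suppin B y -> suppin B (x + y).
Proof. by move=> Bx By t Bt; rewrite coefD Bx // By // addr0. Qed.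

Lemma suppinZ B (a : A) x : suppin B x -> suppin B (a *: x).
Proof. by move=> Bx t Bt; rewrite coefZ Bx // scaler0. Qed.

Lemma suppinB B x y : suppin B x -> suppin B y -> suppin B (x - y).
Proof. by move=> Bx By; rewrite -scaleN1r; apply: suppinD => //; apply: suppinZ. Qed.

Lemma suppin_sum B (I : eqType) (r : seq I) (f : I -> F) :
  (forall i, i \in r -> suppin B (f i)) -> suppin B (\sum_(i <- r) f i).
Proof.
move=> Bf; rewrite big_seq; apply: (big_ind (suppin B)) => //.
  exact: suppin0.
by move=> x y; apply: suppinD.
Qed.

Lemma suppin_incl B B' x : (forall t, B t -> B' t) -> suppin B x -> suppin B' x.
Proof. by move=> BB' Bx t nB't; apply: Bx => /BB'. Qed.

Lemma suppin_supp x : suppU (supp x) x.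
Proof. by move=> t /negP/coef_supp. Qed.

Lemma suppin_dprj B (P : pred T) x : suppin B x -> suppin B (dprj P x).
Proof. by move=> Bx t /Bx; rewrite coef_dprj => ->; rewrite if_same. Qed.

Lemma linear_suppin B B' (f : {linear F -> F}) x : suppin B x ->
  (forall t, B t -> suppin B' (f (e t))) -> suppin B' (f x).
Proof.
move=> Bx Bf; rewrite (F_expand x) linear_sum; apply: suppin_sum => t tx.
rewrite linearZ; apply: suppinZ; apply: Bf; apply: contrapT => /Bx /eqP.
by apply/negP; rewrite -mem_supp.
Qed.

Definition dprjP B : {linear F -> F} := @dprj A T (fun t => `[< B t >]) A^o.

Lemma dprjP_id B x : suppin B x -> dprjP B x = x.
Proof. by move=> Bx; apply: dprj_id => t /negP nB; apply: Bx => Bt; apply: nB; apply/asboolP. Qed.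

Lemma dprjP_suppin B x : suppin B (dprjP B x).
Proof. by move=> t nB; rewrite coef_dprj; case: asboolP. Qed.

Definition dsupp U (f : {linear F -> F}) : {fset T} := (\bigcup_(u <- U) supp (f (e u)))%fset.

Lemma suppin_dsupp U f u : u \in U -> suppU (dsupp U f) (f (e u)).
Proof.
move=> uU; apply: suppin_incl (@suppin_supp _) => t tu.
by apply/bigfcupP; exists u; rewrite ?uU.
Qed.

Lemma linear_dsupp U (f : {linear F -> F}) x : suppU U x -> suppU (dsupp U f) (f x).
Proof. by move=> Ux; apply: linear_suppin Ux _ => t tU; apply: suppin_dsupp. Qed.

Definition restrict U B : {fset T} := [fset t in U | `[< B t >]]%fset.

Lemma suppin_restrict U B x : suppU U x -> suppin B x -> suppU (restrict U B) x.
Proof.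
move=> Ux Bx t; rewrite !inE => /negP; rewrite negb_and => /orP[/negP/Ux //|/asboolPn].
exact: Bx.
Qed.

(** A contraction, on cycles supported in [U], of the quotient by the part supported in [B]. *)
Definition contracts B U (s : {linear F -> F}) :=
  forall g, suppU U g -> suppin B (d g) -> suppin B (g - d (s g)).

(* A subcomplex on which the local contractions restrict. *)
Definition good B := (forall t, B t -> suppin B (D t)) /\
  forall U, (forall t, t \in U -> B t) -> exists s : {linear F -> F},
    (forall x, suppin B (s x)) /\ forall g, suppU U g -> d g = 0 -> d (s g) = g.

Hypothesis dd0 : forall t, d (D t) = 0.
Hypothesis contraction : forall U, exists s : {linear F -> F},
  forall g, (forall t, t \notin U -> coef t g = 0) -> d g = 0 -> d (s g) = g.

Lemma good_dD B x : good B -> suppin B x -> suppin B (d x).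
Proof.
move=> [Bd _] Bx; apply: (@linear_suppin B B (@dD A T D A^o)) => // t Bt.
by rewrite /= dD_e; apply: Bd.
Qed.

(** For a cycle [g] modulo [B], a contraction inside [B] gives [s1 (d g)] with the same boundary as
    [g]. The difference is an honest cycle; contracting it leaves exactly [s1 (d g)], which is
    supported in [B]. *)
Lemma good_contracts B U : good B -> exists s, contracts B U s.
Proof.
move=> gB; case: (gB) => Bd Bs.
pose dl : {linear F -> F} := @dD A T D A^o.
have [|s1 [Bs1 s1P]] := Bs (restrict (dsupp U dl) B).
  by move=> t; rewrite !inE => /andP[_ /asboolP].
have [s2 s2P] := contraction (U `|` dsupp (restrict (dsupp U dl) B) s1)%fset.
pose s : {linear F -> F} := s2 \o (idfun \- (s1 \o (dprjP B \o dl))).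
exists s => g Ug Bdg; rewrite /s /= dprjP_id //.
have Vdg : suppU (restrict (dsupp U dl) B) (d g).
  by apply: suppin_restrict => //; apply: (@linear_dsupp _ dl).
have ds1 : d (s1 (d g)) = d g by apply: s1P => //; apply: dD_sq.
rewrite s2P ?subKr //; last by rewrite dDB ds1 subrr.
move=> t; rewrite in_fsetU => /norP[/negP tU /negP tV].
by rewrite coefB Ug // (linear_dsupp Vdg) // subr0.
Qed.

(** A cycle with finite support splits into a part in [B] and a part in some [U_ i]. The latter is a
    cycle modulo [B], so [s_ i] moves the whole cycle into [B], which has contractions of its
    own. *)
Lemma good_union B (U_ : nat -> {fset T}) (s_ : nat -> {linear F -> F}) : good B ->
  (forall i t, t \in U_ i -> t \in U_ i.+1) ->
  (forall i t, t \in U_ i -> suppU (U_ i.+1) (D t)) ->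
  (forall i t, t \in U_ i -> suppU (U_ i.+1) (s_ i (e t))) ->
  (forall i, contracts B (U_ i) (s_ i)) ->
  good (fun t => B t \/ exists i, t \in U_ i).
Proof.
move=> gB U1 UD Us cs; set B' := fun t => _.
have BB' t : B t -> B' t by left.
have UB' i t : t \in U_ i -> B' t by right; exists i.
split=> [t [Bt|[i ti]]|U UU].
- by apply: suppin_incl BB' _; case: gB => + _; apply.
- exact: suppin_incl (@UB' i.+1) (UD i t ti).
have Um i j t : (i <= j)%N -> t \in U_ i -> t \in U_ j.
  elim: j => [|j IH]; first by rewrite leqn0 => /eqP->.
  by rewrite leq_eqVlt => /orP[/eqP->|/IH h /h /U1].
have [i Ui] : exists i, forall t, t \in U -> B t \/ t \in U_ i.
  have : forall t, exists i, t \in U -> B t \/ t \in U_ i.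
    move=> t; have [/UU[Bt|[i ti]]|] := boolP (t \in U).
    - by exists 0%N; left.
    - by exists i; right.
    - by exists 0%N.
  case/choice => h hP; exists (\max_(t <- U) h t) => t tU.
  have [|th] := hP t tU; [by left | right].
  by apply: Um th; apply: leq_bigmax_seq.
pose dl : {linear F -> F} := @dD A T D A^o.
pose U2 : T -> Prop := fun t => t \in U /\ t \in U_ i.
pose V := restrict (U `|` dsupp (restrict U (fun t => t \in U_ i)) (dl \o s_ i))%fset B.
case: (gB) => Bd Bs.
have [|sV [BsV sVP]] := Bs V; first by move=> t; rewrite !inE => /andP[_ /asboolP].
pose sg := s_ i \o dprjP U2.
pose s : {linear F -> F} := sg \+ (sV \o (idfun \- (dl \o sg))).
exists s; split=> [x|g Ug dg].
  rewrite /s /=; apply: suppinD; last exact: suppin_incl BB' (BsV _).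
  apply: suppin_incl (@UB' i.+1) _; apply: linear_suppin (dprjP_suppin _) _.
  by move=> t [_ /Us].
rewrite /s /= dDD.
set g2 := dprjP U2 g; have U2g2 : suppin U2 g2 by apply: dprjP_suppin.
have Bg1 : suppin B (g - g2).
  move=> t nBt; rewrite coefB coef_dprj; case: asboolP => [_|nU2]; first by rewrite subrr.
  have [tU|/negP tU] := boolP (t \in U); last by rewrite Ug // subrr.
  by case: (Ui t tU) => // ti; case: nU2.
have Bdg2 : suppin B (d g2).
  have -> : d g2 = 0 - d (g - g2) by rewrite dDB dg opprB addrC subrK.
  by apply: suppinB; [apply: suppin0 | apply: good_dD].
have Br : suppin B (g2 - d (s_ i g2)).
  by apply: cs => //; apply: suppin_incl U2g2 => t [].
have Bg : suppin B (g - d (s_ i g2)).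
  by rewrite -(subrK g2 g) -addrA; apply: suppinD.
suff E : d (sV (g - d (s_ i g2))) = g - d (s_ i g2) by rewrite E addrC subrK.
apply: sVP; last by rewrite dDB dg dD_sq // subr0.
apply: suppin_restrict => //; apply: suppinB.
  by apply: suppin_incl Ug => t tU; rewrite in_fsetU tU.
apply: suppin_incl (linear_dsupp (f := dl \o s_ i) (U := restrict U (fun t => t \in U_ i)) _).
  by move=> t tU; rewrite in_fsetU tU orbT.
by apply: suppin_incl U2g2 => t [tU ti]; rewrite !inE tU /=; apply/asboolP.
Qed.

End GoodSubcomplexes.

(** * Kaplansky's argument over a local ring *)

Section LocalMatrix.
Variables (A : comPzRingType) (mx : A -> Prop).
Hypotheses (mxI : idealP mx) (mx1 : ~ mx 1) (mxu : forall a, ~ mx a -> exists b, b * a = 1).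

Lemma unit_modulo_local a : mx (a - 1) -> exists b, b * a = 1.
Proof.
move=> ma; apply: mxu => a_mx; apply: mx1.
by rewrite -(subKr a 1); apply: idealB => //; rewrite -opprB; apply: idealN.
Qed.

(** The determinant is 1 modulo [mx], hence a unit, and the adjugate gives the inverse. *)
Lemma matrix_inverse_local r (C : 'M[A]_r) :
  (forall i j, mx (C i j - (i == j)%:R)) -> exists E : 'M[A]_r, C *m E = 1%:M.
Proof.
move=> Cmx; pose I := mkideal mxI.
have qI x y : mx (x - y) -> qring I x = qring I y.
  by move=> xy; apply/qring_eqP/mem_mkideal.
have [b bE] : exists b, b * \det C = 1.
  apply: unit_modulo_local; apply/(mem_mkideal mxI)/qring_eqP.
  rewrite -det_map_mx rmorph1 -(det1 _ r); congr (\det _).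
  apply/matrixP => i j; rewrite !mxE /= (qI _ _ (Cmx i j)).
  by case: (i == j); rewrite ?rmorph1 ?rmorph0.
exists (b *: \adj C); rewrite -scalemxAr mul_mx_adj.
by rewrite scale_scalar_mx bE.
Qed.
End LocalMatrix.

Lemma mem_spanZ (A : pzRingType) (V : lmodType A) (E : set V) (a : A) b :
  E b -> a *: b \in span E.
Proof.
move=> Eb; apply/asboolP; exists [:: (a, b)]; last by rewrite big_seq1.
by move=> r; rewrite inE => /eqP->.
Qed.

Section Kaplansky.
Variables (A : comPzRingType) (T : choiceType) (D : T -> F A T) (p : pred T).
Variable mx : A -> Prop.
Local Notation F := (F A T).
Local Notation d := (dD D).
Local Notation e := (e A).
Implicit Types (B : T -> Prop) (U V : {fset T}) (x y z g : F) (Y X : seq F).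

Hypothesis dd0 : forall t, d (D t) = 0.
Hypothesis Dp : forall t s, coef s (D t) != 0 -> p s = ~~ p t.
Hypothesis contraction : forall U, exists s : {linear F -> F},
  forall g, (forall t, t \notin U -> coef t g = 0) -> d g = 0 -> d (s g) = g.
Hypotheses (mxI : idealP mx) (mx1 : ~ mx 1) (mxu : forall a, ~ mx a -> exists b, b * a = 1).

Definition killing B (l : {linear F -> A^o}) := forall x, suppin B x -> l x = 0.

Definition coordinates_in B x r (a : 'I_r -> A) :=
  forall t, ~ B t -> exists c : 'I_r -> A, coef t x = \sum_i c i * a i.

(** These forms are the raw material for the dual family of the new cycles. *)
Definition values_at B x r (a : 'I_r -> A) :=
  forall i, exists2 l, killing B l & l x = a i.

(* A minimal generating family of the ideal generated by the coordinates of x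
   outside B. *)
Lemma minimal_coordinates B x : exists r (a : 'I_r -> A),
  [/\ coordinates_in B x a, values_at B x a &
      forall c : 'I_r -> A, \sum_i c i * a i = 0 -> forall i, mx (c i)].
Proof.
pose Q r := `[< exists a : 'I_r -> A, coordinates_in B x a /\ values_at B x a >].
have exQ : exists r, Q r.
  pose l := restrict (supp x) (fun t => ~ B t); pose lt := in_tuple l.
  exists (size l); apply/asboolP; exists (fun i => coef (tnth lt i) x); split.
    move=> t nBt; have [tl|tl] := boolP (t \in l).
      have /tnthP[i ->] : t \in lt by [].
      exists (fun j => (j == i)%:R); rewrite (bigD1 i) //= eqxx mul1r big1 ?addr0 //.
      by move=> j /negPf->; rewrite mul0r.
    exists (fun=> 0); rewrite big1 => [|i _]; last by rewrite mul0r.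
    apply: coef_supp; apply: contra tl => tx; rewrite !inE tx /=; exact/asboolP.
  move=> i; exists (coef (tnth lt i)) => // y By; apply: By.
  by have := mem_tnth i lt; rewrite !inE => /andP[_ /asboolP].
case: (ex_minnP exQ) => r /asboolP[a [ac av]] rmin; exists r, a; split=> // c ca i.
(* A unit coefficient would express [a i] through the other generators, against the minimality of
   [r]. *)
apply: contrapT => /mxu[b bc].
case: r a ac av rmin c ca i bc => [|r] a ac av rmin c ca i bc; first by case: i bc.
have aiE : a i = \sum_j (- (b * c (lift i j))) * a (lift i j).
  move: ca; rewrite (bigD1_ord i) //= => /(congr1 ( *%R b)).
  rewrite mulrDr mulrA bc mul1r mulr0 => /eqP; rewrite addr_eq0 => /eqP->.
  rewrite mulr_sumr -sumrN; apply: eq_bigr => j _.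
  by rewrite mulNr mulrA.
suff /rmin : Q r by rewrite ltnn.
apply/asboolP; exists (fun j => a (lift i j)); split=> [t nBt|j]; last exact: av.
have [c' c'E] := ac t nBt.
exists (fun j => c' (lift i j) - c' i * (b * c (lift i j))).
rewrite c'E (bigD1_ord i) //= {1}aiE mulr_sumr -big_split /=.
by apply: eq_bigr => j _; ring.
Qed.

(* Y is dual to a family of forms killing B; in particular Y is linearly
   independent modulo the elements supported in B. *)
Definition dual B Y := forall b, b \in Y -> exists l : {linear F -> A^o},
  [/\ killing B l, l b = 1 & forall b', b' \in Y -> b' <> b -> l b' = 0].

Lemma dual_sub B X Y : {subset X <= Y} -> dual B Y -> dual B X.
Proof.
move=> XY Yd b /XY /Yd[l [lB lb lY]]; exists l; split=> // b' /XY; exact: lY.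
Qed.

Definition cycle x := d x = 0 /\ dprj p x = x.

Lemma cycle0 : cycle 0. Proof. by rewrite /cycle dD0 raddf0. Qed.

Lemma cycleD x y : cycle x -> cycle y -> cycle (x + y).
Proof.
case=> dx px [dy py]; split; first by rewrite dDD dx dy addr0.
by rewrite raddfD /= px py.
Qed.

Lemma cycleZ (a : A) x : cycle x -> cycle (a *: x).
Proof.
case=> dx px; split; first by rewrite dDZ dx scaler0.
by rewrite linearZ /= px.
Qed.

Lemma cycleB x y : cycle x -> cycle y -> cycle (x - y).
Proof. by move=> cx cy; rewrite -scaleN1r; apply: cycleD => //; apply: cycleZ. Qed.

Lemma cycle_sum (I : eqType) (r : seq I) (f : I -> F) :
  (forall i, i \in r -> cycle (f i)) -> cycle (\sum_(i <- r) f i).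
Proof.
move=> cf; rewrite big_seq; apply: (big_ind cycle) => //; first exact: cycle0.
exact: cycleD.
Qed.

Lemma cycle_boundary x : cycle (dprj p (d x)).
Proof.
split; last exact: dprj_idem.
by rewrite (dD_dprj Dp) dD_sq // raddf0.
Qed.

Definition spans B Y x := exists2 y, y \in span (fun b => b \in Y : Prop) & suppin B (x - y).

Lemma spans_sub B X Y x : {subset X <= Y} -> spans B X x -> spans B Y x.
Proof.
move=> XY [y /asboolP[s sX E] xy]; exists y => //; apply/asboolP; exists s => //.
by move=> r /sX /XY.
Qed.

(* Kaplansky's argument: after projecting x away from Y, write it as a combination
   of the u i with coefficients a i minimally generating its coordinate ideal. The
   local contraction h fixes x, so x is also a combination of the cycles v i, and
   minimality forces the matrix of the v i to be the identity modulo mx. *)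
Lemma extend_dual B Y x : good D B -> dual B Y -> (forall b, b \in Y -> cycle b) ->
  cycle x -> exists Y', [/\ {subset Y <= Y'}, dual B Y',
    (forall b, b \in Y' -> cycle b) & spans B Y' x].
Proof.
move=> gB Yd Yc cx.
have /choice[lam lamP] : forall b, exists l : {linear F -> A^o}, b \in Y ->
    [/\ killing B l, l b = 1 & forall b', b' \in Y -> b' <> b -> l b' = 0].
  move=> b; have [/Yd[l lP]|nb] := boolP (b \in Y); first by exists l.
  by exists \0.
have lamB b z : b \in Y -> suppin B z -> lam b z = 0 by case/lamP => + _ _; apply.
(* [S] is the projection onto the span of [Y] that kills [B]; without [undup] a repeated element
   would count twice. *)
pose Y0 := undup Y; have Y0Y b : b \in Y0 -> b \in Y by rewrite mem_undup.
pose S z := \sum_(b <- Y0) (lam b z : A) *: b.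
pose P z := z - S z.
have lamS b z : b \in Y -> lam b (S z) = lam b z.
  move=> bY; rewrite /S linear_sum /= (big_rem b) ?mem_undup //= linearZ /=.
  case: (lamP b bY) => _ lb lY; rewrite lb /GRing.scale /= mulr1 big_seq big1 ?addr0 //.
  move=> b'; rewrite mem_rem_uniq ?undup_uniq // inE => /andP[b'b /Y0Y b'Y].
  by rewrite linearZ /= (lY b' b'Y (elimN eqP b'b)) /GRing.scale /= mulr0.
have lamP0 b z : b \in Y -> lam b (P z) = 0.
  by move=> bY; rewrite /P linearB /= lamS // subrr.
have Sl : linear S.
  move=> a y z; rewrite /S scaler_sumr -big_split; apply: eq_bigr => b _ /=.
  by rewrite linearP /= scalerDl scalerA.
pose SL : {linear F -> F} := HB.pack S (GRing.isLinear.Build A _ _ _ S Sl).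
pose PL : {linear F -> F} := idfun \- SL.
have SB z : suppin B z -> S z = 0.
  by move=> Bz; rewrite /S big_seq big1 // => b /Y0Y bY; rewrite lamB // scale0r.
have PB z : suppin B z -> P z = z by move=> Bz; rewrite /P SB // subr0.
have PP z : (forall b, b \in Y -> lam b z = 0) -> P z = z.
  move=> lz; rewrite /P /S big_seq big1 ?subr0 // => b /Y0Y bY.
  by rewrite lz // scale0r.
have PY b : b \in Y -> P b = 0.
  move=> bY; rewrite /P /S (big_rem b) ?mem_undup //=.
  case: (lamP b bY) => _ lb _; rewrite lb scale1r big_seq big1 ?addr0 ?subrr //.
  move=> b'; rewrite mem_rem_uniq ?undup_uniq // inE => /andP[/eqP b'b /Y0Y b'Y].
  case: (lamP b' b'Y) => _ _ -> //; first by rewrite scale0r.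
  by move=> bb'; apply: b'b.
have Sc z : cycle (S z).
  by apply: cycle_sum => b /Y0Y /Yc; apply: cycleZ.
have Pc z : cycle z -> cycle (P z) by move=> cz; apply: cycleB.
pose x' := P x; have cx' : cycle x' by apply: Pc.
have [r [a [ac av amin]]] := minimal_coordinates B x'.
have /choice[c cE] : forall t, exists c : 'I_r -> A,
    ~ B t -> coef t x' = \sum_i c i * a i.
  move=> t; have [nB|nnB] := EM (~ B t); first by have [c cE] := ac t nB; exists c.
  by exists (fun=> 0).
have /choice[mu muP] : forall i, exists l : {linear F -> A^o}, killing B l /\ l x' = a i.
  by move=> i; have [l lB lx] := av i; exists l.
(* Cutting down to the support of x' outside [B] keeps [u i] finitely supported and still leaves the
   remainder [w] inside [B]. *)
pose cu i t : A^o := if (t \in supp x') && ~~ `[< B t >] then c t i else 0.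
pose u i : F := mkdsum (cu i).
have coef_u t i : coef t (u i) = cu i t.
  by rewrite (coef_mk _ (B := supp x')) // => s /negPf; rewrite /cu => ->.
pose w := x' - \sum_i a i *: u i.
have Bw : suppin B w.
  move=> t nBt; rewrite coefB linear_sum /=.
  have [tx|tx] := boolP (t \in supp x').
    apply/eqP; rewrite subr_eq0; apply/eqP; rewrite cE //; apply: eq_bigr => i _.
    by rewrite coefZ coef_u /cu tx /=; case: asboolP => // _; rewrite mulrC.
  rewrite coef_supp // sub0r big1 ?oppr0 // => i _.
  by rewrite coefZ coef_u /cu (negPf tx) scaler0.
(* The support of [w] is included so that [h w] stays supported in [B]. *)
have [s sP] := good_contracts dd0 contraction (supp x' `|` supp w)%fset gB.
pose h z := dprj p (d (s z)).
pose hL : {linear F -> F} := @dprj A T p A^o \o (@dD A T D A^o \o s).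
have hx' : suppin B (x' - h x').
  case: (cx') => dx' px'; have -> : x' - h x' = dprj p (x' - d (s x')) by rewrite raddfB /= px'.
  apply: suppin_dprj; apply: sP; last by rewrite dx'; apply: suppin0.
  by apply: suppin_incl (@suppin_supp _ _ _) => t tx; rewrite in_fsetU tx.
have hw : suppin B (h w).
  apply: suppin_dprj; rewrite -(subKr w (d (s w))); apply: suppinB => //.
  apply: sP; last exact: good_dD.
  by apply: suppin_incl (@suppin_supp _ _ _) => t tx; rewrite in_fsetU tx orbT.
(* The second projection makes the forms dual to [Y] vanish on the new cycles. *)
pose v i := P (h (u i)).
have vc i : cycle (v i) by apply: Pc; apply: cycle_boundary.
have lamv b i : b \in Y -> lam b (v i) = 0 by apply: lamP0.
have Pv i : P (v i) = v i by apply: PP => b; apply: lamv.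
have Px' : P x' = x' by apply: PP => b; apply: lamP0.
have x'v : suppin B (x' - \sum_i a i *: v i).
  have E : \sum_i a i *: v i = P (h x') - P (h w).
    pose PhL : {linear F -> F} := PL \o hL.
    rewrite -[LHS]/(\sum_i a i *: PhL (u i)) -[RHS]/(PhL x' - PhL w) -linearB /w subKr.
    by rewrite linear_sum; apply: eq_bigr => i _; rewrite linearZ.
  have -> : x' - \sum_i a i *: v i = P (x' - h x') + P (h w).
    have PB' : P (x' - h x') = P x' - P (h x') by apply: (linearB PL).
    by rewrite E PB' Px' opprB addrCA addrC.
  by rewrite !PB //; apply: suppinD.
pose C := \matrix_(i, j) (mu j (v i) : A).
have [E CE] : exists E : 'M_r, C *m E = 1%:M.
  (* Applying [mu j] to x' = sum of the a i *: v i modulo [B] yields a relation among the minimal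
     generators whose coefficients form column j of C - 1. *)
  apply: (matrix_inverse_local mxI mx1 mxu) => i j.
  apply: (amin (fun i => C i j - (i == j)%:R)).
  have E : a j = \sum_k a k * mu j (v k).
    case: (muP j) => muB <-.
    have := muB _ x'v; rewrite linearB linear_sum /= => /eqP; rewrite subr_eq0 => /eqP->.
    by apply: eq_bigr => k _; rewrite linearZ.
  rewrite (eq_bigr (fun k => a k * mu j (v k) - (k == j)%:R * a k)); last first.
    by move=> k _; rewrite mxE mulrBl mulrC.
  rewrite sumrB -E (bigD1 j) //= eqxx mul1r big1 ?addr0 ?subrr // => k /negPf->.
  by rewrite mul0r.
(* The inverse matrix turns the [mu j] into forms dual to the [v i]; composing with [P] makes them
   vanish on [Y]. *)
pose nu k z : A^o := \sum_j (E j k : A) *: (mu j (P z) : A^o).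
have nul k : linear (nu k).
  move=> b y z; rewrite /nu scaler_sumr -big_split; apply: eq_bigr => j _ /=.
  have -> : mu j (P (b *: y + z)) = b *: mu j (P y) + mu j (P z).
    exact: (linearP (mu j \o PL)).
  by rewrite scalerDr !scalerA mulrC.
pose nuL k : {linear F -> A^o} := HB.pack (nu k) (GRing.isLinear.Build A _ _ _ (nu k) (nul k)).
have nuv k i : nu k (v i) = (i == k)%:R.
  have := congr1 (fun X : 'M_r => X i k) CE; rewrite !mxE => <-.
  by apply: eq_bigr => j _; rewrite mxE Pv mulrC.
exists (Y ++ [seq v i | i : 'I_r]); split.
- by move=> b bY; rewrite mem_cat bY.
- move=> b; rewrite mem_cat => /orP[bY|/mapP[k _ ->]].
    case: (lamP b bY) => lB lb lY; exists (lam b); split=> // b'.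
    by rewrite mem_cat => /orP[/lY //|/mapP[i _ ->] _]; apply: lamv.
  exists (nuL k); split=> [z Bz||b'].
  + rewrite /= /nu PB // big1 // => j _; case: (muP j) => muB _.
    by rewrite muB // scaler0.
  + by rewrite /= nuv eqxx.
  + rewrite mem_cat => /orP[b'Y _|/mapP[i _ ->] ik].
      by rewrite /= /nu PY // big1 // => j _; rewrite linear0 scaler0.
    by rewrite /= nuv; case: eqVneq ik => // -> [].
- by move=> b; rewrite mem_cat => /orP[/Yc //|/mapP[k _ ->]].
- exists (S x + \sum_i a i *: v i).
    apply: rpredD.
      rewrite /S big_seq; apply: rpred_sum => b /Y0Y bY.
      by apply: mem_spanZ; rewrite mem_cat bY.
    apply: rpred_sum => i _.
    by apply: mem_spanZ; rewrite mem_cat map_f ?orbT ?mem_enum.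
  by rewrite opprD addrA.
Qed.

Lemma extend_dual_seq B Y X : good D B -> dual B Y -> (forall b, b \in Y -> cycle b) ->
  (forall x, x \in X -> cycle x) -> exists Y', [/\ {subset Y <= Y'}, dual B Y',
    (forall b, b \in Y' -> cycle b) & forall x, x \in X -> spans B Y' x].
Proof.
move=> gB; elim: X Y => [|x X IH] Y Yd Yc Xc; first by exists Y; split.
have [|Y1 [YY1 Y1d Y1c Y1x]] := extend_dual gB Yd Yc (x := x).
  by apply: Xc; rewrite mem_head.
have [|Y' [Y1Y' Y'd Y'c Y'X]] := IH Y1 Y1d Y1c.
  by move=> y yX; apply: Xc; rewrite inE yX orbT.
exists Y'; split=> //; first by move=> b /YY1 /Y1Y'.
by move=> y; rewrite inE => /orP[/eqP->|/Y'X //]; apply: spans_sub Y1x.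
Qed.

End Kaplansky.

(** * Countable extensions and Zorn's lemma *)

Section SpanFacts.
Local Open Scope classical_set_scope.

Lemma span_incl (A : pzRingType) (V : lmodType A) (E E' : set V) x :
  (forall y, E y -> E' y) -> x \in span E -> x \in span E'.
Proof.
by move=> EE' /asboolP[s sE ->]; apply/asboolP; exists s => // r /sE /EE'.
Qed.

Lemma chain_finite (S : eqType) (C : set (set S)) (W0 : set S) (X : seq S) :
  C W0 -> total_on C subset -> (forall x, x \in X -> exists2 W, C W & W x) ->
  exists2 W, C W & forall x, x \in X -> W x.
Proof.
move=> CW0 Ctot; elim: X => [|x X IH] XC; first by exists W0.
have [|W CW WX] := IH; first by move=> y yX; apply: XC; rewrite inE yX orbT.
have [W' CW' W'x] := XC x (mem_head _ _).
have [sub|sub] := Ctot W W' CW CW'.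
  by exists W' => // y; rewrite inE => /orP[/eqP->|/WX /sub].
by exists W => // y; rewrite inE => /orP[/eqP->|/WX //]; apply: sub.
Qed.
End SpanFacts.

Section FreeCokernel.
Local Open Scope classical_set_scope.
Variables (A : comPzRingType) (T : choiceType) (D : T -> F A T) (p : pred T).
Variable mx : A -> Prop.
Local Notation F := (F A T).
Local Notation d := (dD D).
Local Notation e := (e A).
Local Notation cycle := (cycle D p).

Hypothesis dd0 : forall t, d (D t) = 0.
Hypothesis Dp : forall t s, coef s (D t) != 0 -> p s = ~~ p t.
Hypothesis contraction : forall U : {fset T}, exists s : {linear F -> F},
  forall g, (forall t, t \notin U -> coef t g = 0) -> d g = 0 -> d (s g) = g.
Hypotheses (mxI : idealP mx) (mx1 : ~ mx 1) (mxu : forall a, ~ mx a -> exists b, b * a = 1).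

(** One step of a countable closure: the conditions on U' feed [good_union], and those on Y' make
    the union of all stages span the new cycles modulo [B]. *)
Definition stage_step (B : set T) (U : {fset T}) (Y : seq F)
    (U' : {fset T}) (Y' : seq F) (s : {linear F -> F}) :=
  [/\ {subset U <= U'} /\ {subset Y <= Y'},
      forall t, t \in U -> suppin (fun t => t \in U') (D t) /\ suppin (fun t => t \in U') (s (e t)),
      forall t, t \in U -> spans B Y' (dprj p (d (e t))),
      forall b, b \in Y' -> suppin (fun t => t \in U') b & contracts D B U s].

Lemma stage_step_exists B U Y : good D B -> dual B Y -> (forall b, b \in Y -> cycle b) ->
  exists U' Y' s, [/\ stage_step B U Y U' Y' s, dual B Y' & forall b, b \in Y' -> cycle b].
Proof.
move=> gB Yd Yc; have [s sP] := good_contracts dd0 contraction U gB.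
have [|Y' [YY' Y'd Y'c Y's]] := extend_dual_seq dd0 Dp contraction mxI mx1 mxu
    (X := [seq dprj p (d (e t)) | t <- U]) gB Yd Yc.
  by move=> x /mapP[t _ ->]; apply: cycle_boundary.
pose dl : {linear F -> F} := @dD A T D A^o.
pose U' := (U `|` dsupp U dl `|` dsupp U s `|` \bigcup_(b <- Y') supp b)%fset.
exists U', Y', s; split=> //; split=> //.
- by split=> // t tU; rewrite !in_fsetU tU.
- move=> t tU; split.
    rewrite -(dD_e D t) -[dD D (e t)]/(dl (e t)).
    apply: suppin_incl (suppin_dsupp (f := dl) tU) => r.
    by rewrite !in_fsetU => ->; rewrite orbT.
  by apply: suppin_incl (suppin_dsupp (f := s) tU) => r; rewrite !in_fsetU => ->; rewrite orbT.
- by move=> t tU; apply: Y's; apply/mapP; exists t.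
- move=> b bY; apply: suppin_incl (@suppin_supp _ _ b) => t tb.
  by rewrite in_fsetU; apply/orP; right; apply/bigfcupP; exists b; rewrite ?bY.
Qed.

(** The limit of stages started at t0. Countably many suffice, since a finite set of new coordinates
    or cycles lies in one stage and the next stage closes it up. *)
Lemma good_extension B t0 : good D B -> exists (B' : set T) (C : set F),
  [/\ good D B', B `<=` B' /\ B' t0, forall b, C b -> cycle b /\ suppin B' b,
      forall X : seq F, (forall b, b \in X -> C b) -> dual B X &
      forall x, cycle x -> suppin B' x -> exists2 y, y \in span C & suppin B (x - y)].
Proof.
move=> gB.
pose state := {st : {fset T} * seq F | dual B st.2 /\ forall b, b \in st.2 -> cycle b}.
have /choice[nx nxP] : forall st : state, exists r : state * {linear F -> F},
    stage_step B (sval st).1 (sval st).2 (sval r.1).1 (sval r.1).2 r.2.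
  case=> -[U Y] [/= Yd Yc]; have [U' [Y' [s [h h1 h2]]]] := stage_step_exists U gB Yd Yc.
  by exists (exist _ (U', Y') (conj h1 h2), s).
have st0P : dual B ([fset t0]%fset, [::] : seq F).2 /\
    forall b, b \in ([fset t0]%fset, [::] : seq F).2 -> cycle b by split=> b.
pose st i : state := iter i (fun x => (nx x).1) (exist _ _ st0P).
pose U_ i := (sval (st i)).1; pose Y_ i := (sval (st i)).2; pose s_ i := (nx (st i)).2.
have stP i : stage_step B (U_ i) (Y_ i) (U_ i.+1) (Y_ i.+1) (s_ i) by apply: nxP.
have Um i t : t \in U_ i -> t \in U_ i.+1 by case: (stP i) => -[+ _] _ _ _ _; apply.
have Ym i j b : (i <= j)%N -> b \in Y_ i -> b \in Y_ j.
  elim: j => [|j IH]; first by rewrite leqn0 => /eqP->.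
  rewrite leq_eqVlt => /orP[/eqP->//|/IH h /h].
  by case: (stP j) => -[_ +] _ _ _ _; apply.
pose B' t := B t \/ exists i, t \in U_ i.
pose C b := exists i, b \in Y_ i.
have UB' i t : t \in U_ i -> B' t by right; exists i.
have gB' : good D B'.
  apply: (good_union dd0 (s_ := s_)) => //.
  - by move=> i t tU; case: (stP i) => _ /(_ t tU)[].
  - by move=> i t tU; case: (stP i) => _ /(_ t tU)[].
  - by move=> i; case: (stP i).
exists B', C; split=> //.
- by split; [left | right; exists 0%N; rewrite /U_ /= inE].
- move=> b [i bY]; split; first by case: (svalP (st i)) => _; apply.
  apply: (suppin_incl (@UB' i.+1)); case: (stP i) => -[_ YY] _ _ + _; apply.
  exact: YY.
- move=> X XC; have [i Xi] : exists i, forall b, b \in X -> b \in Y_ i.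
    have /choice[h hP] : forall b, exists i, b \in X -> b \in Y_ i.
      move=> b; have [/XC[i bi]|_] := boolP (b \in X); first by exists i.
      by exists 0%N.
    exists (\max_(b <- X) h b) => b bX; apply: Ym (hP b bX).
    exact: leq_bigmax_seq.
  by apply: (dual_sub Xi); case: (svalP (st i)).
- move=> x [dx px] B'x; pose Sp z := exists2 y, y \in span C & suppin B (z - y).
  have Sp0 : Sp 0 by exists 0; rewrite ?rpred0 ?subr0; last exact: suppin0.
  have SpD y z : Sp y -> Sp z -> Sp (y + z).
    move=> [y' Cy' By'] [z' Cz' Bz']; exists (y' + z'); first exact: rpredD.
    by rewrite opprD addrACA; apply: suppinD.
  have SpZ (a : A) y : Sp y -> Sp (a *: y).
    move=> [y' Cy' By']; exists (a *: y'); first exact: rpredZ.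
    by rewrite -scalerBr; apply: suppinZ.
  case: (gB') => _ /(_ (supp x))[t|s' [Bs' s'P]].
    by rewrite mem_supp => xt; apply: contrapT => /B'x /eqP; apply/negP.
  (* Goodness makes [x] the boundary of an element supported in B', hence a combination of the
     p-parts of boundaries of [e t] with [B' t]. Each of these is either supported in [B] or spanned
     by the next stage. *)
  rewrite -px -[x]s'P //; last exact: suppin_supp.
  pose f : {linear F -> F} := @dprj A T p A^o \o @dD A T D A^o.
  rewrite -[dprj p (d _)]/(f (s' x)) (F_expand (s' x)) linear_sum big_seq.
  apply: (big_ind Sp) => // t ts; rewrite linearZ; apply: SpZ.
  have [Bt|[i ti]] : B' t.
    by apply: contrapT => /(Bs' x) /eqP; apply/negP; rewrite -mem_supp.
    exists 0; rewrite ?rpred0 // subr0; apply: suppin_dprj; rewrite /= dD_e.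
    by case: gB => + _; apply.
  case: (stP i) => _ _ /(_ t ti)[y Yy By] _ _; exists y => //.
  by apply: span_incl Yy => b; exists i.+1.
Qed.

Definition independent (E : set F) := forall (X : seq F) (c : F -> A), uniq X ->
  (forall b, b \in X -> E b) -> \sum_(b <- X) c b *: b = 0 -> forall b, b \in X -> c b = 0.

(** A subset of [T] and a set of cycles are coded as one subset of a disjoint union, so that Zorn's
    lemma for inclusion applies to the pair. *)
Definition partial_basis (W : set (T + F)) :=
  let B t := W (inl t) in let E b := W (inr b) in
  [/\ good D B, forall b, E b -> cycle b /\ suppin B b,
      forall x, cycle x -> suppin B x -> x \in span E & independent E].

Lemma partial_basis0 : partial_basis set0.
Proof.
split=> //.
- split=> // U UB; exists \0; split=> [x|g Ug _]; first exact: suppin0.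
  rewrite /= dD0; apply: dsum_eq => t; rewrite coef0 Ug //.
  by move=> /UB.
- move=> x _ Bx; have -> : x = 0 by apply: dsum_eq => t; rewrite coef0 Bx.
  exact: rpred0.
- by move=> X c _ XE _ b /XE.
Qed.

(** Each clause concerns finitely many coordinates or basis elements at a time, so it is inherited
    from a single member of the chain. *)
Lemma partial_basis_union (C : set (set (T + F))) :
  (forall W, C W -> partial_basis W) -> total_on C subset ->
  partial_basis (\bigcup_(W in C) W).
Proof.
move=> CP Ctot; have [[W0 CW0]|C0] := EM (exists W, C W); last first.
  rewrite bigcup0; first exact: partial_basis0.
  by move=> W CW; case: C0; exists W.
have sub W : C W -> W `<=` \bigcup_(W in C) W by move=> CW x Wx; exists W.
split.
- split=> [t [W CW Wt]|U UB].
    case: (CP W CW) => -[+ _] _ _ _ => /(_ t Wt); apply: suppin_incl => r.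
    exact: sub.
  have [|W CW UW] := chain_finite CW0 Ctot (X := [seq inl t | t <- U]).
    by move=> _ /mapP[t tU ->]; case: (UB t tU) => W; exists W.
  case: (CP W CW) => gW _ _ _; case: gW => _ /(_ U)[|s [Bs sP]].
    by move=> t tU; apply: UW; apply: map_f.
  exists s; split=> // x; apply: suppin_incl (Bs x) => t; exact: sub.
- move=> b [W CW Wb]; case: (CP W CW) => _ /(_ b Wb)[cb Bb] _ _; split=> //.
  by apply: suppin_incl Bb => t; apply: sub.
- move=> x cx Bx.
  have [|W CW xW] := chain_finite CW0 Ctot (X := [seq inl t | t <- supp x]).
    move=> _ /mapP[t tx ->]; apply: contrapT => nW.
    have /Bx /eqP : ~ (\bigcup_(W in C) W) (inl t) by move=> [W CW Wt]; apply: nW; exists W.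
    by apply/negP; rewrite -mem_supp.
  case: (CP W CW) => _ _ sW _.
  apply: (span_incl (E := fun b => W (inr b))); first by move=> b; apply: sub.
  apply: sW => // t nWt.
  by apply/eqP; apply: contra_notT nWt => xt; apply: xW; apply: map_f; rewrite mem_supp.
- move=> X c uX XE.
  have [|W CW XW] := chain_finite CW0 Ctot (X := [seq inr b | b <- X]).
    by move=> _ /mapP[b bX ->]; case: (XE b bX) => W; exists W.
  case: (CP W CW) => _ _ _ ind; apply: ind => // b bX.
  by apply: XW; apply: map_f.
Qed.

Lemma cycle_basis : exists E : set F,
  [/\ forall b, E b -> cycle b, forall x, cycle x -> x \in span E & independent E].
Proof.
have [W [[gB cE sE iE] Wmax]] := Zorn_bigcup partial_basis_union.
pose B : set T := fun t => W (inl t); pose E : set F := fun b => W (inr b).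
have BT t0 : B t0.
  apply: contrapT => nB.
  have [B' [C [gB' [BB' B't0] CP Cd Cs]]] := good_extension t0 gB.
  pose W' : set (T + F) := fun r => match r with inl t => B' t | inr b => E b \/ C b end.
  apply: (Wmax W').
    split; last by move=> /(_ (inl t0) B't0).
    by case=> [t /BB'|b Eb] //; left.
  split=> //=.
  - move=> b [Eb|/CP //]; case: (cE b Eb) => cb Bb; split=> //.
    exact: suppin_incl BB' Bb.
  - move=> x cx B'x; have [y Cy Bxy] := Cs x cx B'x.
    have cy : cycle y.
      case/asboolP: Cy => s sC ->; apply: cycle_sum => r /sC /CP[cr _].
      exact: cycleZ.
    rewrite -(subrK y x); apply: rpredD; last by apply: span_incl Cy; right.
    by apply: (span_incl (E := E)); [left | apply: sE => //; apply: cycleB].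
  - move=> X c uX XE X0.
    (* The dual forms kill all that is supported in [B], in particular [E], and so isolate the
       coefficients of the new elements. *)
    have cC b : b \in X -> C b -> c b = 0.
      move=> bX Cb.
      have CdX : dual B [seq b <- X | `[< C b >]].
        by apply: Cd => b'; rewrite mem_filter => /andP[/asboolP].
      have [|l [lB lb lX]] := CdX b; first by rewrite mem_filter bX andbT; apply/asboolP.
      have := congr1 l X0; rewrite linear_sum linear0 /= (big_rem b) //= linearZ /= lb.
      rewrite [_ *: _]mulr1 big_seq big1 ?addr0 // => b'.
      rewrite mem_rem_uniq // inE => /andP[/eqP b'b b'X]; rewrite linearZ /=.
      suff -> : l b' = 0 by rewrite scaler0.
      have [Cb'|nCb'] := EM (C b').
        by apply: lX => //; rewrite mem_filter b'X andbT; apply/asboolP.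
      by apply: lB; case: (XE b' b'X) => // /cE[].
    move=> b bX; have [/(cC b bX) //|nCb] := EM (C b).
    apply: (iE [seq b <- X | ~~ `[< C b >]] c); first exact: filter_uniq.
    + move=> b'; rewrite mem_filter => /andP[/asboolPn nC /XE[]//].
    + rewrite big_filter -[RHS]X0 [RHS](bigID (fun b => ~~ `[< C b >])) /=.
      rewrite [X in _ = _ + X]big_seq_cond [X in _ = _ + X]big1 ?addr0 //.
      move=> b' /andP[b'X]; rewrite negbK => /asboolP Cb'.
      by rewrite cC // scale0r.
    + by rewrite mem_filter bX andbT; apply/asboolPn.
exists E; split=> //; first by move=> b /cE[].
by move=> x cx; apply: sE => // t /(_ (BT t)).
Qed.

Variables (M : lmodType A) (q : {linear F -> M}).
Hypothesis q_surj : forall m, exists x, m = q x.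
Hypothesis q_ker : forall x, q x = 0 <-> exists y, dprj (predC p) x = d y.
Hypothesis exactA : exact_coef D A^o.

(* The cokernel is isomorphic to the module of cycles via the differential. *)
Lemma free_cokernel : free_module M.
Proof.
have [E [cE sE iE]] := cycle_basis.
pose bd : {linear F -> F} := @dD A T D A^o \o @dprj A T (predC p) A^o.
have q_bd x : q x = 0 <-> bd x = 0.
  rewrite q_ker; split=> [[y /= ->]|]; first exact: dD_sq.
  by move/(exact_coefP _ _).1: exactA; apply.
have cycle_bd x : cycle x -> exists y, x = bd y.
  case=> dx px; have [y yE] := (exact_coefP _ _).1 exactA x dx.
  exists y; rewrite -px yE /= (dD_dprj (p := predC p)) => [|t s /Dp /= ->].
    by apply: dsum_eq => t; rewrite !coef_dprj /= negbK.
  by rewrite negbK.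
have bd_cycle x : cycle (bd x).
  split; first exact: dD_sq.
  rewrite /= (dD_dprj (p := predC p)) => [|t s /Dp /= ->]; last by rewrite negbK.
  by apply: dsum_eq => t; rewrite !coef_dprj /=; case: (p t).
have /choice[g gP] : forall b, exists y, E b -> b = bd y.
  move=> b; have [/cE/cycle_bd[y yE]|nE] := EM (E b); first by exists y.
  by exists 0.
pose T' : choiceType := {b : F | `[< E b >]}.
pose u (b : T') : F := g (val b).
have uE b : bd (u b) = val b by rewrite -gP //; apply/asboolP; apply: (valP b).
(* As [bd (u b)] is [b], identifying [M] with the cycles through [bd] turns this into the map given
   by the basis [E]. *)
pose f : {linear freemod A T' -> M} := freelift (fun b => q (u b)).
exists T', f.
have finj : injective f.
  move=> x y /eqP; rewrite -subr_eq0 -linearB => /eqP fxy.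
  apply/eqP; rewrite -subr_eq0; apply/eqP; move: (x - y) fxy => {x y} z.
  rewrite /= (freeliftE _ (@fsuppP _ _ z)).
  rewrite (eq_bigr (fun t => q (fcoef z t *: u t))) => [|t _]; last by rewrite linearZ.
  rewrite -linear_sum => /q_bd; rewrite linear_sum => z0.
  pose c b := if insub b is Some t then fcoef z t else 0.
  have cE' (t : T') : c (val t) = fcoef z t by rewrite /c valK.
  have c0 : forall b, b \in [seq val t | t <- fsupp z] -> c b = 0.
    apply: iE.
    - by rewrite (map_inj_uniq val_inj) fset_uniq.
    - by move=> _ /mapP[t _ ->]; apply/asboolP; apply: (valP t).
    - rewrite big_map -[RHS]z0; apply: eq_bigr => t _.
      by rewrite cE' -uE [RHS]linearZ.
  apply: freemod_eq => t; have [tz|/fsuppP //] := boolP (t \in fsupp z).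
  by rewrite -cE' c0 //; apply: map_f.
have fsurj m : exists x, f x = m.
  have [x ->] := q_surj m; have /sE/asboolP[s sE' xE] := bd_cycle x.
  pose y := \sum_(r <- s) r.1 *: g r.2.
  have -> : q x = q y.
    apply/eqP; rewrite -subr_eq0 -linearB; apply/eqP/q_bd.
    apply/eqP; rewrite linearB subr_eq0 xE /y linear_sum; apply/eqP.
    rewrite big_seq [RHS]big_seq; apply: eq_bigr => r /sE' Er.
    by rewrite linearZ -gP.
  have : forall r, r \in s -> exists x, f x = q (r.1 *: g r.2).
    move=> r /sE' /asboolP Er; exists (r.1 *: fdelta (exist _ r.2 Er : T')).
    by rewrite !linearZ /= freelift_delta.
  rewrite /y; elim: s {sE' xE y} => [|r s IH] sf.
    by exists 0; rewrite big_nil !linear0.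
  have [|x1 x1E] := IH; first by move=> r' r's; apply: sf; rewrite inE r's orbT.
  have [x2 x2E] := sf r (mem_head _ _).
  by exists (x2 + x1); rewrite big_cons !linearD x1E x2E.
have [h hP] := choice fsurj.
by exists h => // x; apply: finj; rewrite hP.
Qed.

End FreeCokernel.

(** * The complex of a matrix factorization *)

Section Reduction.
Variables (R : comPzRingType) (w : R) (T : choiceType).
Local Notation S := (quotring (principal w)).
Local Notation pi := (qring (principal w)).

Lemma mem_principal (x : R) : (x : R^o) \in principal w <-> exists r, x = r * w.
Proof.
split=> [|[r ->]].
  apply: (span_min (J := fun x => exists r, x = r * w)) => [|_ ->].
    split; first by exists 0; rewrite mul0r.
      by move=> _ _ [r ->] [s ->]; exists (r + s); rewrite mulrDl.
    by move=> a _ [r ->]; exists (a * r); rewrite mulrA.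
  by exists 1; rewrite mul1r.
by apply: idealMl; apply: mem_span.
Qed.

Lemma qring_eq0 (x : R) : pi x = 0 <-> exists r, x = r * w.
Proof.
rewrite -mem_principal -(rmorph0 pi); split=> [/qring_eqP|xw].
  by rewrite subr0.
by apply/qring_eqP; rewrite subr0.
Qed.

Definition red (x : F R T) : F S T := mkdsum (fun t => pi (coef t x) : S^o).

Lemma coef_red t x : coef t (red x) = pi (coef t x).
Proof.
by rewrite (coef_mk _ (B := supp x)) // => s /coef_supp ->; rewrite rmorph0.
Qed.

Lemma red0 : red 0 = 0.
Proof. by apply: dsum_eq => t; rewrite coef_red !coef0 rmorph0. Qed.

Lemma redD x y : red (x + y) = red x + red y.
Proof. by apply: dsum_eq => t; rewrite coefD !coef_red coefD rmorphD. Qed.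

Lemma redZ (a : R) x : red (a *: x) = pi a *: red x.
Proof. by apply: dsum_eq => t; rewrite coefZ !coef_red coefZ rmorphM. Qed.

Lemma redB x y : red (x - y) = red x - red y.
Proof. by apply: dsum_eq => t; rewrite coefB !coef_red coefB rmorphB. Qed.

Lemma red_e t : red (e R t) = e S t.
Proof.
apply: dsum_eq => s; rewrite coef_red !coef_single.
by case: eqP; rewrite ?rmorph0.
Qed.

Lemma red_dprj (B : pred T) x : red (dprj B x) = dprj B (red x).
Proof.
apply: dsum_eq => t; rewrite coef_red !coef_dprj coef_red.
by case: ifP => // _; rewrite rmorph0.
Qed.

Lemma red_surj y : exists x, y = red x.
Proof.
exists (mkdsum (fun t => if t \in supp y then qrrepr (coef t y) : R^o else 0)).
apply: dsum_eq => t; rewrite coef_red (coef_mk _ (B := supp y)) => [|s /negPf-> //].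
by case: ifPn => [_|/coef_supp->]; rewrite ?qrreprK ?rmorph0.
Qed.

Lemma red_eq0 x : red x = 0 -> exists y, x = w *: y.
Proof.
move=> x0; have /choice[r rP] : forall t, exists r, coef t x = r * w.
  by move=> t; apply/qring_eq0; rewrite -coef_red x0 coef0.
exists (mkdsum (fun t => if t \in supp x then r t : R^o else 0)).
apply: dsum_eq => t; rewrite coefZ (coef_mk _ (B := supp x)) => [|s /negPf-> //].
by case: ifPn => [_|/coef_supp->]; rewrite ?scaler0 // rP mulrC.
Qed.

(** Covers maps beyond the reach of [F_ext]: [red] changes the ring and [derive] is not linear. *)
Lemma F_ind (P : F R T -> Prop) x : P 0 -> (forall y z, P y -> P z -> P (y + z)) ->
  (forall (a : R) t, P (a *: e R t)) -> P x.
Proof. by move=> P0 PD Pe; rewrite (F_expand x); apply: (big_ind P). Qed.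

Lemma red_dD (E : T -> F R T) x : dD (fun t => red (E t)) (red x) = red (dD E x).
Proof.
elim/F_ind: x => [|y z Ey Ez|a t]; first by rewrite red0 !dD0 red0.
  by rewrite redD !dDD redD Ey Ez.
by rewrite redZ red_e !dDZ !dD_e redZ.
Qed.

End Reduction.

Section Derivative.
Variables (R : comPzRingType) (T : choiceType) (del : R -> R).
Hypothesis delD : forall a b, del (a + b) = del a + del b.
Hypothesis delM : forall a b, del (a * b) = del a * b + a * del b.

Lemma del0 : del 0 = 0.
Proof. by apply: (addrI (del 0)); rewrite -delD !addr0. Qed.

Lemma del1 : del 1 = 0.
Proof. by apply: (addrI (del 1)); rewrite addr0 -{3}[1]mulr1 delM mulr1 mul1r. Qed.

Definition derive (x : F R T) : F R T := mkdsum (fun t => del (coef t x) : R^o).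

Lemma coef_derive t x : coef t (derive x) = del (coef t x).
Proof. by rewrite (coef_mk _ (B := supp x)) // => s /coef_supp ->; rewrite del0. Qed.

Lemma derive0 : derive 0 = 0.
Proof. by apply: dsum_eq => t; rewrite coef_derive !coef0 del0. Qed.

Lemma deriveD x y : derive (x + y) = derive x + derive y.
Proof. by apply: dsum_eq => t; rewrite coefD !coef_derive coefD delD. Qed.

Lemma deriveZ (a : R) x : derive (a *: x) = del a *: x + a *: derive x.
Proof. by apply: dsum_eq => t; rewrite coefD !coefZ !coef_derive coefZ delM. Qed.

Lemma derive_e t : derive (e R t) = 0.
Proof.
apply: dsum_eq => s; rewrite coef_derive coef_single coef0.
by case: eqP; rewrite ?del0 ?del1.
Qed.

Lemma derive_dD (E : T -> F R T) x :
  derive (dD E x) = dD (fun t => derive (E t)) x + dD E (derive x).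
Proof.
elim/F_ind: x => [|y z Ey Ez|a t]; first by rewrite derive0 !dD0 derive0 addr0.
  by rewrite deriveD !dDD deriveD Ey Ez addrACA.
by rewrite !dDZ deriveZ derive_e scaler0 addr0 dDZ !dD_e deriveZ addrC.
Qed.

End Derivative.

Section FactorizationComplex.
Variables (R : comPzRingType) (w : R) (X : matfac w).
Local Notation S := (quotring (principal w)).
Local Notation pi := (qring (principal w)).
Local Notation M := (coker X : lmodType S).
Local Notation phi := (mf_phi X).
Local Notation psi := (mf_psi X).

(* Coordinates of both modules of the factorization in a single free module; the
   basis elements marked by p belong to X^1. *)
Lemma matfac_coordinates : exists (T : choiceType) (p : pred T)
    (a : {linear F R T -> mf0 X}) (b : {linear F R T -> mf1 X}),
  [/\ forall x, a x = 0 -> forall t, ~~ p t -> coef t x = 0,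
      forall x, b x = 0 -> forall t, p t -> coef t x = 0,
      forall t, p t -> a (e R t) = 0, forall t, ~~ p t -> b (e R t) = 0 &
      forall u v, exists x, a x = u /\ b x = v].
Proof.
have [T0 [f0 f0b]] := mf_free0 X; have [T1 [f1 f1b]] := mf_free1 X.
pose T : choiceType := (T0 + T1)%type.
pose p : pred T := fun t => if t is inr _ then true else false.
pose a : {linear F R T -> mf0 X} := dlift (fun t : T =>
  if t is inl t0 then scalev (f0 (fdelta t0)) : {linear R^o -> mf0 X} else \0).
pose b : {linear F R T -> mf1 X} := dlift (fun t : T =>
  if t is inr t1 then scalev (f1 (fdelta t1)) : {linear R^o -> mf1 X} else \0).
pose r0 (x : F R T) : F R T0 := mkdsum (fun t => coef (inl t : T) x : R^o).
pose r1 (x : F R T) : F R T1 := mkdsum (fun t => coef (inr t : T) x : R^o).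
have coef_r0 t x : coef t (r0 x) = coef (inl t : T) x.
  rewrite (coef_mk _ (B := [fset s | s in pmap (fun t : T => if t is inl t0 then Some t0 else None) (supp x)]%fset)) //.
  move=> s; rewrite inE mem_pmap => /mapP sx; apply: coef_supp; apply/negP => h.
  by apply: sx; exists (inl s).
have coef_r1 t x : coef t (r1 x) = coef (inr t : T) x.
  rewrite (coef_mk _ (B := [fset s | s in pmap (fun t : T => if t is inr t0 then Some t0 else None) (supp x)]%fset)) //.
  move=> s; rewrite inE mem_pmap => /mapP sx; apply: coef_supp; apply/negP => h.
  by apply: sx; exists (inr s).
have aE x : a x = f0 (to_freemod (r0 x)).
  have r00 : r0 0 = 0 by apply: dsum_eq => t; rewrite coef_r0 !coef0.
  have r0D y z : r0 (y + z) = r0 y + r0 z.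
    by apply: dsum_eq => t; rewrite coefD !coef_r0 coefD.
  have r0Z (c : R) y : r0 (c *: y) = c *: r0 y.
    by apply: dsum_eq => t; rewrite coefZ !coef_r0 coefZ.
  elim/F_ind: x => [|y z Ey Ez|c t]; first by rewrite r00 !linear0.
    by rewrite r0D !linearD Ey Ez.
  rewrite r0Z !linearZ /= dlift_single; congr (_ *: _); case: t => [t|t] /=.
    rewrite /scalev scale1r; congr (f0 _); apply: freemod_eq => s.
    rewrite -[RHS]/(coef s (r0 (e R (inl t : T)))) coef_r0 coef_single.
    by rewrite /fcoef /= -[inl s == inl t]/(s == t); case: eqP.
  rewrite (_ : r0 _ = 0) ?linear0 //; apply: dsum_eq => s.
  by rewrite coef_r0 coef_single coef0.
have bE x : b x = f1 (to_freemod (r1 x)).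
  have r10 : r1 0 = 0 by apply: dsum_eq => t; rewrite coef_r1 !coef0.
  have r1D y z : r1 (y + z) = r1 y + r1 z.
    by apply: dsum_eq => t; rewrite coefD !coef_r1 coefD.
  have r1Z (c : R) y : r1 (c *: y) = c *: r1 y.
    by apply: dsum_eq => t; rewrite coefZ !coef_r1 coefZ.
  elim/F_ind: x => [|y z Ey Ez|c t]; first by rewrite r10 !linear0.
    by rewrite r1D !linearD Ey Ez.
  rewrite r1Z !linearZ /= dlift_single; congr (_ *: _); case: t => [t|t] /=.
    rewrite (_ : r1 _ = 0) ?linear0 //; apply: dsum_eq => s.
    by rewrite coef_r1 coef_single coef0.
  rewrite /scalev scale1r; congr (f1 _); apply: freemod_eq => s.
  rewrite -[RHS]/(coef s (r1 (e R (inr t : T)))) coef_r1 coef_single.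
  by rewrite /fcoef /= -[inr s == inr t]/(s == t); case: eqP.
exists T, p, a, b; split.
- move=> x; rewrite aE => x0 [t _|//]; rewrite -coef_r0.
  have -> : r0 x = 0 by apply: to_freemod_inj; apply: (bij_inj f0b); rewrite x0 !linear0.
  by rewrite coef0.
- move=> x; rewrite bE => x0 [//|t _]; rewrite -coef_r1.
  have -> : r1 x = 0 by apply: to_freemod_inj; apply: (bij_inj f1b); rewrite x0 !linear0.
  by rewrite coef0.
- by case=> // t _; rewrite /= dlift_single.
- by case=> // t _; rewrite /= dlift_single.
- move=> u v; have [g0 _ g0K] := f0b; have [g1 _ g1K] := f1b.
  pose y0 := g0 u; pose y1 := g1 v.
  pose x : F R T := mkdsum (fun t : T => match t with
    inl t0 => fcoef y0 t0 : R^o | inr t1 => fcoef y1 t1 end).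
  have coef_x (t : T) : coef t x = match t with
      inl t0 => fcoef y0 t0 : R^o | inr t1 => fcoef y1 t1 end.
    rewrite (coef_mk _ (B := ([fset (inl t0 : T) | t0 in fsupp y0] `|`
                              [fset (inr t1 : T) | t1 in fsupp y1])%fset)) //.
    move=> s; rewrite in_fsetU => /norP[s0 s1]; case: s s0 s1 => s s0 s1.
      by apply: fsuppP; apply: contra s0 => sy; apply: in_imfset.
    by apply: fsuppP; apply: contra s1 => sy; apply: in_imfset.
  exists x; rewrite aE bE; split.
    rewrite -[RHS]g0K; congr (f0 _); apply: freemod_eq => t.
    by rewrite -[LHS]/(coef t (r0 x)) coef_r0 coef_x.
  rewrite -[RHS]g1K; congr (f1 _); apply: freemod_eq => t.
  by rewrite -[LHS]/(coef t (r1 x)) coef_r1 coef_x.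
Qed.

Hypothesis w_regular : forall x, w * x = 0 -> x = 0.

Lemma factorization_complex : exists (T : choiceType) (p : pred T)
    (D : T -> F S T) (q : {linear F S T -> M}),
  [/\ [/\ forall t, dD D (D t) = 0,
      forall t s, coef s (D t) != 0 -> p s = ~~ p t &
      exact_coef D S^o],
      forall m, exists x, m = q x,
      forall x, q x = 0 <-> exists y, dprj (predC p) x = dD D y &
      forall del : R -> R, (forall a b, del (a + b) = del a + del b) ->
        (forall a b, del (a * b) = del a * b + a * del b) ->
        exists H : T -> F S T, forall t, dD D (H t) + dD H (D t) = pi (del w) *: e S t].
Proof.
have [T [p [a [b [a0 b0 ae be ab]]]]] := matfac_coordinates.
have joint x y : a x = a y -> b x = b y -> x = y.
  move=> /eqP; rewrite -subr_eq0 -linearB => /eqP/a0 axy.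
  move=> /eqP; rewrite -subr_eq0 -linearB => /eqP/b0 bxy.
  apply: dsum_eq => t; apply/eqP; rewrite -subr_eq0 -coefB.
  by have [/bxy->|/axy->] := boolP (p t).
(* [DR] is the odd endomorphism with blocks phi and psi in the chosen coordinates. *)
have /choice[DR DRP] : forall t, exists x, a x = phi (b (e R t)) /\ b x = psi (a (e R t)).
  by move=> t; apply: ab.
have aD x : a (dD DR x) = phi (b x).
  elim/F_ind: x => [|y z Ey Ez|c t]; first by rewrite dD0 !linear0.
    by rewrite dDD !linearD Ey Ez.
  by rewrite dDZ !linearZ /= dD_e; case: (DRP t) => ->.
have bD x : b (dD DR x) = psi (a x).
  elim/F_ind: x => [|y z Ey Ez|c t]; first by rewrite dD0 !linear0.
    by rewrite dDD !linearD Ey Ez.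
  by rewrite dDZ !linearZ /= dD_e; case: (DRP t) => _ ->.
have DDw (x : F R T) : dD DR (dD DR x) = w *: x.
  apply: joint. rewrite aD bD mf_phiK linearZ. done. by rewrite bD aD mf_psiK linearZ.
pose D t : F S T := red w (DR t).
have dred x : dD D (red w x) = red w (dD DR x) by apply: red_dD.
have aprj x : a (dprj (predC p) x) = a x.
  elim/F_ind: x => [|y z Ey Ez|c t]; first by rewrite !linear0.
    by rewrite !linearD /= Ey Ez.
  rewrite !linearZ /=; congr (_ *: _); rewrite dprj_single /=.
  by case: ifPn => //; rewrite negbK => pt; rewrite linear0 ae.
have bprj x : b (dprj (predC p) x) = 0.
  elim/F_ind: x => [|y z Ey Ez|c t]; first by rewrite !linear0.
    by rewrite !linearD /= Ey Ez addr0.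
  rewrite !linearZ /= dprj_single /=.
  by case: ifPn => pt; rewrite ?linear0 ?scaler0 // be // scaler0.
pose q : {linear F S T -> M} :=
  dlift (fun t => scalev (qmod (imp phi) (a (e R t)) : M) : {linear S^o -> M}).
have qred x : q (red w x) = qmod (imp phi) (a x).
  elim/F_ind: x => [|y z Ey Ez|c t]; first by rewrite red0 !linear0.
    by rewrite redD !linearD /= -Ey -Ez.
  rewrite redZ red_e linearZ /= dlift_single /= /scalev scale1r.
  have -> : qmod (imp phi) (a (c *: e R t)) = c *: qmod (imp phi) (a (e R t)).
    by rewrite linearZ linearZ.
  exact: (@ann_scaleE _ _ _ (@coker_ann _ _ X) c (qmod (imp phi) (a (e R t)))).
have imp0 v : qmod (imp phi) v = 0 <-> exists u, v = phi u.
  rewrite -(raddf0 (qmod (imp phi))); split=> [/qmod_eqP|vu].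
    by rewrite subr0 => /asboolP.
  by apply/qmod_eqP; rewrite subr0; apply/asboolP.
exists T, p, D, q; split; [split|..].
- move=> t; rewrite dred -[DR t]dD_e DDw redZ.
  have -> : pi w = 0 by apply/qring_eq0; exists 1; rewrite mul1r.
  by rewrite scale0r.
- move=> t s; rewrite coef_red => nz.
  have {}nz : coef s (DR t) != 0 by apply: contra_neq nz => ->; rewrite rmorph0.
  have [pt|pt] := boolP (p t).
    apply: contraNF nz => ps; apply/eqP; apply: b0 ps.
    by case: (DRP t) => _ ->; rewrite ae // linear0.
  apply: contraNT nz => ps; apply/eqP; apply: a0 ps.
  by case: (DRP t) => -> _; rewrite be // linear0.
- apply/exact_coefP => x; have [y ->] := red_surj x.
  rewrite dred => /red_eq0[z zE].
  (* From DR y = w z follows w y = DR (DR y) = w (DR z), and [w] cancels. *)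
  suff -> : y = dD DR z by exists (red w z); rewrite dred.
  apply/eqP; rewrite -subr_eq0; apply/eqP.
  have : w *: (y - dD DR z) = 0 by rewrite -DDw dDB zE DDw subrr dD0.
  move=> wyz; apply: dsum_eq => t; rewrite coef0; apply: w_regular.
  have -> : w * coef t (y - dD DR z) = coef t (w *: (y - dD DR z)) by rewrite coefZ.
  by rewrite wyz coef0.
- move=> m; have [x [ax _]] := ab (qrepr (m : quotmod (imp phi))) 0.
  by exists (red w x); rewrite qred ax qreprK.
- move=> x; have [y ->] := red_surj x; rewrite qred imp0; split=> [[u ayu]|[x' E]].
    have [x' [ax' bx']] := ab 0 u; exists (red w x'); rewrite dred -red_dprj.
    congr (red w _); apply: joint; first by rewrite aprj aD bx'.
    by rewrite bprj bD ax' linear0.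
  have [x1 x1E] := red_surj x'; move: E; rewrite x1E dred -red_dprj => E.
  have [|z zE] := @red_eq0 R w T (dprj (predC p) y - dD DR x1).
    by rewrite redB E subrr.
  (* The error w (a z) equals phi (psi (a z)), so it lies in the image of phi: reducing modulo [w]
     does not change the cokernel. *)
  exists (b x1 + psi (a z)); rewrite linearD mf_phiK -aD -[w *: _]linearZ -linearD.
  by rewrite -zE addrC subrK aprj.
(* The homotopy is the entrywise derivative of [DR]. Leibniz's rule is applied over [R], before
   reduction, because a derivation of [R] need not preserve the ideal of [w]. *)
- move=> del delD delM; exists (fun t => red w (derive del (DR t))) => t.
  rewrite dred red_dD -redD addrC -(derive_dD delD delM) -{1}[DR t]dD_e DDw.
  by rewrite (deriveZ delD delM) (derive_e delD delM) scaler0 addr0 redZ red_e.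
Qed.

End FactorizationComplex.

(** * Ideals of [S] and isolated singularities *)

Section QuotientIdeals.
Variables (R : comNzRingType) (w : R) (m : submodClosed R^o).
Hypotheses (noethR : max_condition R) (wm : (w : R^o) \in m).
Hypotheses (mp : primeP (fun x : R => (x : R^o) \in m)).
Hypothesis mu : forall s : R, (s : R^o) \notin m -> exists t, t * s = 1.
Local Notation S := (quotring (principal w)).
Local Notation pi := (qring (principal w)).

Lemma max_condition_quot (I : submodClosed R^o) : max_condition (quotring I).
Proof.
move=> C CI [J0 CJ0].
pose pre (J : quotring I -> Prop) := fun x : R => J (qring I x).
have [|| K [J CJ ->] Jmax] := noethR (F := fun K => exists2 J, C J & K = pre J).
- move=> _ [J /CI[J00 JD JM] ->]; rewrite /pre; split; first by rewrite rmorph0.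
    by move=> x y Jx Jy; rewrite rmorphD; apply: JD.
  by move=> a x Jx; rewrite rmorphM; apply: JM.
- by exists (pre J0), J0.
exists J => // J' CJ' JJ' s; rewrite -[s]qrreprK => J's.
apply: (Jmax (pre J')) => //; first by exists J'.
by move=> x; apply: JJ'.
Qed.

(** The maximal ideal of [S]; since [w] is in [m], the choice of representative does not matter. *)
Definition max_quot (s : S) : Prop := (qrrepr s : R^o) \in m.

Lemma max_quotE (x : R) : max_quot (pi x) <-> (x : R^o) \in m.
Proof.
have [[m0 mD mM] _ _] := mp.
have xw : (qrrepr (pi x) - x : R^o) \in m.
  have /mem_principal[r ->] : (qrrepr (pi x) - x : R^o) \in principal w.
    by apply/qring_eqP; rewrite qrreprK.
  exact: mM.
split=> h; last by rewrite /max_quot -(subrK x (qrrepr (pi x))); apply: mD.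
rewrite -[x](subKr (qrrepr (pi x))); apply: mD => //.
by rewrite -mulN1r; apply: mM.
Qed.

Lemma max_quot_ideal : idealP max_quot.
Proof.
have [[m0 mD mM] _ _] := mp; split.
- by rewrite -(rmorph0 pi) max_quotE.
- by move=> x y; rewrite -[x]qrreprK -[y]qrreprK -rmorphD !max_quotE; apply: mD.
- by move=> a x; rewrite -[x]qrreprK -[a]qrreprK -rmorphM !max_quotE; apply: mM.
Qed.

Lemma max_quot1 : ~ max_quot 1.
Proof. by rewrite -(rmorph1 pi) max_quotE; case: mp. Qed.

Lemma max_quot_unit s : ~ max_quot s -> exists t, t * s = 1.
Proof.
rewrite -[s]qrreprK max_quotE => /negP/mu[t tE].
by exists (pi t); rewrite -rmorphM tE rmorph1.
Qed.

Lemma max_quot_prime_incl P : primeP P -> forall s, P s -> max_quot s.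
Proof.
move=> [[_ _ PM] P1 _] s Ps; apply: contrapT => /max_quot_unit[t tE].
by apply: P1; rewrite -tE; apply: PM.
Qed.

End QuotientIdeals.

Lemma dependent_family (k : fieldType) n (c : 'I_n.+1 -> 'I_n -> k) :
  exists2 v : 'I_n.+1 -> k, (exists i, v i != 0) &
    forall j, \sum_i v i * c i j = 0.
Proof.
pose C := \matrix_(i, j) c i j.
have : kermx C != 0.
  by rewrite kermx_eq0 /row_free neq_ltn ltnS rank_leq_col.
case/rowV0Pn => v /sub_kermxP vC v0; exists (fun i => v 0 i).
  have /rV0Pn[i vi] := v0; by exists i.
move=> j; have := congr1 (fun X : 'rV_n => X 0 j) vC; rewrite !mxE => E.
by rewrite -[RHS]E; apply: eq_bigr => i _; rewrite mxE.
Qed.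

Lemma span_range_coords (k : pzRingType) (V : lmodType k) r (b : 'I_r -> V) (v : V) :
  v \in span (range b) -> exists c : 'I_r -> k, v = \sum_j c j *: b j.
Proof.
case/asboolP => s sb ->; elim: s sb => [|q s IH] sb.
  by exists (fun=> 0); rewrite big_nil big1 // => j _; rewrite scale0r.
have [|c cE] := IH; first by move=> q' q's; apply: sb; rewrite inE q's orbT.
have [j _ jE] := sb q (mem_head _ _).
exists (fun l => c l + q.1 * (l == j)%:R); rewrite big_cons cE -jE.
rewrite [RHS](eq_bigr (fun l => c l *: b l + (q.1 * (l == j)%:R) *: b l)); last first.
  by move=> l _; rewrite scalerDl.
rewrite [RHS]big_split /= addrC; congr (_ + _).
rewrite [RHS](bigD1 j) //= eqxx mulr1 big1 ?addr0 // => l /negPf->.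
by rewrite mulr0 scale0r.
Qed.

Lemma fingen_dependent (k : fieldType) (V : lmodType k) (v : nat -> V) : fingen V ->
  exists2 l : seq k, has (fun c => c != 0) l & \sum_(i < size l) l`_i *: v i = 0.
Proof.
case=> r [b bspan].
have /choice[c cE] : forall i : 'I_r.+1, exists c : 'I_r -> k, v i = \sum_j c j *: b j.
  by move=> i; apply: span_range_coords.
have [x [i xi] xc] := dependent_family c.
exists [seq x i | i <- enum 'I_r.+1].
  by apply/hasP; exists (x i) => //; apply: map_f; rewrite mem_enum.
rewrite size_map size_enum_ord.
rewrite (eq_bigr (fun j : 'I_r.+1 => \sum_l (x j * c j l) *: b l)); last first.
  move=> j _; rewrite (nth_map j) ?size_enum_ord // nth_ord_enum cE scaler_sumr.
  by apply: eq_bigr => l _; rewrite scalerA.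
rewrite exchange_big big1 //= => l _.
by rewrite -scaler_suml xc scale0r.
Qed.

Section Jacobian.
Variables (k : fieldType) (R : comAlgType k) (w : R) (m : submodClosed R^o).
Hypotheses (wm : (w : R^o) \in m).
Hypotheses (mp : primeP (fun x : R => (x : R^o) \in m)).
Hypothesis mu : forall s : R, (s : R^o) \notin m -> exists t, t * s = 1.
Variables (n : nat) (D : 'I_n -> {linear R -> R}).
Local Notation S := (quotring (principal w)).
Local Notation pi := (qring (principal w)).
Local Notation Om := (Omega w D).

Lemma jacobian_incl (I : S -> Prop) : idealP I -> (forall i, I (pi (D i w))) ->
  forall s : S, (s : S^o) \in jacobian_ideal w D -> I s.
Proof. by move=> II ID; apply: span_min => // _ [i ->]. Qed.

(* A prime ideal containing the Jacobian ideal has a residue ring which is finite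
   dimensional over k, hence algebraic. *)
Lemma isolated_prime P : isolated_singularity w D -> primeP P ->
  (forall i, P (pi (D i w))) -> forall s, max_quot m s <-> P s.
Proof.
move=> iso Pp PD y; split; last exact: max_quot_prime_incl.
move=> ym; case: (Pp) => PI P1 PM; case: (PI) => P0 Padd Pmul.
pose io (c : k) : S := pi (c%:A).
have io0 : io 0 = 0 by rewrite /io scale0r rmorph0.
have ioN0 c : c != 0 -> ~ max_quot m (io c).
  move=> c0 mc; apply: (max_quot1 wm mp).
  have -> : 1 = io c^-1 * io c by rewrite /io -rmorphM -scalerAl mul1r scalerA mulVf // scale1r rmorph1.
  by have [_ _ mM] := max_quot_ideal wm mp; apply: mM.
(* Horner's form of the polynomial with coefficients [l], evaluated at [y]. *)
pose ev (l : seq k) : S := foldr (fun c z => io c + y * z) 0 l.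
(* A non-zero constant coefficient would be a unit inside the maximal ideal. A zero one leaves a
   factor [y], which [P] either contains or allows to be cancelled. *)
have evP l : P (ev l) -> has (fun c => c != 0) l -> P y.
  elim: l => [//|c l IH] /= Pcl; have [c0|c0] := eqVneq c 0.
    move: Pcl; rewrite c0 io0 add0r => /PM[//|Pl /=]; exact: IH.
  have [_ mD mM] := max_quot_ideal wm mp.
  case: (ioN0 c c0); rewrite -(addrK (y * ev l) (io c)).
  apply: idealB; [exact: max_quot_ideal | exact: max_quot_prime_incl Pcl |].
  by rewrite mulrC; apply: mM.
pose pr : S -> restr Om^o (Omega_proj w D \o pi \o in_alg R) := Omega_proj w D.
have prZ c z : c *: pr z = pr (io c * z) by symmetry; apply: rmorphM.
have prD : {morph pr : x z / x + z >-> x + z} by apply: rmorphD.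
have pr0 : pr 0 = 0 by apply: rmorph0.
have [l lnz l0] := fingen_dependent (fun i => pr (y ^+ i)) iso.
apply: (evP l) => //; apply: (jacobian_incl PI PD).
have evE (l' : seq k) : ev l' = \sum_(i < size l') io l'`_i * y ^+ i.
  elim: l' => [|a l' IH] /=; first by rewrite big_ord0.
  rewrite big_ord_recl expr0 mulr1 IH mulr_sumr; congr (_ + _).
  by apply: eq_bigr => j _; rewrite exprS mulrCA.
have prl : pr (ev l) = 0.
  rewrite evE (big_morph pr prD pr0) -[RHS]l0.
  by apply: eq_bigr => j _; rewrite prZ.
have : qring (jacobian_ideal w D) (ev l) = qring (jacobian_ideal w D) 0.
  by rewrite rmorph0; apply: prl.
by move/qring_eqP; rewrite subr0.
Qed.

Lemma fingen_restr (N : lmodType Om) : fingen N -> fingen (restr N (Omega_proj w D)).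
Proof.
case=> r [b bspan]; exists r, (b : 'I_r -> restr N (Omega_proj w D)) => v.
have /asboolP[s sb ->] := bspan v; apply/asboolP.
exists [seq (qrrepr q.1, q.2 : restr N (Omega_proj w D)) | q <- s].
  by move=> q /mapP[q' /sb [j _ jE] ->]; exists j.
rewrite big_map; apply: eq_bigr => q _.
by rewrite -[RHS]/(Omega_proj w D (qrrepr q.1) *: q.2) -[Omega_proj w D _]/(qring _ (qrrepr q.1)) qrreprK.
Qed.

Variables (T : choiceType) (E : T -> F S T).

(** As [I] contains the Jacobian ideal, S/I is a cyclic module over [Omega w D], so the hypothesis
    on finitely generated modules reaches it. *)
Lemma exact_mod_jacobian (I : S -> Prop) : idealP I -> (forall i, I (pi (D i w))) ->
  (forall N : lmodType Om, fingen N -> exact_coef E (restr N (Omega_proj w D))) ->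
  @exact_mod S T E S^o I.
Proof.
move=> II ID HN; pose I' (o : Om) := I (qrrepr o).
have I'E s : I' (Omega_proj w D s) <-> I s.
  have js : I (qrrepr (Omega_proj w D s) - s).
    by apply: (jacobian_incl II ID); apply/qring_eqP; rewrite qrreprK.
  case: (II) => I0 IA IM; split=> h.
    rewrite -[s](subKr (qrrepr (Omega_proj w D s))); apply: idealB => //.
  by rewrite /I' -(subrK s (qrrepr _)); apply: IA.
have I'I : idealP I'.
  case: (II) => I0 IA IM; split; first by rewrite -(rmorph0 (Omega_proj w D)) I'E.
    by move=> x z; rewrite -[x]qrreprK -[z]qrreprK -rmorphD !I'E; apply: IA.
  by move=> x z; rewrite -[x]qrreprK -[z]qrreprK -rmorphM !I'E; apply: IM.
pose N : lmodType Om := quotmod (mkideal I'I).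
have NE (o : Om) : o *: (qmod (mkideal I'I) (1 : Om) : N) = qmod (mkideal I'I) o.
  by rewrite -linearZ /= -[in RHS](mulr1 o).
have fN : fingen N.
  exists 1%N, (fun=> qmod (mkideal I'I) (1 : Om)) => v.
  have -> : v = (qrepr v : Om) *: (qmod (mkideal I'I) (1 : Om) : N) by rewrite NE qreprK.
  by apply: mem_spanZ; exists ord0.
have := HN N fN.
pose u : restr N (Omega_proj w D) := qmod (mkideal I'I) (1 : Om).
have uE s : scalev u s = qmod (mkideal I'I) (Omega_proj w D s) by rewrite -NE.
move/(exact_mod_quot (f := scalev u)) => HI.
apply: exact_mod_ext (HI _) => [s|v]; last first.
  by exists (qrrepr (qrepr (v : quotmod _))); rewrite /= uE -[LHS]qreprK -{1}[qrepr _]qrreprK.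
rewrite /= uE -(raddf0 (qmod _)) -I'E; split=> [/qmod_eqP|Is].
  by rewrite subr0 => /mem_mkideal.
by apply/qmod_eqP; rewrite subr0; apply/mem_mkideal.
Qed.

Lemma residue_scale s (wm' : (w : R^o) \in m) :
  scalev (qmod m (1 : R) : residue_module wm') s = qmod m (qrrepr s : R).
Proof.
rewrite -[LHS]/(qrrepr s *: qmod m (1 : R)) -linearZ /=.
by congr (qmod m _); apply: mulr1.
Qed.

Lemma residue_cyclic (wm' : (w : R^o) \in m) (v : residue_module wm') :
  exists s : S, v = scalev (qmod m (1 : R) : residue_module wm') s.
Proof.
exists (pi (qrepr (v : quotmod m))); rewrite residue_scale -[LHS]qreprK.
apply/qmod_eqP; rewrite -opprB; have [mI _ _] := mp; apply: (idealN mI).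
have /mem_principal[t ->] : (qrrepr (pi (qrepr (v : quotmod m))) - qrepr (v : quotmod m) : R^o) \in principal w.
  by apply/qring_eqP; rewrite qrreprK.
by case: mI => _ _; apply.
Qed.

Lemma fingen_residue (wm' : (w : R^o) \in m) : fingen (residue_module wm').
Proof.
exists 1%N, (fun=> (qmod m (1 : R) : residue_module wm')) => v.
by have [s ->] := residue_cyclic v; apply: mem_spanZ; exists ord0.
Qed.

Lemma exact_mod_residue (wm' : (w : R^o) \in m) :
  exact_coef E (residue_module wm') -> @exact_mod S T E S^o (max_quot m).
Proof.
move/(exact_mod_quot (f := scalev (qmod m (1 : R) : residue_module wm'))) => HI.
apply: exact_mod_ext (HI _) => [s|v]; last exact: residue_cyclic.
rewrite /= residue_scale -(raddf0 (qmod m)); split=> [/qmod_eqP|ms].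
  by rewrite subr0.
by apply/qmod_eqP; rewrite subr0.
Qed.

End Jacobian.

(** * The equivalences *)

Theorem theorem4p7 (k : fieldType) (R : comAlgType k)
    (m : submodClosed R^o) (n : nat)
    (regR : @regular_local R m n) (resR : residue_field_is m)
    (w : R) (wm : (w : R^o) \in m) (w0 : w != 0)
    (D : 'I_n -> {linear R -> R}) (derD : forall i, derivation (D i))
    (X : matfac w) :
  let S := quotring (principal w) in
  let M : lmodType S := coker X in
  let cond3 := forall N : lmodType S, fingen N ->
    forall i : nat, (0 < i)%N -> zero_module (Tor i N M) in
  let cond4 := forall N : lmodType (Omega w D), fingen N ->
    forall i : nat, (0 < i)%N ->
      zero_module (Tor i (restr N (Omega_proj w D)) M) in
  let cond5 := forall i : nat, (0 < i)%N ->
    zero_module (Tor i (residue_module wm) M) in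
  [<-> free_module M; flat_module M; cond3; cond4] /\
  (isolated_singularity w D ->
    [<-> free_module M; flat_module M; cond3; cond4; cond5]).
Proof.
move=> S M cond3 cond4 cond5.
have wreg (x : R) : w * x = 0 -> x = 0.
  by move/(regular_local_domain regR)=> [/eqP|//]; rewrite (negPf w0).
have [noeR mloc _ _] := regR.
have noethR := noetherian_max noeR.
have mp := local_prime noethR mloc; have mu := local_unit noethR mloc.
have noethS : max_condition S by apply: max_condition_quot.
have mxI := max_quot_ideal wm mp; have mx1 := max_quot1 wm mp.
have mxu := max_quot_unit wm mp mu.
have [T [p [E [q [[dd0 Ep exS] q_surj q_ker homot]]]]] := factorization_complex X wreg.
(* The common target of (4) and (5), which differ only in how they supply exactness modulo ideals
   containing all the d_i w. *)
have ideals_free : (forall I : S -> Prop, idealP I -> (forall i, I (qring (principal w) (D i w))) ->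
    @exact_mod S T E S^o I) -> free_module M.
  move=> HJ; apply: (free_cokernel dd0 Ep _ mxI mx1 mxu q_surj q_ker exS).
  apply: (cycle_contraction dd0).
  apply: (exact_mod_noetherian dd0 (a := fun i => qring (principal w) (D i w)) noethS) => // i.
  by apply: homot; [exact: raddfD | exact: derD].
have h12 : free_module M -> flat_module M by apply: free_flat.
have h23 : flat_module M -> cond3.
  by move=> flM N _ [//|i] _; apply: flat_tor_zero.
have h34 : cond3 -> cond4.
  by move=> c3 N fN; apply: c3; apply: fingen_restr.
have h41 : cond4 -> free_module M.
  move=> c4; apply: ideals_free => I II ID; apply: (exact_mod_jacobian II ID) => N fN.
  by apply: (tor_zero_exact dd0 Ep q_surj q_ker exS); apply: c4.
split=> [|iso]; first by tfae.
have h45 : cond4 -> cond5.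
  by move/h41/h12/h23; apply; apply: fingen_residue.
have h51 : cond5 -> free_module M.
  move=> c5; apply: ideals_free => I II ID.
  apply: (exact_mod_isolated dd0 (a := fun i => qring (principal w) (D i w)) noethS _ _ II ID).
    by move=> P Pp PD; apply: (isolated_prime wm mp mu iso Pp PD).
  apply: (exact_mod_residue mp (wm' := wm)).
  exact: (tor_zero_exact dd0 Ep q_surj q_ker exS).
by tfae.
Qed.
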